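(* Let $\ell_N=N^{4/5}$ if $d=1$; let $\ell_N$ be defined by $\ell_N^3\log \ell_N=N^2$ if $d=2$; and let $\ell_N=N^{4/(3d)}$ if $d\ge 3$. Assume that $\lim_{N\to\infty}K_N=\infty$ and $\sup_{N\ge1}K_N^2/\ell_N^d<\infty$. Then there exists a constant $\mathfrak c(\boldsymbol u^N)$, depending only on $\boldsymbol u^N$ and uniformly bounded in $N$, such that $$\frac{d}{dt}H_N(f^N_t)\;\le\;\mathfrak c(\boldsymbol u^N)\,K_N^2\,\big\{H_N(f^N_t)+(N/\ell_N)^d\big\}$$ for all $t\ge0$, $N\ge1$.
   Context: Fix $d\ge1$. $\mathbb T_N=\mathbb Z/N\mathbb Z$, $\Omega_N=\{0,1\}^{\mathbb T_N^d}$, $\{e_1,\dots,e_d\}$ is the canonical basis of $\mathbb R^d$. For $\eta\in\Omega_N$, $T^{x,y}\eta$ is obtained from $\eta$ by exchanging $\eta_x$ and $\eta_y$, $T^x\eta$ by replacing $\eta_x$ by $1-\eta_x$, and $(\tau_x\eta)_z=\eta_{x+z}$. Let $(L^E_Nf)(\eta)=\sum_{x\in\mathbb T_N^d}\sum_{j=1}^d\{f(T^{x,x+e_j}\eta)-f(\eta)\}$ and $(L^G_Nf)(\eta)=\sum_{x\in\mathbb T_N^d}c_0(\tau_x\eta)[f(T^x\eta)-f(\eta)]$, where, with $\sigma_x=2\eta_x-1$, $c_0(\eta)=1-\gamma\sigma_0[\sigma_{-e_1}+\sigma_{e_1}]+\gamma^2\sigma_{-e_1}\sigma_{e_1}$ and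 $1/2<\gamma<1$ is fixed. $(K_N)$ is an increasing sequence of positive numbers with $K_N\to\infty$, $K_N/N\to0$. $L_N=N^2L^E_N+K_NL^G_N$ generates the Markov chain $\eta^N(t)$ on $\Omega_N$, with semigroup $S^N(t)$. $V:[0,1]\to\mathbb R$ is a potential with $V'(\rho)=-(2\gamma-1)(2\rho-1)+\gamma^2(2\rho-1)^3$; the zeros of $V'$ are $0<\rho_-<\rho^*=1/2<\rho_+<1$. For $K=K_N$ (assumed such that it exists), $\rho^K:\sqrt K\,\mathbb T\to(0,1)$ ($\sqrt K\,\mathbb T$ the torus of length $\sqrt K$) is the unique $\sqrt K$-periodic solution of $\partial_\vartheta^2\rho^K-V'(\rho^K)=0$ taking the value $\rho^*$ at exactly two points of $\sqrt K\,\mathbb T$, with $\rho^K(0)=\rho^*$, $\partial_\vartheta\rho^K(0)<0$. Set $\boldsymbol u^N(x_1,\dots,x_d)=\rho^{K_N}(x_1\sqrt{K_N}/N)$, $x\in\mathbb T_N^d$, and let $\nu^N$ be the product measure on $\Omega_N$ with $\nu^N\{\eta_x=1\}=\boldsymbol u^N(x)$. $f^N_t=\dfrac{d\,\nu^NS^N(t)}{d\nu^N}$ is the density at time $t$ of the law of the process started from $\nu^N$, and $H_N(f)=\int f\log f\,d\nu^N$ for a density $f$ with respect to $\nu^N$. *)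

(* Defs.v *)
From mathcomp Require Import all_boot all_order all_algebra.
From mathcomp Require Import all_classical all_reals all_analysis.
Import Order.TTheory GRing.Theory Num.Theory.
Import numFieldNormedType.Exports.

Set Implicit Arguments.
Unset Strict Implicit.
Unset Printing Implicit Defensive.

Local Open Scope ring_scope.

(* For d, N >= 1 the type 'I_N.-1.+1 is 'I_N with its group structure of
   integers mod N (unlike 'Z_N, this is also right for N = 1), and
   'I_d.-1.+1 is 'I_d with ord0 available as the first coordinate.  The values
   at d = 0 or N = 0 are junk. *)
Definition torus (d N : nat) := {ffun 'I_d.-1.+1 -> 'I_N.-1.+1}.

Definition basis_vec (d N : nat) (j : 'I_d.-1.+1) : torus d N :=
  [ffun i => if i == j then inZp 1 else 0].
Arguments basis_vec {d N} j.

Definition config (d N : nat) := {ffun torus d N -> bool}.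

Definition exchange (d N : nat) (x y : torus d N) (eta : config d N) :
    config d N :=
  [ffun z => if z == x then eta y else if z == y then eta x else eta z].

Definition flip (d N : nat) (x : torus d N) (eta : config d N) : config d N :=
  [ffun z => if z == x then ~~ eta z else eta z].

Definition translate (d N : nat) (x : torus d N) (eta : config d N) :
    config d N :=
  [ffun z => eta (x + z)].

Section Dynamics.
Variables (R : realType) (d N : nat).
Implicit Types (f nu : config d N -> R) (eta xi : config d N).

Definition spin eta (x : torus d N) : R := 2 * (eta x)%:R - 1.

Definition glauber_rate (gamma : R) eta : R :=
  1 - gamma * spin eta 0 *
        (spin eta (- basis_vec ord0) + spin eta (basis_vec ord0))
  + gamma ^+ 2 * spin eta (- basis_vec ord0) * spin eta (basis_vec ord0).

Definition exclusion_gen f eta : R :=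
  \sum_(x : torus d N) \sum_(j < d.-1.+1)
    (f (exchange x (x + basis_vec j) eta) - f eta).

Definition glauber_gen (gamma : R) f eta : R :=
  \sum_(x : torus d N)
    glauber_rate gamma (translate x eta) * (f (flip x eta) - f eta).

Definition generator (gamma K : R) f eta : R :=
  N%:R ^+ 2 * exclusion_gen f eta + K * glauber_gen gamma f eta.

(* The state space is finite, so the semigroup is the exponential series
   exp(t L). *)
Definition semigroup (gamma K t : R) f eta : R :=
  limn (series (fun n : nat =>
    t ^+ n / n`!%:R * iter n (generator gamma K) f eta)).

(* nu S(t), as a probability mass function *)
Definition law_at (gamma K t : R) nu eta : R :=
  \sum_(xi : config d N)
    nu xi * semigroup gamma K t (fun zeta => (zeta == eta)%:R) xi.

Definition density (gamma K t : R) nu eta : R :=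
  law_at gamma K t nu eta / nu eta.

(* ln 0 = 0 in the library, so 0 log 0 = 0 *)
Definition entropy nu f : R :=
  \sum_(eta : config d N) nu eta * (f eta * ln (f eta)).

Definition product_measure (u : torus d N -> R) eta : R :=
  \prod_(x : torus d N) (if eta x then u x else 1 - u x).

(* rho is meant to be (sqrt K)-periodic, so the choice of the representative
   of x_1 in {0, ..., N-1} is immaterial. *)
Definition profile_on_torus (K : R) (rho : R -> R) (x : torus d N) : R :=
  rho ((x ord0 : nat)%:R * Num.sqrt K / N%:R).

End Dynamics.

Definition dpotential (R : realType) (gamma rho : R) : R :=
  - (2 * gamma - 1) * (2 * rho - 1) + gamma ^+ 2 * (2 * rho - 1) ^+ 3.

(* A function on the torus of length sqrt K is a (sqrt K)-periodic function on
   the line; [0, sqrt K[ is a fundamental domain, in which 0 and theta1 are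
   the two points where rho takes the value 1/2. *)
Definition is_profile (R : realType) (gamma K : R) (rho : R -> R) : Prop :=
  [/\ forall theta, rho (theta + Num.sqrt K) = rho theta,
      forall theta, 0 < rho theta < 1,
      forall theta,
        [/\ derivable rho theta 1, derivable (derive1 rho) theta 1
          & derive1 (derive1 rho) theta - dpotential gamma (rho theta) = 0],
      exists2 theta1, 0 < theta1 < Num.sqrt K &
        forall theta, 0 <= theta < Num.sqrt K ->
          (rho theta = 1 / 2 <-> theta = 0 \/ theta = theta1)
    & derive1 rho 0 < 0].

(* For N >= 1 the equation of the case d = 2 has a unique solution, which is
   larger than 1. *)
Definition is_scale (R : realType) (d N : nat) (l : R) : Prop :=
  match d with
  | 1 => l = N%:R `^ (4 / 5)
  | 2 => 0 < l /\ l ^+ 3 * ln l = N%:R ^+ 2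
  | _ => l = N%:R `^ (4 / (3 * d%:R))
  end.

(* Main.v *)
Require Import Defs.
From mathcomp Require Import all_boot all_order all_algebra.
From mathcomp Require Import all_classical all_reals all_analysis.
From mathcomp Require Import zify ring lra.
Import Order.TTheory GRing.Theory Num.Theory.
Import numFieldNormedType.Exports.

(** Yau's relative entropy method.  The entropy production inequality reads
    [H' <= E(f L^* 1) - N^2 D(sqrt f)], where [E] is the expectation under the
    product measure, [L^*] the adjoint of the generator with respect to it and
    [D] the Dirichlet form of the exclusion dynamics.  With
    [w_x = eta_x - u x], the equation [rho'' = V'(rho)] cancels the terms of
    [L^* 1] of degree one up to [O(K^2 / N^2)] per site, and what remains is
    [K] times a sum of local monomials [psi_x omega_{x+e_1}], where [psi_x] is
    [w_x] times a function of [eta_{x-e_1}].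

    One replaces [omega] by its averages over boxes of side [m] in one
    direction if [d = 1] and in two directions if [d >= 2], with [m] of order
    [N] and [N^{2/3}] respectively.  Each replacement is a sum of gradients
    [h_z (omega_z - omega_{z+e_j})], which an integration by parts bounds by
    [N^2 D / 4 + C (K^2 / N^2) sum E(f h_z^2)]; the inhomogeneity of the
    measure leaves a martingale-like remainder in direction [e_1].  All the
    resulting quadratic functionals are controlled by the entropy inequality
    and by exponential moments, which come from integrating out the sites one
    at a time.  The choice of [m] makes the error [m N^{d-2} + N^d / m^2]
    (for [d >= 2]) of order at most [(N / ell)^d]. *)

Set Implicit Arguments.
Unset Strict Implicit.
Unset Printing Implicit Defensive.
Local Open Scope classical_set_scope.
Local Open Scope ring_scope.

(** * Expectations under the product measure *)

Section Expectation.
Variables (R : realType) (d N : nat).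
Local Notation T := (torus d N).
Local Notation conf := (config d N).
Implicit Types (u : T -> R) (F G f : conf -> R) (eta : conf) (x y z : T).

(** The box averages of [psi] run backwards in direction [e_1], those of [omega_{x+e_1}] forwards.
    Hence the factor [h_z] never depends on the two sites exchanged by the gradient it multiplies,
    as the integration by parts requires, and in the remainder each [w_y] multiplies a function of
    sites strictly behind [y]. Since a torus has no global order, every argument that relies on one
    is carried out after a cut along a hyperplane or a strip. Two kinds of exponential estimate
    result: sums that are linear in the latest [w] are peeled, while squares of box sums are sorted
    into colour classes of disjoint boxes. Each averaging is done twice, so that both factors of the
    bilinear term end up averaged. A quarter of the Dirichlet form per flow is affordable because
    there are four flows, two per direction. Powers of [K] below [K^2] are absorbed because the
    existence of a periodic profile forces [K >= 1/2]. The boxes do not fit into small tori, so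
    [N < 1000] is treated by a crude bound. The final constant depends on [d] and [gamma] only. *)

Definition expect u F : R := \sum_(eta : conf) product_measure u eta * F eta.

Definition set_site x (b : bool) eta : conf :=
  [ffun z => if z == x then b else eta z].

Definition site_free x F := forall b eta, F (set_site x b eta) = F eta.

Definition cond_site u x F eta : R :=
  u x * F (set_site x true eta) + (1 - u x) * F (set_site x false eta).

Definition centered u x eta : R := (eta x)%:R - u x.

Lemma set_site_self x eta : set_site x (eta x) eta = eta.
Proof. by apply/ffunP => z; rewrite ffunE; case: eqP => [->|]. Qed.

Lemma set_site_set x b b' eta : set_site x b (set_site x b' eta) = set_site x b eta.
Proof. by apply/ffunP => z; rewrite !ffunE; case: eqP. Qed.

Lemma set_siteC x y b b' eta : x != y ->
  set_site x b (set_site y b' eta) = set_site y b' (set_site x b eta).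
Proof.
move=> xy; apply/ffunP => z; rewrite !ffunE.
by case: eqP => // ->; rewrite (negbTE xy).
Qed.

Lemma flipK x : involutive (@flip d N x).
Proof.
by move=> eta; apply/ffunP => z; rewrite !ffunE; case: eqP => // _; rewrite negbK.
Qed.

Lemma flip_set_site x eta : flip x eta = set_site x (~~ eta x) eta.
Proof. by apply/ffunP => z; rewrite !ffunE; case: eqP => [->|]. Qed.

Lemma measure_set_site u x b eta :
  product_measure u (set_site x b eta) =
  (if b then u x else 1 - u x) *
    \prod_(z | z != x) (if eta z then u z else 1 - u z).
Proof.
rewrite /product_measure (bigD1 x) //= ffunE eqxx; congr (_ * _).
by apply: eq_bigr => z zx; rewrite ffunE (negbTE zx).
Qed.

Lemma eq_expect u F G : (forall eta, F eta = G eta) -> expect u F = expect u G.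
Proof. by move=> FG; apply: eq_bigr => eta _; rewrite FG. Qed.

(** The difference of both sides, weighted by the measure, changes sign under the flip at [x], so
    its sum [S] equals [- S]. *)
Lemma expect_cond_site u x F : expect u (cond_site u x F) = expect u F.
Proof.
apply/eqP; rewrite -subr_eq0 -sumrB; apply/eqP.
set S := \sum_(eta : conf) _.
suff : S + S = 0 by lra.
rewrite {2}/S (reindex_inj (inv_inj (@flipK x))) /S -big_split /= big1 // => eta _.
rewrite !flip_set_site /cond_site !set_site_set -{1 4 7}(set_site_self x eta).
rewrite -[in F eta](set_site_self x eta) !set_site_set.
by rewrite !measure_set_site; case: (eta x) => /=; ring.
Qed.

Lemma expectD u F G : expect u (fun eta => F eta + G eta) = expect u F + expect u G.
Proof. by rewrite -big_split; apply: eq_bigr => eta _; rewrite mulrDr. Qed.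

Lemma expectZ u (c : R) F : expect u (fun eta => c * F eta) = c * expect u F.
Proof. by rewrite mulr_sumr; apply: eq_bigr => eta _; rewrite mulrCA. Qed.

Lemma expect_sum u (I : Type) (s : seq I) (P : pred I) (F : I -> conf -> R) :
  expect u (fun eta => \sum_(i <- s | P i) F i eta) =
  \sum_(i <- s | P i) expect u (F i).
Proof. by rewrite exchange_big; apply: eq_bigr => eta _; rewrite mulr_sumr. Qed.

Section Positive.
Variable u : T -> R.
Hypothesis u01 : forall x, 0 < u x < 1.

Lemma product_measure_gt0 eta : 0 < product_measure u eta.
Proof.
apply: prodr_gt0 => x _; have /andP[u0 u1] := u01 x.
by case: (eta x); rewrite // subr_gt0.
Qed.

Lemma ler_expect F G : (forall eta, F eta <= G eta) -> expect u F <= expect u G.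
Proof.
move=> FG; apply: ler_sum => eta _.
by apply: ler_wpM2l; rewrite ?FG // ltW // product_measure_gt0.
Qed.

Lemma cond_site_mulr x F G eta : site_free x G ->
  cond_site u x (fun eta => F eta * G eta) eta = cond_site u x F eta * G eta.
Proof. by move=> hG; rewrite /cond_site !hG; ring. Qed.

Lemma site_free_all F : (forall x, site_free x F) -> forall eta xi, F eta = F xi.
Proof.
move=> hF eta xi.
have H (s : seq T) : exists2 zeta, F zeta = F eta & {in s, zeta =1 xi}.
  elim: s => [|x s [zeta Fz zs]]; first by exists eta.
  exists (set_site x (xi x) zeta); first by rewrite hF.
  move=> y; rewrite inE ffunE; case: eqP => [-> //|_ /=]; exact: zs.
have [zeta <- zs] := H (enum T).
by congr F; apply/ffunP => y; apply: zs; rewrite mem_enum.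
Qed.

Lemma expect1 : expect u (fun=> 1) = 1.
Proof.
rewrite (_ : expect _ _ = \sum_eta product_measure u eta); last first.
  by apply: eq_bigr => eta _; rewrite mulr1.
have := bigA_distr_bigA (fun (x : T) (b : bool) => if b then u x else 1 - u x).
by move=> <-; rewrite big1 // => x _; rewrite big_bool /=; ring.
Qed.

Lemma expect_cst (c : R) : expect u (fun=> c) = c.
Proof.
rewrite -[RHS]mulr1 -[in RHS]expect1 -expectZ.
by apply: eq_expect => eta; rewrite mulr1.
Qed.

Lemma site_free_cond x F : site_free x (cond_site u x F).
Proof. by move=> b eta; rewrite /cond_site !set_site_set. Qed.

Lemma site_free_cond' x y F : site_free y F -> site_free y (cond_site u x F).
Proof.
move=> hF; have [->|xy] := eqVneq x y; first exact: site_free_cond.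
by move=> b eta; rewrite /cond_site !(set_siteC _ _ _ xy) !hF.
Qed.

(** The sites of [s] are integrated out one by one: [G] ignores them and passes through [cond_site],
    and what finally remains of [F] depends on no site at all. *)
Lemma expect_mul_indep (s : seq T) F G :
  (forall x, x \notin s -> site_free x F) -> {in s, forall x, site_free x G} ->
  expect u (fun eta => F eta * G eta) = expect u F * expect u G.
Proof.
elim: s F => [|x s IH] F hF hG.
  have cF := @site_free_all F (fun x => hF x isT).
  have eta0 : conf := [ffun=> true].
  rewrite (@eq_expect u F (fun=> F eta0)) ?expect_cst; last by move=> eta; apply: cF.
  by rewrite -expectZ; apply: eq_expect => eta; rewrite (cF eta eta0).
rewrite -(expect_cond_site u x F) -IH.
- rewrite -(expect_cond_site u x); apply: eq_expect => eta.
  by rewrite cond_site_mulr //; apply: hG; rewrite inE eqxx.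
- move=> y; have [->|yx] := eqVneq y x; first by move=> _; apply: site_free_cond.
  move=> ys; apply: site_free_cond'; apply: hF; rewrite inE negb_or yx //.
- by move=> y ys; apply: hG; rewrite inE ys orbT.
Qed.

End Positive.
End Expectation.

(** * Moment generating functions of centred Bernoulli variables *)

Lemma expR_le_quadratic (R : realType) (y : R) :
  `|y| <= 1 / 3 -> expR y <= 1 + y + y ^+ 2.
Proof.
rewrite ler_norml => /andP[y0 y1].
have h : 0 < 1 - y / 2 by lra.
have e1 : expR (y / 2) <= (1 - y / 2)^-1.
  rewrite -[y / 2]opprK expRN lef_pV2 ?posrE ?expR_gt0 //; last lra.
  by have := expR_ge1Dx (- (y / 2)); lra.
have -> : expR y = expR (y / 2) ^+ 2.
  by rewrite expr2 -expRD; congr expR; lra.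
apply: (@le_trans _ _ ((1 - y / 2)^-1 ^+ 2)).
  by rewrite ler_sqr ?nnegrE ?expR_ge0 // invr_ge0 ltW.
rewrite exprVn -div1r ler_pdivrMr ?exprn_gt0 //.
(* The product of [1 + y + y^2] and [(1 - y/2)^2] exceeds 1 by a quarter of this quantity. *)
have : 0 <= y ^+ 2 * (1 - 3 * y + y ^+ 2) by apply: mulr_ge0; rewrite ?sqr_ge0 //; nra.
rewrite !expr2; nra.
Qed.

(** For [|c| <= 1/3] the linear terms cancel in the mean and the quadratic ones remain; for larger
    [c] both exponents are at most [|c| <= 3 c^2], which is the origin of the constant 3. *)
Lemma expR_bernoulli_bound (R : realType) (p c : R) : 0 < p < 1 ->
  p * expR ((1 - p) * c) + (1 - p) * expR (- p * c) <= expR (3 * c ^+ 2).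
Proof.
move=> /andP[p0 p1]; have [c3|c3] := leP `|c| (1 / 3).
  have bd q : `|q| <= 1 -> expR (q * c) <= 1 + q * c + (q * c) ^+ 2.
    move=> q1; apply: expR_le_quadratic; rewrite normrM.
    by rewrite (le_trans _ c3) // ler_piMl.
  have h1 : `|1 - p| <= 1 by rewrite ler_norml; lra.
  have h2 : `|- p| <= 1 by rewrite ler_norml; lra.
  apply: (@le_trans _ _ (1 + c ^+ 2)); last first.
    apply: le_trans (expR_ge1Dx _); have := sqr_ge0 c; lra.
  have := ler_wpM2l (ltW p0) (bd _ h1).
  have p1' : 0 <= 1 - p by lra.
  have := ler_wpM2l p1' (bd _ h2).
  have := sqr_ge0 c; rewrite !expr2; nra.
have bd q : `|q| <= 1 -> expR (q * c) <= expR (3 * c ^+ 2).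
  move=> q1; rewrite ler_expR; apply: (le_trans (ler_norm _)); rewrite normrM.
  have h : `|q| * `|c| <= `|c| by rewrite ler_piMl.
  apply: (le_trans h); rewrite -normr_id -(real_normK (num_real c)) expr2.
  rewrite normr_id; nra.
have h1 : `|1 - p| <= 1 by rewrite ler_norml; lra.
have h2 : `|- p| <= 1 by rewrite ler_norml; lra.
have := bd _ h1; have := bd _ h2; nra.
Qed.

Section Peeling.
Variables (R : realType) (d N : nat) (u : torus d N -> R).
Local Notation T := (torus d N).
Local Notation conf := (config d N).
Hypothesis u01 : forall x, 0 < u x < 1.

Lemma site_free_centered (x y : T) : x != y -> site_free x (centered u y).
Proof. by move=> xy b eta; rewrite /centered ffunE eq_sym (negbTE xy). Qed.

Lemma cond_site_expR (x : T) (F : conf -> R) eta : site_free x F ->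
  cond_site u x (fun eta => expR (centered u x eta * F eta - 3 * F eta ^+ 2)) eta
  <= 1.
Proof.
move=> hF; rewrite /cond_site /centered !hF !ffunE eqxx /= sub0r.
set c := F eta; rewrite !expRD !mulrA -mulrDl expRN.
rewrite ler_pdivrMr ?expR_gt0 // mul1r -[3 * c * c]mulrA.
exact: expR_bernoulli_bound.
Qed.

(* Integrating out the sites of [S] one at a time, in decreasing order of rank,
   leaves a supermartingale. *)
Lemma expect_peel (S : {set T}) (rk : T -> nat) (chi : T -> conf -> R) :
  {in S &, forall x y, (rk y <= rk x)%N -> site_free x (chi y)} ->
  expect u (fun eta => expR (\sum_(x in S)
    (centered u x eta * chi x eta - 3 * chi x eta ^+ 2))) <= 1.
Proof.
have [n] := ubnP #|S|; elim: n S => // n IH S Sn hS.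
have [->|[x0 x0S]] := set_0Vmem S.
  rewrite (@eq_expect _ _ _ _ _ (fun=> 1)) ?expect_cst // => eta.
  by rewrite big_set0 expR0.
have [x xS xmax] := arg_maxnP rk x0S.
apply: le_trans (IH (S :\ x) _ _); last 2 first.
- by move: Sn; rewrite (cardsD1 x) [x \in S]xS.
- by move=> y z; rewrite !inE => /andP[_ yS] /andP[_ zS]; apply: hS.
rewrite -(expect_cond_site u x); apply: ler_expect => // eta.
pose G eta := expR (\sum_(y in S :\ x)
    (centered u y eta * chi y eta - 3 * chi y eta ^+ 2)).
pose F eta := expR (centered u x eta * chi x eta - 3 * chi x eta ^+ 2).
have FG : cond_site u x (fun eta => F eta * G eta) eta <= G eta.
  rewrite cond_site_mulr; last first.
    move=> b zeta; rewrite /G; congr expR; apply: eq_bigr => y; rewrite !inE => /andP[yx yS].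
    rewrite eq_sym in yx; have cf := site_free_centered yx.
    by rewrite cf (hS x y) //; apply: xmax.
  rewrite -[leRHS]mul1r ler_pM2r ?expR_gt0 //; apply: cond_site_expR.
  exact: hS.
apply: le_trans FG.
by rewrite le_eqVlt; apply/orP; left; apply/eqP;
   rewrite /cond_site /F /G -!expRD -!(big_setD1 x).
Qed.

End Peeling.

(** * Duality between relative entropy and exponential moments *)

Section Entropy.
Variables (R : realType) (d N : nat) (u : torus d N -> R).
Local Notation T := (torus d N).
Local Notation conf := (config d N).
Hypothesis u01 : forall x, 0 < u x < 1.

(** The tangent inequality of the exponential at 0, taken at [b - ln a] and multiplied by [a]. *)
Lemma young_entropy (a b : R) : 0 < a -> a * b <= a * ln a - a + expR b.
Proof.
move=> a0; have := expR_ge1Dx (b - ln a).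
rewrite -(ler_pM2l a0) expRD expRN lnK ?posrE //.
by rewrite [_ * (_ * _^-1)]mulrC -mulrA mulVf ?gt_eqF // mulr1; lra.
Qed.

(** The entropy inequality in normalised form: what Young's inequality adds to the entropy is
    [- E f + E (exp X)], at most [-1 + 1]. *)
Lemma expect_le_entropy (f X : conf -> R) : (forall eta, 0 < f eta) ->
  expect u f = 1 -> expect u (fun eta => expR (X eta)) <= 1 ->
  expect u (fun eta => f eta * X eta) <= entropy (product_measure u) f.
Proof.
move=> f0 f1 X1.
have : expect u (fun eta => f eta * X eta) <=
    expect u (fun eta => f eta * ln (f eta) + (-1 * f eta + expR (X eta))).
  apply: ler_expect => // eta; have := young_entropy (X eta) (f0 eta); lra.
rewrite !expectD expectZ f1 => /le_trans; apply.
by rewrite -[leRHS]addr0 lerD2l; lra.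
Qed.

Lemma entropy_ge0 (f : conf -> R) : (forall eta, 0 < f eta) ->
  expect u f = 1 -> 0 <= entropy (product_measure u) f.
Proof.
move=> f0 f1; have := @expect_le_entropy f (fun=> 0) f0 f1.
have -> : expect u (fun eta => f eta * 0) = 0.
  by rewrite -{2}(expect_cst u 0); apply: eq_expect => eta; rewrite mulr0.
by rewrite expect_cst // expR0; apply.
Qed.

End Entropy.

(** * Exponential moments of squares *)

Section CyclicGap.
Variable n : nat.
Implicit Types a b c : 'I_n.+1.

(* Not symmetric: the distance from [b] forward to [a] on the oriented cycle. *)
Definition cdist a b : nat := (a - b)%R.

Lemma ord_addE a b :
  (a + b)%R = (if a + b < n.+1 then a + b else a + b - n.+1)%N :> nat.
Proof.
have := ltn_ord a; have := ltn_ord b; rewrite /= => hb ha.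
case: ltnP => h; first by rewrite modn_small.
by rewrite -{1}(subnK h) modnDr modn_small //; lia.
Qed.

Lemma cdistE a b : cdist a b = (if b <= a then a - b else n.+1 + a - b)%N.
Proof.
have := ltn_ord a; have := ltn_ord b => hb ha; rewrite /cdist /= modnDmr.
case: leqP => h; last by rewrite modn_small; lia.
have -> : (a + (n.+1 - b) = (a - b) + n.+1)%N by lia.
by rewrite modnDr modn_small //; lia.
Qed.

Lemma ord_inZp k : (k < n.+1)%N -> (inZp k : 'I_n.+1) = k :> nat.
Proof. exact: modn_small. Qed.

Lemma cyclic_class_bound M a : (0 < M)%N ->
  ((if a < n.+1 %/ M * M then a %% M else M + (a - n.+1 %/ M * M)) < 2 * M)%N.
Proof.
move=> M0; have := ltn_ord a; have := ltn_pmod a M0; have := ltn_pmod n.+1 M0.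
have := divn_eq n.+1 M; case: ifP; lia.
Qed.

(* A colouring of the cycle such that two points of the same colour are at
   distance at least [M] from each other; the remainder of the division of the
   length of the cycle by [M] forces colours with a single point. *)
Definition cyclic_class M (M0 : (0 < M)%N) a : 'I_(2 * M) := Ordinal (cyclic_class_bound a M0).

Lemma cyclic_class_inj M (M0 : (0 < M)%N) a b :
  cyclic_class M0 a = cyclic_class M0 b -> (cdist a b < M)%N -> a = b.
Proof.
move=> /(congr1 val) /=; rewrite cdistE => cab dab; apply: val_inj => /=.
have ha := ltn_ord a; have hb := ltn_ord b.
have := ltn_pmod a M0; have := ltn_pmod b M0; have := ltn_pmod n.+1 M0.
move: cab dab; have := divn_eq n.+1 M.
set q := (n.+1 %/ M)%N; set r := (n.+1 %% M)%N => eN.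
have := divn_eq a M; have := divn_eq b M.
set qa := (a %/ M)%N; set qb := (b %/ M)%N.
set ra := (a %% M)%N; set rb := (b %% M)%N => eb ea.
case: ltnP => h1; case: ltnP => h2; try lia.
move=> rr; have {}rr : ra = rb by lia.
have qaq : (qa < q)%N by rewrite -(ltn_pmul2r M0); lia.
have qbq : (qb < q)%N by rewrite -(ltn_pmul2r M0); lia.
case: (leqP b a) => h d *.
  have [q1|q1|q1] := ltngtP qa qb; [| |by lia].
  - have := leq_mul2r M qa.+1 qb; rewrite q1 orbT mulSn; lia.
  - have := leq_mul2r M qb.+1 qa; rewrite q1 orbT mulSn; lia.
(* Here the way from [b] to [a] wraps around the end of the cycle. As [b] lies in a complete block,
   its residue is met again only after [M] steps. *)
have : (qb.+1 * M <= q * M)%N by rewrite leq_mul2r qbq orbT.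
rewrite mulSn; lia.
Qed.

End CyclicGap.

Section Convexity.
Variable R : realType.

(** Jensen's inequality: the exponential lies above its tangent at the mean [m], and the linear
    parts sum to zero. *)
Lemma expR_mean_le (I : finType) (a : I -> R) : (0 < #|I|)%N ->
  expR ((\sum_i a i) / #|I|%:R) <= (\sum_i expR (a i)) / #|I|%:R.
Proof.
move=> I0; have I0' : (0 : R) < #|I|%:R by rewrite ltr0n.
set m := _ / _; rewrite ler_pdivlMr //.
have -> : expR m * #|I|%:R = \sum_i expR m * (1 + (a i - m)).
  rewrite -mulr_sumr big_split /= sumrB !sumr_const; congr (_ * _).
  by rewrite -[m *+ _]mulr_natr /m divfK ?gt_eqF // subrr addr0.
apply: ler_sum => i _; rewrite -ler_pdivlMl ?expR_gt0 // -expRN mulrC -expRD.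
exact: expR_ge1Dx.
Qed.

(** The ratio [8 / 9] is an upper bound of [exp (- 1/8)], the decay left in the linearised series of
    [expect_expR_sqr]. *)
Lemma geometric_bound n : \sum_(i < n) (8 / 9 : R) ^+ i <= 9.
Proof.
have -> : \sum_(i < n) (8 / 9 : R) ^+ i = 9 * (1 - (8 / 9) ^+ n).
  elim: n => [|n IH]; first by rewrite big_ord0 expr0; lra.
  by rewrite big_ord_recr IH /= exprS; lra.
have : (0 : R) <= (8 / 9) ^+ n by apply: exprn_ge0; lra.
lra.
Qed.

(* Completing the square, with the nearest half integer in the role of the
   Gaussian variable of the usual linearisation of [expR (y ^+ 2)]. *)
Lemma expR_sqr_le_sum (y : R) (M : nat) : 2 * `|y| < M%:R ->
  expR (y ^+ 2) <= expR (1 / 4) *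
    \sum_(n < M) expR (- (n%:R ^+ 2 / 4)) * (expR (n%:R * y) + expR (- n%:R * y)).
Proof.
move=> yM; have y0 : 0 <= 2 * `|y| by rewrite mulr_ge0.
have /andP[n1 n2] := truncn_itv y0; set n := Num.truncn _ in n1 n2.
have nM : (n < M)%N by rewrite -(ltr_nat R); apply: le_lt_trans yM.
rewrite (bigD1 (Ordinal nM)) //= mulrDr -[leLHS]addr0; apply: lerD; last first.
  apply: mulr_ge0; first exact: expR_ge0.
  apply: sumr_ge0 => i _; apply: mulr_ge0; first exact: expR_ge0.
  by apply: addr_ge0; exact: expR_ge0.
apply: (@le_trans _ _ (expR (1 / 4) * (expR (- (n%:R ^+ 2 / 4)) * expR (n%:R * `|y|)))).
  rewrite -!expRD ler_expR -(real_normK (num_real y)).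
  have h : `| `|y| - n%:R / 2 | <= 1 / 2.
    by rewrite ler_norml; move: n1 n2; rewrite -(natr1 n); lra.
  have : (`|y| - n%:R / 2) ^+ 2 <= (1 / 2) ^+ 2.
    by rewrite -(real_normK (num_real (`|y| - _))) ler_sqr ?nnegrE //; lra.
  rewrite !expr2; lra.
rewrite !ler_pM2l ?expR_gt0 //.
have [y1|y1] := leP 0 y; first by rewrite (ger0_norm y1) lerDl expR_ge0.
by rewrite (ltr0_norm y1) mulrN mulNr lerDr expR_ge0.
Qed.

End Convexity.

Section SquareMoment.
Variables (R : realType) (d N : nat) (u : torus d N -> R).
Local Notation T := (torus d N).
Local Notation conf := (config d N).
Hypothesis u01 : forall x, 0 < u x < 1.

(** For [l = n * sqrt k] the subgaussian moment is at most [exp (n^2 / 8)], against a weight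
    [exp (- n^2 / 4)]. The resulting series is bounded by [18 * exp (1/4)], hence by [exp 19]. *)
Lemma expect_expR_sqr (h : conf -> R) (v k : R) : 0 <= k -> k * v <= 1 / 8 ->
  (forall l, expect u (fun eta => expR (l * h eta)) <= expR (l ^+ 2 * v)) ->
  expect u (fun eta => expR (k * h eta ^+ 2)) <= expR 19.
Proof.
move=> k0 kv hh; pose s := Num.sqrt k; have s2 : s ^+ 2 = k by rewrite sqr_sqrtr.
(* The state space is finite, so [h] is bounded and finitely many terms suffice; the estimate is
   uniform in their number [M]. *)
pose B := \sum_eta 2 * `|s * h eta|.
have B0 : 0 <= B by apply: sumr_ge0 => eta _; rewrite mulr_ge0.
pose M := (Num.truncn B).+1.
have hM eta : 2 * `|s * h eta| < M%:R.
  apply: le_lt_trans (truncnS_gt B); rewrite /B (bigD1 eta) //= lerDl.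
  by apply: sumr_ge0 => xi _; rewrite mulr_ge0.
have h1 : expect u (fun eta => expR (k * h eta ^+ 2)) <=
    expect u (fun eta => expR (1 / 4) * \sum_(n < M) expR (- (n%:R ^+ 2 / 4)) *
      (expR (n%:R * s * h eta) + expR (- n%:R * s * h eta))).
  apply: ler_expect => // eta; rewrite -s2 -exprMn.
  apply: le_trans (expR_sqr_le_sum (hM eta)) _; rewrite le_eqVlt; apply/orP; left.
  by apply/eqP; congr (_ * _); apply: eq_bigr => n _; rewrite -!mulrA.
apply: (le_trans h1); rewrite expectZ expect_sum.
have h2 n : expect u (fun eta => expR (- (n%:R ^+ 2 / 4)) *
      (expR (n%:R * s * h eta) + expR (- n%:R * s * h eta))) <= 2 * (8 / 9) ^+ n.
  rewrite expectZ expectD.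
  have e1 (l : R) : l ^+ 2 = n%:R ^+ 2 -> expect u (fun eta => expR (l * s * h eta)) <= expR (n%:R ^+ 2 / 8).
    move=> ln; apply: (le_trans (hh (l * s))); rewrite ler_expR exprMn s2 ln -mulrA.
    by rewrite ler_wpM2l ?sqr_ge0 //; lra.
  have e2 := e1 n%:R erefl; have e3 := e1 (- n%:R) (sqrrN _).
  apply: (@le_trans _ _ (expR (- (n%:R ^+ 2 / 4)) * (2 * expR (n%:R ^+ 2 / 8)))).
    by rewrite ler_wpM2l ?expR_ge0 //; lra.
  rewrite mulrCA -expRD ler_pM2l //.
  have e4 : expR (- (1 / 8)) <= 8 / 9 :> R.
    rewrite expRN -[leRHS]invrK lef_pV2 ?posrE ?expR_gt0 ?invr_gt0 ?divr_gt0 //.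
    apply: le_trans (expR_ge1Dx _); lra.
  apply: (@le_trans _ _ (expR (- (1 / 8)) ^+ n)); last first.
    by rewrite lerXn2r ?nnegrE ?expR_ge0 ?divr_ge0.
  rewrite -expRM_natl ler_expR.
  have : (n%:R : R) <= n%:R ^+ 2 by rewrite -natrX ler_nat; case: (n : nat) => // m; nia.
  lra.
have e5 : \sum_(n < M) expect u (fun eta => expR (- (n%:R ^+ 2 / 4)) *
      (expR (n%:R * s * h eta) + expR (- n%:R * s * h eta))) <= 18.
  apply: (@le_trans _ _ (\sum_(n < M) 2 * (8 / 9) ^+ n)).
    by apply: ler_sum => n _; exact: h2.
  by rewrite -mulr_sumr; have := geometric_bound R M; lra.
apply: (@le_trans _ _ (expR (1 / 4) * 18)); first by rewrite ler_pM2l ?expR_gt0.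
have -> : (19 : R) = 1 + 18 by lra.
rewrite expRD; apply: ler_pM; rewrite ?expR_ge0 //; first by rewrite ler_expR; lra.
by apply: le_trans (expR_ge1Dx _); lra.
Qed.

Lemma expect_prod (s : seq T) (D : T -> {set T}) (F : T -> conf -> R) : uniq s ->
  {in s &, forall x y, x != y ->
    forall z, z \in D x -> z \notin D y} ->
  {in s, forall x y, y \notin D x -> site_free y (F x)} ->
  expect u (fun eta => \prod_(x <- s) F x eta) = \prod_(x <- s) expect u (F x).
Proof.
elim: s => [|x s IH] /=.
  move=> _ _ _; rewrite big_nil -[RHS](expect_cst u 1).
  by apply: eq_expect => eta; rewrite big_nil.
move=> /andP[xs us] hD hF; rewrite big_cons -IH //; first last.
- by move=> y ys; apply: hF; rewrite inE ys orbT.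
- by move=> y z ys zs; apply: hD; rewrite inE ?ys ?zs orbT.
rewrite -(@expect_mul_indep _ _ _ u (enum (D x))).
- by apply: eq_expect => eta; rewrite big_cons.
- by move=> y; rewrite mem_enum; apply: hF; rewrite inE eqxx.
- move=> y; rewrite mem_enum => yD b eta; apply: eq_big_seq => z zs.
  have zin : z \in x :: s by rewrite inE zs orbT.
  apply: (hF z zin); have xz : x != z by apply: contraNneq xs => ->.
  by apply: (hD x z _ zin xz) => //; rewrite inE eqxx.
Qed.

End SquareMoment.

(** * Boxes on the torus and their disjointness *)

Section Torus.
Variables (d N : nat).
Local Notation T := (torus d N).
Local Notation p := N.-1.+1.
Implicit Types (x y z : T) (i j : 'I_d.-1.+1).

Lemma basis_mulrnE j k i : ((basis_vec j : T) *+ k) i = if i == j then inZp k else 0.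
Proof.
rewrite ffunMnE ffunE; case: eqP => _; last by rewrite mul0rn.
by rewrite Zp_mulrn; apply: val_inj => /=; rewrite modnMml mul1n.
Qed.

Lemma inZp_mulrn0 : (inZp 0 : 'I_p) = 0.
Proof. by apply: val_inj; rewrite /= mod0n. Qed.

Definition back j (k1 k2 : nat) x : T :=
  x - (basis_vec ord0 *+ k1 + basis_vec j *+ k2).

Lemma backE j k1 k2 x i : back j k1 k2 x i =
  x i - ((if i == ord0 then inZp k1 else 0) + (if i == j then inZp k2 else 0)).
Proof. by rewrite /back !ffunE !basis_mulrnE. Qed.

(** The hypothesis gives [a - b = k - l], so one of [a], [b] lies less than [M] steps behind the
    other; equal colours then force equality. *)
Lemma inZpB_inj (a b : 'I_p) k l M (M0 : (0 < M)%N) : (M <= p)%N -> (k < M)%N -> (l < M)%N ->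
  a - inZp k = b - inZp l -> cyclic_class M0 a = cyclic_class M0 b -> a = b /\ k = l.
Proof.
move=> Mp kM lM ab cab.
have e : a - b = inZp k - inZp l.
  apply/eqP; rewrite subr_eq -[a](subrK (inZp k)) ab addrC -addrA.
  by rewrite [- _ + b]addrC.
have kp : (k < p)%N by exact: leq_trans kM Mp.
have lp : (l < p)%N by exact: leq_trans lM Mp.
suff abE : a = b.
  split=> //; move: e; rewrite abE subrr => /esym/eqP; rewrite subr_eq0 => /eqP /(congr1 val) /=.
  by rewrite !modn_small.
have [lk|kl] := leqP l k.
  apply: cyclic_class_inj cab _; rewrite /cdist e -/(cdist _ _) cdistE !ord_inZp //.
  by rewrite lk; lia.
apply/esym; apply: cyclic_class_inj (esym cab) _.
rewrite /cdist -opprB e opprB -/(cdist _ _) cdistE !ord_inZp // (ltnW kl); lia.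
Qed.

(** Boxes based at distinct points of the same colours are disjoint and, for [x = y], a box lists
    its points without repetition. The alternative [M2 = 1] encodes a one-dimensional box. *)
Lemma back_inj j k1 k2 l1 l2 x y M1 M2 (M1_gt0 : (0 < M1)%N) (M2_gt0 : (0 < M2)%N) :
  (M1 <= p)%N -> (M2 <= p)%N -> j != ord0 \/ M2 = 1%N ->
  (k1 < M1)%N -> (l1 < M1)%N -> (k2 < M2)%N -> (l2 < M2)%N ->
  cyclic_class M1_gt0 (x ord0) = cyclic_class M1_gt0 (y ord0) ->
  cyclic_class M2_gt0 (x j) = cyclic_class M2_gt0 (y j) ->
  back j k1 k2 x = back j l1 l2 y -> [/\ x = y, k1 = l1 & k2 = l2].
Proof.
move=> M1p M2p hj k1M l1M k2M l2M c1 c2 e.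
have ei i := congr1 (fun z : T => z i) e.
have {}ei i := eq_trans (esym (backE j k1 k2 x i)) (eq_trans (ei i) (backE j l1 l2 y i)).
have [x0 k1l1] : x ord0 = y ord0 /\ k1 = l1.
  apply: inZpB_inj M1p k1M l1M _ c1; have := ei ord0; rewrite eqxx.
  case: hj => [/negbTE|M21]; first by rewrite eq_sym => ->; rewrite !addr0.
  have -> : k2 = 0%N by lia.
  have -> : l2 = 0%N by lia.
  by rewrite inZp_mulrn0 if_same !addr0.
have [xj k2l2] : x j = y j /\ k2 = l2.
  have [j0|j0] := eqVneq j ord0; last first.
    apply: inZpB_inj M2p k2M l2M _ c2; have := ei j.
    by rewrite eqxx (negbTE j0) !add0r.
  move: hj; rewrite j0 eqxx => -[//|M21]; split=> //; lia.
split=> //; apply/ffunP => i.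
have [->//|i0] := eqVneq i ord0; have [->//|ij] := eqVneq i j.
by have := ei i; rewrite (negbTE i0) (negbTE ij) addr0 !subr0.
Qed.

End Torus.

(** * Exponential moments on the cut torus *)

Section Slit.
Variables (R : realType) (d N : nat) (u : torus d N -> R).
Local Notation T := (torus d N).
Local Notation conf := (config d N).
Local Notation p := N.-1.+1.
Hypothesis u01 : forall x, 0 < u x < 1.

(* Cutting the torus along a strip of width [L] in the first coordinate unrolls
   it, so that the coefficients only look at sites of smaller rank. *)
Lemma expect_slit_le1 (a : 'I_p) (L : nat) (chi : T -> conf -> R) :
  (forall x y : T, ~~ (0 < cdist (x ord0) (y ord0) <= L)%N -> site_free y (chi x)) ->
  expect u (fun eta => expR (\sum_(x : T | (L <= cdist (x ord0) a)%N)
    (centered u x eta * chi x eta - 3 * chi x eta ^+ 2))) <= 1.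
Proof.
move=> hchi.
have := @expect_peel _ _ _ u u01 [set x : T | (L <= cdist (x ord0) a)%N]%SET
  (fun x : T => cdist (x ord0) a) chi.
set F := (X in (_ -> expect u X <= 1) -> _); set G := (X in _ -> expect u X <= 1).
have -> : F = G.
  by apply: funext => eta; congr expR; apply: eq_bigl => x; rewrite inE.
apply=> x y; rewrite !inE => xL yL xy; apply: hchi; apply/negP => /andP[].
move: xL yL xy; rewrite !cdistE.
have := ltn_ord (x ord0); have := ltn_ord (y ord0); have := ltn_ord a.
move: (nat_of_ord (x ord0)) (nat_of_ord (y ord0)) (nat_of_ord a) => m n k.
by do 3!case: ifP => ?; lia.
Qed.

Section Subgaussian.
Variables (Q : R) (q : T -> conf -> R).
Hypothesis Q_ge : forall x eta, `|q x eta| <= Q.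
Hypothesis q_free : forall x y : T, y != x - basis_vec ord0 -> site_free y (q x).

(** A general [q] covers both factors of the bilinear term: [coupling] gives [psi], the inverse
    mobility gives [omega]. *)
Definition monomial x eta : R := centered u x eta * q x eta.

(** Since [q] looks only at the preceding site, a slit of width one, along a hyperplane that the
    family [s] avoids, is enough to peel. *)
Lemma expect_expR_monomial (K : finType) (s : K -> T) (c : K -> R) (a : 'I_p) :
  (1 < p)%N -> injective s -> (forall k, s k ord0 != a) ->
  expect u (fun eta => expR (\sum_k c k * monomial (s k) eta)) <=
  expR (3 * Q ^+ 2 * \sum_k c k ^+ 2).
Proof.
move=> p1 sinj sa.
(* The coefficients carried from the index type to the sites; they vanish on the slit. *)
pose lam x := \sum_k c k * (x == s k)%:R.
have lams k : lam (s k) = c k.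
  rewrite /lam (bigD1 k) //= eqxx mulr1 big1 ?addr0 // => l lk.
  by rewrite (inj_eq sinj) eq_sym (negbTE lk) mulr0.
have lam0 (x : T) : ~~ (1 <= cdist (x ord0) a)%N -> lam x = 0.
  move=> xa; rewrite /lam big1 // => k _; case: eqP => [e|]; last by rewrite mulr0.
  move: (sa k); rewrite -e => /negP[]; apply/eqP/val_inj; move: xa.
  have := ltn_ord (x ord0); have := ltn_ord a; rewrite cdistE /=; case: ifP; lia.
have sumlam (F : T -> R) : \sum_x lam x * F x = \sum_k c k * F (s k).
  rewrite /lam; under eq_bigr do rewrite mulr_suml.
  rewrite exchange_big; apply: eq_bigr => k _ /=.
  rewrite (bigD1 (s k)) //= eqxx mulr1 big1 ?addr0 // => x /negbTE ->.
  by rewrite mulr0 mul0r.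
have slit (F : T -> R) :
    \sum_(x : T | (1 <= cdist (x ord0) a)%N) lam x * F x = \sum_k c k * F (s k).
  rewrite -sumlam [RHS](bigID (fun x : T => (1 <= cdist (x ord0) a)%N)) /=.
  rewrite [X in _ = _ + X]big1 ?addr0 // => x xa.
  by rewrite lam0 ?mul0r.
have := @expect_slit_le1 a 1 (fun x eta => lam x * q x eta) _.
set X := (X in (_ -> X) -> _) => h.
have {h} h1 : X.
  apply: h => x y xy b eta; have [lx0|lx0] := eqVneq (lam x) 0; first by rewrite lx0 !mul0r.
  rewrite q_free //; apply: contra xy => /eqP -> {y}.
  rewrite /cdist (_ : (x - basis_vec ord0) ord0 = x ord0 - inZp 1); last first.
    by rewrite !ffunE eqxx.
  by rewrite opprB addrC subrK ord_inZp.
set V := 3 * Q ^+ 2 * _.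
apply: (@le_trans _ _ (expR V * 1)); last by rewrite mulr1.
apply: le_trans (ler_wpM2l (expR_ge0 V) h1); rewrite -expectZ.
apply: ler_expect => // eta; rewrite -expRD ler_expR sumrB addrCA -lerBlDl.
have -> : \sum_(x : T | (1 <= cdist (x ord0) a)%N)
    centered u x eta * (lam x * q x eta) = \sum_k c k * monomial (s k) eta.
  by rewrite -(slit (fun x => monomial x eta)); apply: eq_bigr => x _; rewrite mulrCA.
rewrite subrr subr_ge0 /V.
have -> : \sum_k c k ^+ 2 = \sum_(x : T | (1 <= cdist (x ord0) a)%N) lam x * lam x.
  by rewrite (slit lam); apply: eq_bigr => k _; rewrite lams.
rewrite mulr_sumr; apply: ler_sum => x _.
rewrite exprMn -mulrA ler_pM2l // mulrC -expr2 ler_wpM2r ?sqr_ge0 //.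
by rewrite -(real_normK (num_real (q x eta))) lerXn2r ?nnegrE // (le_trans _ (Q_ge x eta)).
Qed.

Section Box.
Variables (m1 m2 : nat) (j : 'I_d.-1.+1) (c : 'I_m1 * 'I_m2 -> R).
Hypotheses (m1_gt0 : (0 < m1)%N) (m2_gt0 : (0 < m2)%N).
Hypotheses (m1p : (m1 < p)%N) (m2p : (m2 <= p)%N) (hj : j != ord0 \/ m2 = 1%N).

Definition box_sum (z : T) eta : R :=
  \sum_k c k * monomial (back j k.1 k.2 z) eta.

(** The number of colour classes for boxes with [m1.+1] and [m2] layers. *)
Let P := (2 * m1.+1 * (2 * m2))%N.

Lemma expect_box_sum (z : T) (l : R) :
  expect u (fun eta => expR (l * box_sum z eta)) <=
  expR (l ^+ 2 * (3 * Q ^+ 2 * \sum_k c k ^+ 2)).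
Proof.
(* The first coordinates used are [z ord0 - k] with [k < m1]; the slit takes the next one, still
   free because [m1 < p]. *)
have := @expect_expR_monomial _ (fun k : 'I_m1 * 'I_m2 => back j k.1 k.2 z)
  (fun k => l * c k) (z ord0 - inZp m1) _ _ _.
set X := (X in (_ -> _ -> _ -> X) -> _) => h.
have : X.
  apply: h; first by apply: leq_trans m1p.
    move=> [k1 k2] [l1 l2] /= e.
    have [] // := @back_inj d N j k1 k2 l1 l2 z z m1 m2 m1_gt0 m2_gt0 (ltnW m1p) m2p hj.
    by move=> _ /val_inj -> /val_inj ->.
  move=> [k1 k2] /=; rewrite backE eqxx; apply/eqP.
  have -> : (if ord0 == j then inZp k2 else 0) = 0 :> 'I_p.
    case: eqP => // j0; case: hj => [|m21]; first by rewrite -j0 eqxx.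
    have -> : (k2 : nat) = 0%N by have := ltn_ord k2; lia.
    exact: inZp_mulrn0.
  rewrite addr0 => e.
  have k1m := ltn_ord k1.
  have [_] := @inZpB_inj N _ _ k1 m1 m1.+1 isT m1p (ltnW k1m) (ltnSn m1) e erefl.
  by move: k1m; lia.
rewrite /X; set A := expR _; set B := (X in _ <= expR X -> _).
have -> : l ^+ 2 * (3 * Q ^+ 2 * \sum_k c k ^+ 2) = B.
  rewrite /B mulrCA; congr (_ * _); rewrite mulr_sumr.
  by apply: eq_bigr => k _; rewrite exprMn.
apply: le_trans; rewrite le_eqVlt; apply/orP; left; apply/eqP/eq_expect => eta.
by congr expR; rewrite mulr_sumr; apply: eq_bigr => k _; rewrite mulrA.
Qed.

(** One layer more than the index set of [box_sum], because [q] looks one site further back. *)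
Definition box (z : T) : {set T} :=
  ((fun k : 'I_m1.+1 * 'I_m2 => back j k.1 k.2 z) @: predT)%SET.

Lemma box_sum_free (z y : T) : y \notin box z ->
  site_free y (box_sum z).
Proof.
move=> yD b eta; apply: eq_bigr => -[k1 k2] _ /=.
have k1m : (k1 < m1.+1)%N by exact: ltnW (ltn_ord k1).
have k1m' : (k1.+1 < m1.+1)%N by exact: ltn_ord k1.
rewrite /monomial site_free_centered ?q_free //.
  apply: contra yD => /eqP ->; apply/imsetP; exists (Ordinal k1m', k2) => //=.
  by rewrite /back mulrS -addrA -opprD [_ + basis_vec ord0]addrC addrA.
by apply: contra yD => /eqP ->; apply/imsetP; exists (Ordinal k1m, k2).
Qed.

(** By Jensen the exponential of the average over the [P] colour classes is at most the average of
    the exponentials. Within a class the boxes are disjoint, so the expectation factorises, and each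
    factor is at most [exp 19 * exp (- 19)]. *)
Lemma expect_box_sqr (k : R) : 0 <= k ->
  k * P%:R * (3 * Q ^+ 2 * \sum_k c k ^+ 2) <= 1 / 8 ->
  expect u (fun eta => expR (k * \sum_z box_sum z eta ^+ 2 - 19 * #|T|%:R / P%:R)) <= 1.
Proof.
move=> k0 kP.
pose cl (z : T) := (cyclic_class (ltn0Sn m1) (z ord0), cyclic_class m2_gt0 (z j)).
pose I := ('I_(2 * m1.+1) * 'I_(2 * m2))%type.
have cI : #|{: I}| = P by rewrite card_prod !card_ord.
have P0 : (0 : R) < P%:R by rewrite ltr0n /P; lia.
have part (G : T -> R) : \sum_z G z = \sum_(i : I) \sum_(z | cl z == i) G z.
  exact: (partition_big cl xpredT).
pose F z eta := expR (k * P%:R * box_sum z eta ^+ 2 - 19).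
pose a (i : I) eta := \sum_(z | cl z == i) (k * P%:R * box_sum z eta ^+ 2 - 19).
have h1 : expect u (fun eta => expR (k * \sum_z box_sum z eta ^+ 2 - 19 * #|T|%:R / P%:R))
    <= expect u (fun eta => P%:R^-1 * \sum_(i : I) \prod_(z | cl z == i) F z eta).
  apply: ler_expect => // eta.
  have := @expR_mean_le R I (fun i => a i eta); rewrite cI -(ltr0n R) => /(_ P0).
  rewrite [X in _ <= X -> _]mulrC.
  under [X in _ <= _ * X -> _]eq_bigr do rewrite /a expR_sum.
  apply: le_trans; rewrite ler_expR le_eqVlt; apply/orP; left; apply/eqP.
  rewrite /a -part sumrB -mulr_sumr sumr_const -mulr_natr.
  by field; rewrite gt_eqF.
apply: (le_trans h1); rewrite expectZ expect_sum mulrC ler_pdivrMr // mul1r.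
have -> : P%:R = \sum_(i : I) (1 : R) by rewrite sumr_const cI.
apply: ler_sum => i _.
have := @expect_prod _ _ _ u [seq z <- enum T | cl z == i] box F _ _ _.
have eF eta : \prod_(z | cl z == i) F z eta = \prod_(z <- [seq z <- enum T | cl z == i]) F z eta.
  by rewrite big_filter big_enum_cond.
rewrite (eq_expect _ eF) => ->.
- rewrite big_filter big_enum_cond; apply: prodr_ile1 => z _.
  rewrite sumr_ge0 /=; last by move=> eta _; rewrite mulr_ge0 ?expR_ge0 // ltW // product_measure_gt0.
  rewrite (@eq_expect _ _ _ _ _ (fun eta => expR (- 19) * expR (k * P%:R * box_sum z eta ^+ 2))).
    rewrite expectZ expRN ler_pdivrMl ?expR_gt0 // mulr1.
    apply: (@expect_expR_sqr _ _ _ u u01 _ (3 * Q ^+ 2 * \sum_k c k ^+ 2)) => //.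
      by rewrite mulr_ge0 // ltW.
    by move=> l; apply: expect_box_sum.
  by move=> eta; rewrite -expRD addrC.
- by rewrite filter_uniq // enum_uniq.
- move=> x y; rewrite !mem_filter => /andP[/eqP cx _] /andP[/eqP cy _] xy z.
  move=> /imsetP[[k1 k2] _ ->] /=; apply/imsetP => -[[l1 l2] _ /=] e.
  have := congr1 fst (etrans cx (esym cy)); have := congr1 snd (etrans cx (esym cy)) => /= c2 c1.
  have [] := @back_inj d N j k1 k2 l1 l2 x y m1.+1 m2 _ _ m1p m2p hj _ _ _ _ c1 c2 e => //.
  by move=> e'; rewrite e' eqxx in xy.
- move=> x _ y yx b eta; have bf := @box_sum_free x y yx b eta.
  by rewrite /F bf.
Qed.

End Box.
End Subgaussian.
End Slit.

(** * The adjoint of the generator *)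

Section Adjoint.
Variables (R : realType) (d N : nat) (u : torus d N -> R).
Local Notation T := (torus d N).
Local Notation conf := (config d N).
Local Notation p := N.-1.+1.
Local Notation e1 := (basis_vec ord0 : T).
Hypothesis u01 : forall x, 0 < u x < 1.
Implicit Types (x y z : T) (eta : conf) (f : conf -> R).

Definition mobility x : R := u x * (1 - u x).

Definition omega x eta : R := centered u x eta / mobility x.

Lemma mobility_gt0 x : 0 < mobility x.
Proof. by have /andP[u0 u1] := u01 x; rewrite mulr_gt0 // subr_gt0. Qed.

Lemma exchangeK x y : involutive (@exchange d N x y).
Proof.
move=> eta; apply/ffunP => z; rewrite !ffunE !eqxx.
have [->|zx] := eqVneq z x; first by have [->|] := eqVneq y x.
by have [->|] := eqVneq z y.
Qed.

Lemma expect_exchange x y (F : conf -> R) :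
  expect u (fun eta => F (exchange x y eta)) =
  \sum_eta product_measure u (exchange x y eta) * F eta.
Proof.
rewrite /expect (reindex_inj (inv_inj (@exchangeK x y))) /=.
by apply: eq_bigr => eta _; rewrite exchangeK.
Qed.

Lemma expect_flip x (F : conf -> R) :
  expect u (fun eta => F (flip x eta)) =
  \sum_eta product_measure u (flip x eta) * F eta.
Proof.
rewrite /expect (reindex_inj (inv_inj (@flipK d N x))) /=.
by apply: eq_bigr => eta _; rewrite flipK.
Qed.

Lemma product_measure_split x y eta : x != y ->
  product_measure u eta = (if eta x then u x else 1 - u x) *
   ((if eta y then u y else 1 - u y) *
     \prod_(z | (z != x) && (z != y)) (if eta z then u z else 1 - u z)).
Proof. by move=> xy; rewrite /product_measure (bigD1 x) // (bigD1 y) //= eq_sym. Qed.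

Lemma product_measure_exchange x y eta : x != y ->
  product_measure u (exchange x y eta) = product_measure u eta *
   (1 + (u y - u x) * (omega x eta - omega y eta)
      - (u y - u x) ^+ 2 * (omega x eta * omega y eta)).
Proof.
move=> xy; rewrite !(@product_measure_split x y) // !ffunE eqxx eq_sym (negbTE xy) eqxx.
rewrite (eq_bigr (fun z => if eta z then u z else 1 - u z)); last first.
  by move=> z /andP[zx zy]; rewrite ffunE (negbTE zx) (negbTE zy).
rewrite /omega /centered /mobility; have /andP[x0 x1] := u01 x; have /andP[y0 y1] := u01 y.
have x1' : 1 - u x != 0 by rewrite subr_eq0 gt_eqF.
have y1' : 1 - u y != 0 by rewrite subr_eq0 gt_eqF.
have x0' : u x != 0 by rewrite gt_eqF.
have y0' : u y != 0 by rewrite gt_eqF.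
set P := \prod_(_ | _) _.
by case: (eta x); case: (eta y) => /=; field; rewrite x1' y1' x0' y0'.
Qed.

Lemma expect_exchangeB x y f : x != y ->
  expect u (fun eta => f (exchange x y eta) - f eta) =
  expect u (fun eta => f eta * ((u y - u x) * (omega x eta - omega y eta)
      - (u y - u x) ^+ 2 * (omega x eta * omega y eta))).
Proof.
move=> xy; have -> : expect u (fun eta => f (exchange x y eta) - f eta) =
    expect u (fun eta => f (exchange x y eta)) - expect u f.
  by rewrite -sumrB; apply: eq_bigr => eta _; rewrite mulrBr.
rewrite expect_exchange -sumrB; apply: eq_bigr => eta _.
by rewrite product_measure_exchange //; ring.
Qed.

Lemma spinE x eta : spin R eta x = 2 * u x - 1 + 2 * centered u x eta.
Proof. by rewrite /spin /centered; ring. Qed.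

Section Glauber.
Variable gamma : R.

(** The coefficient of [omega x] in the adjoint of the Glauber part. For constant [u] it equals
    [- V'(u)], whence its cancellation against the discrete Laplacian in [drift]. *)
Definition reaction x : R :=
  gamma * ((2 * u (x - e1) - 1) + (2 * u (x + e1) - 1)) -
  (1 + gamma ^+ 2 * (2 * u (x - e1) - 1) * (2 * u (x + e1) - 1)) * (2 * u x - 1).

Lemma expect_flipB x f : x - e1 != x -> x + e1 != x ->
  expect u (fun eta => glauber_rate gamma (translate x eta) * (f (flip x eta) - f eta)) =
  expect u (fun eta => f eta * (omega x eta * (reaction x
     + (2 * gamma - 2 * gamma ^+ 2 * (2 * u x - 1) * (2 * u (x + e1) - 1)) * centered u (x - e1) eta
     + (2 * gamma - 2 * gamma ^+ 2 * (2 * u x - 1) * (2 * u (x - e1) - 1)) * centered u (x + e1) eta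
     - 4 * gamma ^+ 2 * (2 * u x - 1) * (centered u (x - e1) eta * centered u (x + e1) eta)))).
Proof.
move=> xm xp; set c := fun eta => glauber_rate gamma (translate x eta).
have -> : expect u (fun eta => c eta * (f (flip x eta) - f eta)) =
    expect u (fun eta => c (flip x (flip x eta)) * f (flip x eta)) - expect u (fun eta => c eta * f eta).
  by rewrite -sumrB; apply: eq_bigr => eta _; rewrite flipK; ring.
rewrite (expect_flip x (fun eta => c (flip x eta) * f eta)) -sumrB; apply: eq_bigr => eta _.
have sE (zeta : conf) y : spin R (translate x zeta) y = spin R zeta (x + y).
  by rewrite /spin ffunE.
rewrite /c /glauber_rate !sE addr0.
have fl y : y != x -> spin R (flip x eta) y = spin R eta y.
  by move=> yx; rewrite /spin ffunE (negbTE yx).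
have fx : spin R (flip x eta) x = - spin R eta x.
  by rewrite /spin ffunE eqxx; case: (eta x) => /=; ring.
rewrite (fl _ xm) (fl _ xp) fx (spinE (x - e1)) (spinE (x + e1)) flip_set_site measure_set_site.
have -> : product_measure u eta = (if eta x then u x else 1 - u x) *
    \prod_(z | z != x) (if eta z then u z else 1 - u z).
  by rewrite /product_measure (bigD1 x).
rewrite /omega /reaction /mobility /spin.
move: (centered u (x - e1) eta) (centered u (x + e1) eta) => wm wp.
rewrite /centered; have /andP[x0 x1] := u01 x.
have x1' : 1 - u x != 0 by rewrite subr_eq0 gt_eqF.
have x0' : u x != 0 by rewrite gt_eqF.
set P := \prod_(_ | _) _.
by case: (eta x) => /=; field; rewrite x1' x0'.
Qed.

Lemma basis_vec_neq0 j : (1 < p)%N -> (basis_vec j : T) != 0.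
Proof.
move=> p1; apply/eqP => /(congr1 (fun z : T => z j : nat)).
by rewrite !ffunE eqxx /= modn_small.
Qed.

Variables (K : R).
Hypothesis K_neq0 : K != 0.
Hypothesis uE : forall x j, j != ord0 -> u (x + basis_vec j) = u x.
Hypothesis p_gt1 : (1 < p)%N.

Definition drift x : R :=
  N%:R ^+ 2 * (u (x + e1) + u (x - e1) - 2 * u x) + K * reaction x.

(* [coupling] collects all terms of the adjoint attached to the bond
   [(x, x + e1)]: the flips at [x] and at [x + e1], and the exchange. *)
Definition coupling0 x : R :=
  (2 * gamma - 2 * gamma ^+ 2 * (2 * u (x + e1) - 1) * (2 * u (x + e1 + e1) - 1))
  + (2 * gamma - 2 * gamma ^+ 2 * (2 * u x - 1) * (2 * u (x - e1) - 1))
    * (mobility (x + e1) / mobility x)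
  - N%:R ^+ 2 * (u (x + e1) - u x) ^+ 2 / (K * mobility x).

Definition coupling1 x : R :=
  - 4 * gamma ^+ 2 * (2 * u x - 1) * (mobility (x + e1) / mobility x).

Definition coupling x eta : R := coupling0 x + coupling1 x * centered u (x - e1) eta.

(** Only bonds in direction [ord0] contribute, [u] being constant along the others; a summation by
    parts of the linear terms produces the discrete Laplacian. *)
Lemma expect_exclusion f :
  expect u (exclusion_gen f) = expect u (fun eta => f eta *
    \sum_(x : T) (omega x eta * (u (x + e1) + u (x - e1) - 2 * u x)
            - (u (x + e1) - u x) ^+ 2 * (omega x eta * omega (x + e1) eta))).
Proof.
rewrite /exclusion_gen expect_sum.
transitivity (\sum_(x : T) expect u (fun eta => f eta *
   ((u (x + e1) - u x) * (omega x eta - omega (x + e1) eta)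
      - (u (x + e1) - u x) ^+ 2 * (omega x eta * omega (x + e1) eta)))).
  apply: eq_bigr => x _; rewrite expect_sum.
  have xj j : x != x + basis_vec j.
    by rewrite -subr_eq0 opprD addNKr oppr_eq0 basis_vec_neq0.
  rewrite (bigD1 ord0) //= expect_exchangeB // big1 ?addr0 // => j j0.
  rewrite expect_exchangeB // uE // subrr /expect big1 // => eta _.
  by rewrite expr0n /= !mul0r subrr !mulr0.
rewrite -expect_sum; apply: eq_expect => eta.
rewrite -mulr_sumr; congr (_ * _); rewrite !sumrB; congr (_ - _).
under eq_bigr do rewrite mulrBr.
rewrite sumrB [X in _ - X](reindex_inj (addIr (- e1))) /= -sumrB.
by apply: eq_bigr => x _; rewrite subrK; ring.
Qed.

Lemma expect_generator f :
  expect u (generator gamma K f) =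
  expect u (fun eta => f eta * \sum_(x : T) omega x eta * drift x) +
  K * expect u (fun eta => f eta *
    \sum_(x : T) monomial u coupling x eta * omega (x + e1) eta).
Proof.
have -> : expect u (generator gamma K f) =
    N%:R ^+ 2 * expect u (exclusion_gen f) + K * expect u (glauber_gen gamma f).
  by rewrite -!expectZ -expectD.
rewrite expect_exclusion /glauber_gen expect_sum.
have xm x : x - e1 != x.
  by rewrite -subr_eq0 addrAC subrr sub0r oppr_eq0 basis_vec_neq0.
have xp x : x + e1 != x.
  by rewrite -subr_eq0 addrAC subrr add0r basis_vec_neq0.
under eq_bigr do rewrite expect_flipB //.
rewrite -expect_sum -!expectZ -!expectD; apply: eq_expect => eta.
rewrite -mulr_sumr !mulrA ![_ * f eta]mulrC -!mulrA -!mulrDr; congr (_ * _).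
rewrite !mulr_sumr -!big_split /=.
pose al x := 2 * gamma - 2 * gamma ^+ 2 * (2 * u x - 1) * (2 * u (x + e1) - 1).
(* The interaction of a flip at [x] with its left neighbour belongs to the bond that ends at [x];
   the shift files it under the starting point of that bond. *)
have sh : \sum_(x : T) K * (omega x eta * (al x * centered u (x - e1) eta)) =
  \sum_(x : T) K * (omega (x + e1) eta * (al (x + e1) * centered u x eta)).
  rewrite (reindex_inj (addIr e1)) /=; apply: eq_bigr => x _; by rewrite addrK.
apply/eqP; rewrite -subr_eq0 -sumrB; apply/eqP.
rewrite (eq_bigr (fun x => K * (omega x eta * (al x * centered u (x - e1) eta))
   - K * (omega (x + e1) eta * (al (x + e1) * centered u x eta)))).
  by rewrite sumrB sh subrr.
move=> x _; rewrite /monomial /coupling /coupling0 /coupling1 /drift -/(al (x + e1)) -/(al x).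
have := mobility_gt0 x; have := mobility_gt0 (x + e1) => /lt0r_neq0 m1 /lt0r_neq0 m0.
rewrite /omega; field; rewrite K_neq0 m0 m1 //.
Qed.

End Glauber.
End Adjoint.

(** * Averages and flows *)

Section Averages.
Variables (R : realType) (d N : nat).
Local Notation T := (torus d N).
Implicit Types (g Y : T -> R) (x y z : T) (i j : 'I_d.-1.+1) (l m : nat).

Definition avg_back j m g x : R :=
  m%:R^-1 * \sum_(k < m) g (x - basis_vec j *+ k).

Definition avg_fwd j m g x : R :=
  m%:R^-1 * \sum_(k < m) g (x + basis_vec j *+ k).

(** The weight [(m - k.+1) / m] is the mass still to be carried past step [k] when a unit mass is
    spread evenly over [m] points. *)
Definition flow j m g x : R :=
  \sum_(k < m) (m - k.+1)%:R / m%:R * g (x - basis_vec j *+ k).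

Lemma sum_translate (y : T) g : \sum_(x : T) g (x + y) = \sum_(x : T) g x.
Proof. by rewrite [RHS](reindex_inj (addIr y)). Qed.

Lemma avg_adjoint j m g Y :
  \sum_(x : T) g x * avg_fwd j m Y x = \sum_(x : T) avg_back j m g x * Y x.
Proof.
rewrite /avg_fwd /avg_back.
under eq_bigr do rewrite mulrCA mulr_sumr.
under [RHS]eq_bigr do rewrite -mulrA mulr_suml.
rewrite -!mulr_sumr exchange_big [in RHS]exchange_big; congr (_ * _).
apply: eq_bigr => k _ /=.
rewrite -(sum_translate (- (basis_vec j *+ k))); apply: eq_bigr => x _.
by rewrite subrK.
Qed.

Lemma sub_mean_telescope m (a : nat -> R) : (0 < m)%N ->
  a 0%N - m%:R^-1 * \sum_(k < m) a k =
  \sum_(k < m) (m - k.+1)%:R / m%:R * (a k - a k.+1).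
Proof.
move=> m0; have m0' : (m%:R : R) != 0 by rewrite pnatr_eq0 -lt0n.
suff H : m%:R * a 0%N - \sum_(k < m) a k =
    \sum_(k < m) (m - k.+1)%:R * (a k - a k.+1).
  apply: (mulfI m0'); rewrite mulrBr mulVKf // H mulr_sumr.
  by apply: eq_bigr => k _; rewrite mulrA mulrCA mulfV // mulr1.
elim: m {m0 m0'} => [|m IH]; first by rewrite !big_ord0 mul0r subr0.
rewrite big_ord_recr [RHS]big_ord_recr /= subnn mul0r addr0.
have -> : \sum_(i < m) (m.+1 - i.+1)%:R * (a i - a i.+1) =
    \sum_(i < m) (m - i.+1)%:R * (a i - a i.+1) + \sum_(i < m) (a i - a i.+1).
  rewrite -big_split /=; apply: eq_bigr => i _.
  by rewrite subSS -(subnSK (ltn_ord i)) -natr1 mulrDl mul1r.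
have -> : \sum_(i < m) (a i - a i.+1) = a 0%N - a m.
  rewrite -(big_mkord xpredT (fun k => a k - a k.+1)) -opprB -(telescope_sumr _ (leq0n m)).
  by rewrite -sumrN; apply: eq_bigr => i _; rewrite opprB.
by rewrite -IH -natr1; ring.
Qed.

Lemma flow_telescope j m g Y : (0 < m)%N ->
  \sum_(x : T) g x * (Y x - avg_fwd j m Y x) =
  \sum_(z : T) flow j m g z * (Y z - Y (z + basis_vec j)).
Proof.
move=> m0; rewrite /flow.
transitivity (\sum_(x : T) \sum_(k < m) (m - k.+1)%:R / m%:R * (g x *
    (Y (x + basis_vec j *+ k) - Y (x + basis_vec j *+ k.+1)))).
  apply: eq_bigr => x _.
  have := @sub_mean_telescope m (fun k => Y (x + basis_vec j *+ k)) m0.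
  rewrite mulr0n addr0 /avg_fwd => ->; rewrite mulr_sumr.
  by apply: eq_bigr => k _; rewrite mulrCA.
under [RHS]eq_bigr do rewrite mulr_suml.
rewrite exchange_big [in RHS]exchange_big; apply: eq_bigr => k _ /=.
rewrite -(sum_translate (- (basis_vec j *+ k))); apply: eq_bigr => x _.
by rewrite subrK mulrSr addrA subrK mulrA.
Qed.

Lemma sqr_mean_le m (a : 'I_m -> R) :
  (m%:R^-1 * \sum_(k < m) a k) ^+ 2 <= m%:R^-1 * \sum_(k < m) a k ^+ 2.
Proof.
case: m a => [|m] a; first by rewrite invr0 !mul0r expr0n.
set s := _ * \sum_(k < m.+1) a k; have m0 : (0 : R) < m.+1%:R by rewrite ltr0n.
rewrite mulrC ler_pdivlMr //.
have sE : \sum_(k < m.+1) a k = m.+1%:R * s by rewrite /s mulVKf ?gt_eqF.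
have : 0 <= \sum_(k < m.+1) (a k - s) ^+ 2 by apply: sumr_ge0 => k _; apply: sqr_ge0.
have -> : \sum_(k < m.+1) (a k - s) ^+ 2 =
    \sum_(k < m.+1) a k ^+ 2 - 2 * s * (\sum_(k < m.+1) a k) + m.+1%:R * s ^+ 2.
  have <- : \sum_(k < m.+1) s ^+ 2 = m.+1%:R * s ^+ 2.
    by rewrite sumr_const card_ord mulr_natl.
  rewrite mulr_sumr -sumrB -big_split.
  by apply: eq_bigr => k _ /=; ring.
rewrite sE; lra.
Qed.

Lemma flow_avg_back i j l m g x :
  flow j m (avg_back i l g) x = avg_back i l (flow j m g) x.
Proof.
rewrite /flow /avg_back.
under eq_bigr do rewrite mulrCA mulr_sumr.
rewrite -mulr_sumr exchange_big; congr (_ * _); apply: eq_bigr => k _.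
by apply: eq_bigr => k' _; rewrite addrAC.
Qed.

Lemma sum_sqr_avg_back j m g :
  \sum_(x : T) avg_back j m g x ^+ 2 <= \sum_(x : T) g x ^+ 2.
Proof.
apply: (@le_trans _ _ (\sum_(x : T) m%:R^-1 * \sum_(k < m) g (x - basis_vec j *+ k) ^+ 2)).
  by apply: ler_sum => x _; apply: sqr_mean_le.
rewrite -mulr_sumr exchange_big /=.
under eq_bigr do rewrite (sum_translate _ (fun x => g x ^+ 2)).
rewrite sumr_const card_ord -[X in _ * X]mulr_natl mulrA.
case: m => [|m]; last by rewrite mulVf ?mul1r // pnatr_eq0.
by rewrite mulr0 mul0r sumr_ge0 // => x _; apply: sqr_ge0.
Qed.

(** Flows and averages are convolutions, so they commute, and averages contract the sum of
    squares. *)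
Lemma sum_sqr_flow_avg_back i j l m g :
  \sum_(x : T) flow j m (avg_back i l g) x ^+ 2 <= \sum_(x : T) flow j m g x ^+ 2.
Proof.
under eq_bigr do rewrite flow_avg_back.
exact: sum_sqr_avg_back.
Qed.

(** Each direction is averaged twice, four averages being put on [g]. Adjointness then moves two of
    them to [Y], which makes both factors of the last sum box averages. *)
Lemma two_scale_average j m1 m2 g Y : (0 < m1)%N -> (0 < m2)%N ->
  let A := avg_back ord0 m1 in let B := avg_back j m2 in
  \sum_(x : T) g x * Y x =
  \sum_(z : T) flow ord0 m1 g z * (Y z - Y (z + basis_vec ord0)) +
  \sum_(z : T) flow j m2 (A g) z * (Y z - Y (z + basis_vec j)) +
  \sum_(z : T) flow ord0 m1 (B (A g)) z * (Y z - Y (z + basis_vec ord0)) +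
  \sum_(z : T) flow j m2 (A (B (A g))) z * (Y z - Y (z + basis_vec j)) +
  \sum_(x : T) B (A g) x * avg_fwd ord0 m1 (avg_fwd j m2 Y) x.
Proof.
move=> m10 m20 A B.
have step i m h : (0 < m)%N -> \sum_(x : T) h x * Y x =
    \sum_(z : T) flow i m h z * (Y z - Y (z + basis_vec i)) +
    \sum_(x : T) avg_back i m h x * Y x.
  move=> m0; rewrite -flow_telescope // -avg_adjoint -big_split /=.
  by apply: eq_bigr => x _; rewrite -mulrDr subrK.
rewrite (step ord0 m1 g) // (step j m2 (A g)) // (step ord0 m1 (B (A g))) //.
rewrite (step j m2 (A (B (A g)))) // !avg_adjoint -/(A (B (A g))).
by rewrite /A /B !addrA.
Qed.

End Averages.

(** * How far behind a point a local function looks *)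

Section Lag.
Variables (R : realType) (d N : nat) (u : torus d N -> R).
Local Notation T := (torus d N).
Local Notation conf := (config d N).
Local Notation p := N.-1.+1.
Implicit Types (F : T -> conf -> R) (x y z : T) (j : 'I_d.-1.+1) (L m : nat).

Lemma cdist_back (a b : 'I_p) k : (k <= cdist a b)%N ->
  cdist (a - inZp k) b = (cdist a b - k)%N.
Proof.
move=> kab; have ab : (cdist a b < p)%N := ltn_ord _.
have -> : cdist (a - inZp k) b = cdist (a - b) (inZp k) by rewrite /cdist addrAC.
have kp : (k < p)%N by exact: leq_ltn_trans kab ab.
by rewrite cdistE ord_inZp //; move: kab; rewrite /cdist => ->.
Qed.

Lemma translate0 x j k :
  (x - basis_vec j *+ k) ord0 = if j == ord0 then x ord0 - inZp k else x ord0.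
Proof.
have -> : (x - basis_vec j *+ k) ord0 = x ord0 - (basis_vec j *+ k) ord0 by rewrite !ffunE.
by rewrite basis_mulrnE eq_sym; case: eqP => // _; rewrite subr0.
Qed.

(** [F x] sees only sites whose first coordinate is at most [L] steps behind that of [x]. Sites
    ahead count as very far behind on the cycle, so they are excluded too as long as [L] is small
    compared with its length. *)
Definition lag L F := forall x y, (L < cdist (x ord0) (y ord0))%N -> site_free y (F x).

(** A sum over [m] points in direction [ord0] adds at most [m - 1] to the lag; other directions do
    not move the first coordinate. *)
Lemma lag_sum L L' j m (c : nat -> R) F : lag L F -> (L <= L')%N ->
  (j == ord0 -> L + m <= L'.+1)%N ->
  lag L' (fun x eta => \sum_(k < m) c k * F (x - basis_vec j *+ k) eta).
Proof.
move=> LF LL hj x y xy b eta; apply: eq_bigr => k _; congr (_ * _).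
apply: LF; rewrite translate0; case: eqP => [/eqP j0|_]; last exact: leq_ltn_trans xy.
have := hj j0 => Lm; have km := ltn_ord k.
rewrite cdist_back; [lia|lia].
Qed.

Lemma lag_avg_back L L' j m F : lag L F -> (L <= L')%N ->
  (j == ord0 -> L + m <= L'.+1)%N ->
  lag L' (fun x eta => avg_back j m (F ^~ eta) x).
Proof.
move=> LF LL hj x y xy b eta; congr (_ * _).
have := @lag_sum L L' j m (fun=> 1) F LF LL hj x y xy b eta.
by under eq_bigr do rewrite mul1r; under [in X in _ = X -> _]eq_bigr do rewrite mul1r.
Qed.

Lemma lag_flow L L' j m F : lag L F -> (L <= L')%N ->
  (j == ord0 -> L + m <= L'.+1)%N ->
  lag L' (fun x eta => flow j m (F ^~ eta) x).
Proof. exact: (@lag_sum L L' j m (fun k => (m - k.+1)%:R / m%:R)). Qed.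

Lemma lag_monomial (q : T -> conf -> R) :
  (forall x y, y != x - basis_vec ord0 -> site_free y (q x)) ->
  lag 1 (monomial u q).
Proof.
move=> hq x y xy b eta; rewrite /monomial site_free_centered ?hq //.
  apply/negP => /eqP e; move: xy; have := translate0 x ord0 1.
  rewrite e mulr1n eqxx => ->; rewrite /cdist opprB addrC subrK ltnNge /=.
  by rewrite leq_mod.
by apply/negP => /eqP e; move: xy; rewrite e /cdist subrr.
Qed.

End Lag.

(** * Integration by parts along one bond *)

Section FlowEstimate.
Variables (R : realType) (d N : nat) (u : torus d N -> R).
Local Notation T := (torus d N).
Local Notation conf := (config d N).
Local Notation p := N.-1.+1.
Local Notation e1 := (basis_vec ord0 : T).
Variable b : R.
Hypotheses (b_gt0 : 0 < b) (u_ge : forall x, b <= u x) (u_le : forall x, b <= 1 - u x).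
Implicit Types (x y z : T) (eta : conf) (f h : conf -> R).

Lemma u01 x : 0 < u x < 1.
Proof.
rewrite (lt_le_trans b_gt0 (u_ge x)) /= -subr_gt0.
exact: lt_le_trans b_gt0 (u_le x).
Qed.

Lemma omega_le x eta : `|omega u x eta| <= b^-1.
Proof.
have /andP[x0 x1] := u01 x; have x1' : 0 < 1 - u x by rewrite subr_gt0.
rewrite /omega /centered /mobility; case: (eta x) => /=.
  have -> : (1 - u x) / (u x * (1 - u x)) = (u x)^-1.
    by field; rewrite !gt_eqF.
  by rewrite ger0_norm ?invr_ge0 ?(ltW x0) // lef_pV2 ?posrE.
have -> : (0 - u x) / (u x * (1 - u x)) = - (1 - u x)^-1.
  by field; rewrite !gt_eqF.
by rewrite normrN ger0_norm ?invr_ge0 ?(ltW x1') // lef_pV2 ?posrE.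
Qed.

(* The correction makes [current] times the product measure antisymmetric under
   the exchange of [x] and [y]; it vanishes when [u x = u y]. *)
Definition current x y eta : R :=
  omega u x eta - omega u y eta + (u x - u y) * (omega u x eta * omega u y eta).

(** In this form [current] times the measure of the two sites is 1, -1 or 0, which explains both the
    antisymmetry and the bound [b ^- 2]. *)
Lemma currentE x y eta : current x y eta =
  if eta x then (if eta y then 0 else (u x * (1 - u y))^-1)
  else (if eta y then - (u y * (1 - u x))^-1 else 0).
Proof.
have /andP[x0 x1] := u01 x; have /andP[y0 y1] := u01 y.
have x1' : 1 - u x != 0 by rewrite subr_eq0 gt_eqF.
have y1' : 1 - u y != 0 by rewrite subr_eq0 gt_eqF.
have x0' : u x != 0 by rewrite gt_eqF.
have y0' : u y != 0 by rewrite gt_eqF.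
rewrite /current /omega /centered /mobility.
by case: (eta x); case: (eta y) => /=; field; rewrite x1' y1' x0' y0'.
Qed.

Lemma current_le x y eta : `|current x y eta| <= b ^- 2.
Proof.
have /andP[x0 x1] := u01 x; have /andP[y0 y1] := u01 y.
have b2 : 0 <= b ^- 2 by rewrite invr_ge0 exprn_ge0 // ltW.
have bd z z' : `|(u z * (1 - u z'))^-1| <= b ^- 2.
  have /andP[z0 z1] := u01 z; have /andP[z0' z1'] := u01 z'.
  have zz : 0 < u z * (1 - u z') by rewrite mulr_gt0 // subr_gt0.
  rewrite ger0_norm ?invr_ge0 ?(ltW zz) // lef_pV2 ?posrE ?exprn_gt0 //.
  by rewrite expr2 ler_pM // ltW.
by rewrite currentE; case: (eta x); case: (eta y); rewrite ?normrN ?normr0.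
Qed.

Lemma product_measure_current x y eta : x != y ->
  product_measure u (exchange x y eta) * current x y (exchange x y eta) =
  - (product_measure u eta * current x y eta).
Proof.
move=> xy; rewrite !currentE !(@product_measure_split _ _ _ u x y) // !ffunE eqxx eq_sym (negbTE xy) eqxx.
rewrite (eq_bigr (fun z => if eta z then u z else 1 - u z)); last first.
  by move=> z /andP[zx zy]; rewrite ffunE (negbTE zx) (negbTE zy).
have /andP[x0 x1] := u01 x; have /andP[y0 y1] := u01 y.
have x1' : 1 - u x != 0 by rewrite subr_eq0 gt_eqF.
have y1' : 1 - u y != 0 by rewrite subr_eq0 gt_eqF.
have x0' : u x != 0 by rewrite gt_eqF.
have y0' : u y != 0 by rewrite gt_eqF.
set P := \prod_(_ | _) _.
by case: (eta x); case: (eta y) => /=; field; rewrite ?x1' ?y1' ?x0' ?y0'.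
Qed.

Lemma exchange_set_site x y eta :
  exchange x y eta = set_site x (eta y) (set_site y (eta x) eta).
Proof. by apply/ffunP => z; rewrite !ffunE. Qed.

Definition dirichlet_form f x y : R :=
  expect u (fun eta => (Num.sqrt (f (exchange x y eta)) - Num.sqrt (f eta)) ^+ 2).

Lemma expect_current_le x y f h (s : R) : x != y -> (forall eta, 0 < f eta) ->
  0 < s -> site_free x h -> site_free y h ->
  expect u (fun eta => f eta * (h eta * current x y eta)) <=
  s * dirichlet_form f x y + (4 * s * b ^+ 4)^-1 * expect u (fun eta => f eta * h eta ^+ 2).
Proof.
move=> xy f0 s0 hx hy; set t := exchange x y; pose G := current x y.
have ht eta : h (t eta) = h eta by rewrite /t exchange_set_site hx hy.
have tK eta : t (t eta) = eta by exact: exchangeK.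
have pG eta : product_measure u (t eta) * G (t eta) = - (product_measure u eta * G eta).
  exact: product_measure_current.
have swap (F : conf -> R) : expect u (fun eta => F (t eta) * (h eta * G eta)) =
    - expect u (fun eta => F eta * (h eta * G eta)).
  rewrite {1}/expect (reindex_inj (inv_inj (@exchangeK d N x y))) -sumrN.
  apply: eq_bigr => eta _; rewrite -/(t eta) ht tK.
  have -> : product_measure u (t eta) * (F eta * (h eta * G (t eta))) =
    product_measure u (t eta) * G (t eta) * (F eta * h eta) by ring.
  by rewrite pG; ring.
set D := dirichlet_form f x y.
pose V := b ^- 4 * expect u (fun eta => f eta * h eta ^+ 2).
have b4 : b ^- 4 = b ^- 2 * b ^- 2 by rewrite -invfM -exprD.
have V1 : expect u (fun eta => f eta * (h eta * G eta) ^+ 2) <= V.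
  rewrite /V -expectZ; apply: ler_expect; first exact: u01.
  move=> eta; rewrite [leRHS]mulrCA ler_pM2l // exprMn mulrC ler_wpM2r ?sqr_ge0 //.
  rewrite b4 -expr2 -(real_normK (num_real (G eta))) lerXn2r ?nnegrE ?current_le //.
  by rewrite invr_ge0 exprn_ge0 // ltW.
(* After the change of variables the antisymmetry trades [nu (t eta) * G (t eta)] for
   [- nu eta * G eta]: no bound on the ratio of the measures is needed beyond that on [current]. *)
have V2 : expect u (fun eta => f (t eta) * (h eta * G eta) ^+ 2) <= V.
  rewrite {1}/expect (reindex_inj (inv_inj (@exchangeK d N x y))) /=.
  rewrite /V -expectZ; apply: ler_sum => eta _; rewrite -/(t eta) ht tK.
  have -> : product_measure u (t eta) * (f eta * (h eta * G (t eta)) ^+ 2) =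
     product_measure u (t eta) * G (t eta) * (f eta * h eta ^+ 2 * G (t eta)) by ring.
  have nu0 := product_measure_gt0 u01 eta.
  have -> : product_measure u (t eta) * G (t eta) * (f eta * h eta ^+ 2 * G (t eta)) =
     product_measure u eta * (f eta * h eta ^+ 2 * - (G eta * G (t eta))).
    by rewrite pG; ring.
  rewrite ler_pM2l // [leRHS]mulrC ler_wpM2l //.
    exact: mulr_ge0 (ltW (f0 _)) (sqr_ge0 _).
  apply: le_trans (ler_norm _) _; rewrite normrN normrM b4.
  by rewrite ler_pM ?current_le.
have f2 : expect u (fun eta => f eta * (h eta * G eta)) + 
    expect u (fun eta => f eta * (h eta * G eta)) <=
   2 * s * D + (4 * s)^-1 * expect u (fun eta => f eta * (h eta * G eta) ^+ 2) +
   (4 * s)^-1 * expect u (fun eta => f (t eta) * (h eta * G eta) ^+ 2).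
  rewrite -[X in X + _]opprK -swap addrC -mulN1r -!expectZ -!expectD.
  apply: ler_expect; first exact: u01.
  move=> eta; rewrite -/t.
  set r := Num.sqrt (f (t eta)); set r' := Num.sqrt (f eta); set a := h eta * G eta.
  have rE : f (t eta) = r ^+ 2 by rewrite sqr_sqrtr // ltW.
  have rE' : f eta = r' ^+ 2 by rewrite sqr_sqrtr // ltW.
  rewrite rE rE'; set c := (4 * s)^-1.
  have cs : c * (4 * s) = 1 by rewrite mulVf // gt_eqF // mulr_gt0.
  have c0 : 0 < c by rewrite invr_gt0 mulr_gt0.
  (* Young's inequality as a square. Its cross term is [2 a (r^2 - r'^2)] since [c * (4 * s) = 1];
     the parallelogram identity [k4] then removes the sum [r + r']. *)
  have k1 : 0 <= c * ((4 * s * (r - r') + a * (r + r')) ^+ 2).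
    by rewrite mulr_ge0 ?sqr_ge0 // ltW.
  have k2 : 0 <= c * (a * (r - r')) ^+ 2 by rewrite mulr_ge0 ?sqr_ge0 // ltW.
  have k3 : c * ((4 * s * (r - r') + a * (r + r')) ^+ 2) =
      (c * (4 * s)) * (4 * s * (r - r') ^+ 2) + (c * (4 * s)) * (2 * a * (r ^+ 2 - r' ^+ 2))
       + c * (a * (r + r')) ^+ 2 by ring.
  rewrite k3 cs !mul1r in k1.
  have k4 : c * (a * (r + r')) ^+ 2 + c * (a * (r - r')) ^+ 2 =
    2 * (c * (r ^+ 2 * a ^+ 2)) + 2 * (c * (r' ^+ 2 * a ^+ 2)) by ring.
  rewrite !mulrA -!(mulrA c) -/a in k1 k2 k4 *.
  lra.
have c0 : 0 < (4 * s)^-1 by rewrite invr_gt0 mulr_gt0.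
have -> : (4 * s * b ^+ 4)^-1 * expect u (fun eta => f eta * h eta ^+ 2) = (4 * s)^-1 * V.
  by rewrite invfM -mulrA.
have := ler_wpM2l (ltW c0) V1; have := ler_wpM2l (ltW c0) V2.
lra.
Qed.

End FlowEstimate.

(** * The remainder due to the inhomogeneity, and the cost of one flow *)

Section Remainder.
Variables (R : realType) (d N : nat) (u : torus d N -> R).
Local Notation T := (torus d N).
Local Notation conf := (config d N).
Local Notation p := N.-1.+1.
Local Notation e1 := (basis_vec ord0 : T).
Variable b : R.
Hypotheses (b_gt0 : 0 < b) (u_ge : forall x, b <= u x) (u_le : forall x, b <= 1 - u x).
Implicit Types (x y z : T) (eta : conf) (h : conf -> R).
Variable f : conf -> R.
Hypotheses (f_gt0 : forall eta, 0 < f eta) (f_mass : expect u f = 1).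
Local Notation Ent := (entropy (product_measure u) f).

Let u_in01 := u01 b_gt0 u_ge u_le.

Lemma Ent_ge0 : 0 <= Ent. Proof. exact: entropy_ge0. Qed.

Lemma slit_entropy (a : 'I_p) (L : nat) (chi : T -> conf -> R) :
  (forall x y, ~~ (0 < cdist (x ord0) (y ord0) <= L)%N -> site_free y (chi x)) ->
  expect u (fun eta => f eta * \sum_(x : T | (L <= cdist (x ord0) a)%N)
    (centered u x eta * chi x eta - 3 * chi x eta ^+ 2)) <= Ent.
Proof. by move=> hchi; apply: expect_le_entropy => //; apply: expect_slit_le1. Qed.

(* The torus is covered by two strips, each of which unrolls. *)
Lemma martingale_entropy (L : nat) (chi : T -> conf -> R) : (2 * L <= p)%N ->
  (forall x y, ~~ (0 < cdist (x ord0) (y ord0) <= L)%N -> site_free y (chi x)) ->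
  expect u (fun eta => f eta * \sum_(x : T)
    (centered u x eta * chi x eta - 3 * chi x eta ^+ 2)) <= 2 * Ent.
Proof.
move=> Lp hchi; pose S (x : T) := (L <= cdist (x ord0) 0%R)%N.
(* The second strip is cut at [- L] so as to contain the sites left out by the first; [chi']
   vanishes on the first strip, so that each site is counted once. *)
pose chi' x eta := if S x then 0 else chi x eta.
have h1 := slit_entropy 0 hchi.
have h2 : expect u (fun eta => f eta * \sum_(x : T | (L <= cdist (x ord0) (- inZp L)%R)%N)
    (centered u x eta * chi' x eta - 3 * chi' x eta ^+ 2)) <= Ent.
  apply: slit_entropy => x y xy bb eta; rewrite /chi'; case: (S x) => //; exact: hchi.
apply: le_trans (_ : _ <= Ent + Ent) _; last by rewrite mulr_natl.
apply: le_trans (lerD h1 h2); rewrite -expectD le_eqVlt; apply/orP; left; apply/eqP.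
apply: eq_expect => eta; rewrite -mulrDr; congr (_ * _).
rewrite (bigID S) /=; congr (_ + _).
rewrite [RHS](bigID S) /= [X in _ = X + _]big1 ?add0r; last first.
  by move=> x /andP[_ Sx]; rewrite /chi' Sx mulr0 expr0n /= mulr0 subrr.
apply: eq_big => x; last by move=> Sx; rewrite /chi' (negbTE Sx).
case Sx: (S x); rewrite ?andbF ?andbT //=; apply/esym.
move: Sx; rewrite /S /cdist subr0 opprK => /negbT; rewrite -ltnNge => xL.
by rewrite ord_addE ord_inZp; [case: ifP; lia | lia].
Qed.

Lemma mobility_ge x : b ^+ 2 <= mobility u x.
Proof. by rewrite expr2 ler_pM // ltW. Qed.

Section Bond.
Variables (K s M C : R) (L : nat) (H : T -> conf -> R).
Hypotheses (K_gt0 : 0 < K) (s_gt0 : 0 < s) (M_gt0 : 0 < M) (C_ge0 : 0 <= C).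
Hypothesis grad : forall x, `|u (x + e1) - u x| <= C * s / M.
Hypothesis uE : forall x j, j != ord0 -> u (x + basis_vec j) = u x.
Hypotheses (lagH : lag L H) (L_le : (2 * L.+2 <= p)%N).

Let E2 : R := expect u (fun eta => f eta * \sum_(z : T) H z eta ^+ 2).

Lemma E2_ge0 : 0 <= E2.
Proof.
rewrite -(expect_cst u 0); apply: ler_expect => // eta.
by rewrite mulr_ge0 ?(ltW (f_gt0 _)) // sumr_ge0 // => x _; rewrite sqr_ge0.
Qed.

Lemma cdist_add1 (a : 'I_p) k : (k < p)%N -> (0 < k)%N -> cdist (a - inZp k) a = (p - k)%N.
Proof.
move=> kp k0; rewrite /cdist addrAC subrr sub0r.
have -> : - inZp k = 0 - inZp k :> 'I_p by rewrite sub0r.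
rewrite -/(cdist 0 (inZp k)) cdistE ord_inZp //=.
by case: leqP; lia.
Qed.

(** With [y = z + 2 e1] the summand is [s * w_y * chi y], where [chi y] only sees sites strictly
    behind [y], down to lag [L.+2]. Dividing the gradient by [s] makes it at most [C / M], so the
    quadratic correction is of order [1 / M^2]. *)
Lemma remainder_bound :
  expect u (fun eta => f eta * \sum_(z : T) - (u (z + e1) - u (z + e1 + e1)) *
    (H z eta * (omega u (z + e1) eta * omega u (z + e1 + e1) eta))) <=
  s * (2 * Ent + 3 * C ^+ 2 / (M ^+ 2 * b ^+ 6) * E2).
Proof.
pose chi (y : T) eta := - (u (y - e1) - u y) / s * (H (y - e1 - e1) eta *
   omega u (y - e1) eta / mobility u y).
have chi_free x y : ~~ (0 < cdist (x ord0) (y ord0) <= L.+2)%N -> site_free y (chi x).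
  move=> xy bb eta; rewrite /chi.
  have x2 : (x - e1 - e1) ord0 = x ord0 - inZp 2.
    by rewrite -addrA -opprD -[e1 + e1]mulr2n translate0 eqxx.
  have Hf : site_free y (H (x - e1 - e1)).
    apply: lagH; rewrite x2; move: xy; rewrite negb_and -leqNgt leqn0 -ltnNge.
    move=> /orP[/eqP xy|xy].
      have -> : y ord0 = x ord0.
        apply/esym/eqP; rewrite -subr_eq0; apply/eqP/val_inj; exact: xy.
      by rewrite cdist_add1 //; lia.
    by rewrite cdist_back; lia.
  have xyn : y != x - e1.
    apply/negP => /eqP yE; move: xy; have := translate0 x ord0 1.
    rewrite mulr1n eqxx yE => ->; rewrite /cdist opprB addrC subrK ord_inZp //; lia.
  have of_ : site_free y (omega u (x - e1)).
    by move=> b' eta'; rewrite /omega site_free_centered.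
  by rewrite Hf of_.
have := @martingale_entropy L.+2 chi L_le chi_free.
rewrite -(ler_pM2l s_gt0) -expectZ => h0.
have h1 : expect u (fun eta => s * (f eta * \sum_(x : T) (3 * chi x eta ^+ 2))) <=
    s * (3 * C ^+ 2 / (M ^+ 2 * b ^+ 6) * E2).
  rewrite expectZ ler_pM2l // -expectZ; apply: ler_expect => // eta.
  rewrite [leRHS]mulrCA ler_wpM2l ?(ltW (f_gt0 _)) //.
  rewrite -(sum_translate e1) -(sum_translate e1) mulr_sumr; apply: ler_sum => z _.
  rewrite /chi !addrK -(mulrA 3) -(mulrA 3) ler_pM2l //.
  set r := u (z + e1) - u _; have rb : `|r| <= C * s / M.
    by rewrite distrC; apply: grad.
  set o := omega u _ eta; have ob : `|o| <= b^-1 by exact: omega_le.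
  set g := mobility _ _; have gb : b ^+ 2 <= g by exact: mobility_ge.
  have b2 : 0 < b ^+ 2 by rewrite exprn_gt0.
  have g0 : 0 < g by exact: lt_le_trans gb.
  have -> : (- r / s * (H z eta * o / g)) ^+ 2 = (`|r| ^+ 2 / s ^+ 2) * (`|o| ^+ 2 / g ^+ 2) * H z eta ^+ 2.
    by rewrite !real_normK ?num_real //; field; rewrite !gt_eqF.
  rewrite ler_wpM2r ?sqr_ge0 //.
  have -> : C ^+ 2 / (M ^+ 2 * b ^+ 6) = ((C * s / M) ^+ 2 / s ^+ 2) * (b^-1 ^+ 2 / (b ^+ 2) ^+ 2).
    by field; rewrite !gt_eqF.
  have Cs : 0 <= C * s / M by rewrite divr_ge0 ?mulr_ge0 // ltW.
  apply: ler_pM.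
  - by rewrite divr_ge0 ?sqr_ge0.
  - by rewrite divr_ge0 ?sqr_ge0.
  - by rewrite ler_wpM2r ?invr_ge0 ?sqr_ge0 // lerXn2r ?nnegrE.
  apply: ler_pM; rewrite ?invr_ge0 ?sqr_ge0 //.
    by rewrite lerXn2r ?nnegrE ?invr_ge0 ?(ltW b_gt0).
  by rewrite lef_pV2 ?posrE ?exprn_gt0 // lerXn2r ?nnegrE ?(ltW g0) ?(ltW b2).
rewrite mulrDr; apply: le_trans (lerD h0 h1); rewrite -expectD le_eqVlt.
apply/orP; left; apply/eqP; apply: eq_expect => eta.
rewrite -!mulrDr mulrCA; congr (_ * _); rewrite -big_split mulr_sumr.
rewrite -[RHS](sum_translate e1) -[RHS](sum_translate e1); apply: eq_bigr => z _ /=.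
rewrite subrK /chi !addrK [omega u (z + e1 + e1) eta]/omega.
have := mobility_gt0 u_in01 (z + e1 + e1) => /lt0r_neq0 m0.
by field; rewrite m0 gt_eqF.
Qed.

(** The difference of the two [omega] is the current minus an inhomogeneous product. Young's
    parameter [M^2 / (4 K)] spends a quarter of the Dirichlet form on the current; the product goes
    to [remainder_bound] if [j = ord0] and vanishes otherwise. *)
Lemma flow_bound j :
  expect u (fun eta => f eta * (K * \sum_(z : T) H z eta *
     (omega u (z + e1) eta - omega u (z + e1 + basis_vec j) eta))) <=
  M ^+ 2 / 4 * (\sum_(z : T) dirichlet_form u f z (z + basis_vec j)) +
  (K ^+ 2 / (M ^+ 2 * b ^+ 4) + 3 * K * s * C ^+ 2 / (M ^+ 2 * b ^+ 6)) * E2 +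
  2 * K * s * Ent.
Proof.
have := Ent_ge0; have := E2_ge0 => E20 H0.
have e10 k : (0 < k)%N -> (k < p)%N -> (basis_vec ord0 *+ k : T) != 0.
  move=> k0 kp; apply/eqP => /(congr1 (fun v : T => v ord0 : nat)).
  by rewrite basis_mulrnE eqxx ord_inZp // ffunE /=; lia.
(* The exchanged sites lie one or two steps ahead of [z], hence more than [L] steps behind it around
   the cycle. *)
have free1 (z : T) : site_free (z + e1) (H z).
  apply: lagH; have -> : z ord0 = (z + e1) ord0 - inZp 1.
    by rewrite !ffunE eqxx addrK.
  by rewrite cdist_add1; lia.
have free2 (z : T) : site_free (z + e1 + basis_vec j) (H z).
  apply: lagH; have [->|j0] := eqVneq j ord0.
    have -> : z ord0 = (z + e1 + e1) ord0 - inZp 2.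
      have := translate0 (z + e1 + e1) ord0 2.
      by rewrite eqxx mulr2n opprD addrA !addrK.
    by rewrite cdist_add1; lia.
  have -> : z ord0 = (z + e1 + basis_vec j) ord0 - inZp 1.
    by rewrite !ffunE eqxx eq_sym (negbTE j0) addr0 addrK.
  by rewrite cdist_add1; lia.
have bond (z : T) : z + e1 != z + e1 + basis_vec j.
  rewrite -subr_eq0 opprD addNKr oppr_eq0 basis_vec_neq0 //; lia.
have cur (z : T) : expect u (fun eta => f eta * (H z eta * current u (z + e1) (z + e1 + basis_vec j) eta)) <=
   M ^+ 2 / (4 * K) * dirichlet_form u f (z + e1) (z + e1 + basis_vec j) +
   K / (M ^+ 2 * b ^+ 4) * expect u (fun eta => f eta * H z eta ^+ 2).
  have s0 : 0 < M ^+ 2 / (4 * K) by rewrite divr_gt0 ?mulr_gt0 ?exprn_gt0.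
  have := expect_current_le b_gt0 u_ge u_le (bond z) f_gt0 s0 (free1 z) (free2 z).
  congr (_ <= _ + _ * _); field; rewrite !gt_eqF //.
have rem : expect u (fun eta => f eta * \sum_(z : T) - (u (z + e1) - u (z + e1 + basis_vec j)) *
    (H z eta * (omega u (z + e1) eta * omega u (z + e1 + basis_vec j) eta))) <=
   s * (2 * Ent + 3 * C ^+ 2 / (M ^+ 2 * b ^+ 6) * E2).
  have [->|j0] := eqVneq j ord0; first exact: remainder_bound.
  rewrite (@eq_expect _ _ _ _ _ (fun=> 0)) ?expect_cst //; last first.
    by move=> eta; rewrite big1 ?mulr0 // => z _; rewrite (uE (z + e1) j0) subrr oppr0 mul0r.
  have c0 : 0 <= 3 * C ^+ 2 / (M ^+ 2 * b ^+ 6).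
    apply: divr_ge0; first by rewrite mulr_ge0 ?sqr_ge0.
    by rewrite mulr_ge0 ?sqr_ge0 // exprn_ge0 // ltW.
  apply: mulr_ge0; first exact: ltW.
  by apply: addr_ge0; apply: mulr_ge0.
have -> : expect u (fun eta => f eta * (K * \sum_(z : T) H z eta *
     (omega u (z + e1) eta - omega u (z + e1 + basis_vec j) eta))) =
  K * (\sum_(z : T) expect u (fun eta => f eta * (H z eta * current u (z + e1) (z + e1 + basis_vec j) eta))
   + expect u (fun eta => f eta * \sum_(z : T) - (u (z + e1) - u (z + e1 + basis_vec j)) *
    (H z eta * (omega u (z + e1) eta * omega u (z + e1 + basis_vec j) eta)))).
  rewrite -expect_sum -expectD -expectZ; apply: eq_expect => eta.
  rewrite -mulr_sumr -mulrDr mulrCA -big_split; congr (_ * (_ * _)).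
  by apply: eq_bigr => z _; rewrite /current /=; ring.
apply: (@le_trans _ _ (K * (\sum_(z : T) (M ^+ 2 / (4 * K) * dirichlet_form u f (z + e1) (z + e1 + basis_vec j) +
   K / (M ^+ 2 * b ^+ 4) * expect u (fun eta => f eta * H z eta ^+ 2)) +
   s * (2 * Ent + 3 * C ^+ 2 / (M ^+ 2 * b ^+ 6) * E2)))).
  by rewrite ler_pM2l // lerD // ler_sum.
rewrite big_split /= -!mulr_sumr (sum_translate e1 (fun z => dirichlet_form u f z (z + basis_vec j))).
have -> : \sum_(z : T) expect u (fun eta => f eta * H z eta ^+ 2) = E2.
  by rewrite -expect_sum; apply: eq_expect => eta; rewrite mulr_sumr.
rewrite le_eqVlt; apply/orP; left; apply/eqP; field.
by rewrite !gt_eqF.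
Qed.

End Bond.
End Remainder.

(** * Quadratic functionals bounded by the entropy *)

Section BoxEntropy.
Variables (R : realType) (d N : nat) (u : torus d N -> R).
Local Notation T := (torus d N).
Local Notation conf := (config d N).
Local Notation p := N.-1.+1.
Local Notation e1 := (basis_vec ord0 : T).
Hypothesis u01 : forall x, 0 < u x < 1.
Variable f : conf -> R.
Hypotheses (f_gt0 : forall eta, 0 < f eta) (f_mass : expect u f = 1).
Local Notation Ent := (entropy (product_measure u) f).
Implicit Types (x y z : T) (eta : conf).
Variables (Q : R) (q : T -> conf -> R).
Hypotheses (Q_gt0 : 0 < Q) (Q_ge : forall x eta, `|q x eta| <= Q).
Hypothesis q_free : forall x y : T, y != x - basis_vec ord0 -> site_free y (q x).

(** The factor [m1 * m2] is the price of the colour classes, and [v] bounds the variance of one box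
    sum up to a constant. *)
Lemma box_entropy m1 m2 j (c : 'I_m1 * 'I_m2 -> R) (v : R) :
  (0 < m1)%N -> (0 < m2)%N -> (m1 < p)%N -> (m2 <= p)%N -> j != ord0 \/ m2 = 1%N ->
  0 < v -> \sum_k c k ^+ 2 <= v ->
  expect u (fun eta => f eta * \sum_(z : T) box_sum u q j c z eta ^+ 2) <=
  192 * Q ^+ 2 * (m1 * m2)%:R * v * (Ent + 5 * #|T|%:R / (m1 * m2)%:R).
Proof.
move=> m10 m20 m1p m2p hj v0 cv.
set m : R := (m1 * m2)%:R; have m0 : 0 < m by rewrite ltr0n muln_gt0 m10.
set P : R := (2 * m1.+1 * (2 * m2))%:R.
have P1 : 4 * m <= P by rewrite /m /P -(natrM _ 4) ler_nat; nia.
have P2 : P <= 8 * m by rewrite /m /P -(natrM _ 8) ler_nat; nia.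
have Q2 : 0 < Q ^+ 2 by rewrite exprn_gt0.
(* Since [P <= 8 m], the exponent condition becomes [8 * 3 / 192 = 1 / 8]; the constant 5 in the
   conclusion exceeds [19 / 4], from [P >= 4 m]. *)
set w := 192 * Q ^+ 2 * m * v; have w0 : 0 < w by rewrite !mulr_gt0.
have k0 : 0 <= w^-1 by rewrite invr_ge0 ltW.
have kP : w^-1 * P * (3 * Q ^+ 2 * \sum_k c k ^+ 2) <= 1 / 8.
  rewrite -mulrA mulrC ler_pdivrMr //.
  apply: (@le_trans _ _ ((8 * m) * (3 * Q ^+ 2 * v))).
    apply: ler_pM => //.
      apply: mulr_ge0; first by apply: mulr_ge0 => //; apply: ltW.
      by apply: sumr_ge0 => k _; apply: sqr_ge0.
    by rewrite ler_pM2l // mulr_gt0.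
  by rewrite le_eqVlt; apply/orP; left; apply/eqP; rewrite /w; field.
have := expect_le_entropy u01 f_gt0 f_mass
  (expect_box_sqr u01 Q_ge q_free m10 m20 m1p m2p hj k0 kP).
have -> : expect u (fun eta => f eta * (w^-1 * \sum_(z : T) box_sum u q j c z eta ^+ 2 -
      19 * #|T|%:R / P)) =
    w^-1 * expect u (fun eta => f eta * \sum_(z : T) box_sum u q j c z eta ^+ 2) -
      19 * #|T|%:R / P.
  set a := 19 * _ / P; have aE : - a = - a * expect u f by rewrite f_mass mulr1.
  rewrite [in RHS]aE -!expectZ -expectD.
  by apply: eq_expect => eta; rewrite mulrBr mulrCA mulNr [_ * a]mulrC.
rewrite lerBlDr ler_pdivrMl // => /le_trans; apply.
rewrite ler_pM2l // lerD2l.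
have P0 : 0 < P by apply: lt_le_trans P1; rewrite mulr_gt0.
rewrite ler_pdivrMr // mulrAC ler_pdivlMr //.
have := ler0n R #|T|; move: (#|T|%:R) => t t0.
have := ler_wpM2l t0 P1; have := mulr_ge0 t0 (ltW m0); lra.
Qed.

(** The weights of a flow are at most 1, so [v = m]: nothing compensates the size of the box. *)
Lemma flow0_entropy m : (0 < m)%N -> (m < p)%N ->
  expect u (fun eta => f eta * \sum_(z : T) flow ord0 m ((monomial u q)^~ eta) z ^+ 2) <=
  192 * Q ^+ 2 * m%:R ^+ 2 * (Ent + 5 * #|T|%:R / m%:R).
Proof.
move=> m0 mp.
have := @box_entropy m 1 ord0 (fun k => (m - k.1.+1)%:R / m%:R) m%:R m0 isT mp (ltn0Sn _)
  (or_intror erefl) _ _.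
rewrite muln1 ltr0n m0 -[_ * m%:R * m%:R]mulrA -expr2 => h.
apply: le_trans (h isT _); last first.
  rewrite -(pair_bigA _ (fun (k : 'I_m) (l : 'I_1) => ((m - k.+1)%:R / m%:R) ^+ 2)) /=.
  apply: (@le_trans _ _ (\sum_(k < m) 1)); last by rewrite sumr_const card_ord.
  apply: ler_sum => k _; rewrite big_ord1 expr_le1 // ?divr_ge0 //.
  by rewrite ler_pdivrMr ?ltr0n // mul1r ler_nat leq_subr.
rewrite le_eqVlt; apply/orP; left; apply/eqP/eq_expect => eta; congr (_ * _).
apply: eq_bigr => z _; congr (_ ^+ 2); rewrite /flow /box_sum.
rewrite -(pair_bigA _ (fun (k : 'I_m) (l : 'I_1) => (m - k.+1)%:R / m%:R *
  monomial u q (back ord0 k l z) eta)) /=.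
by apply: eq_bigr => k _; rewrite big_ord1 /back mulr0n addr0.
Qed.

Lemma flow_entropy j m : (0 < m)%N -> (m <= p)%N -> (1 < p)%N -> j != ord0 \/ m = 1%N ->
  expect u (fun eta => f eta * \sum_(z : T) flow j m ((monomial u q)^~ eta) z ^+ 2) <=
  192 * Q ^+ 2 * m%:R ^+ 2 * (Ent + 5 * #|T|%:R / m%:R).
Proof.
move=> m0 mp p1 hj.
have := @box_entropy 1 m j (fun k => (m - k.2.+1)%:R / m%:R) m%:R isT m0 p1 mp hj _ _.
rewrite mul1n ltr0n m0 -[_ * m%:R * m%:R]mulrA -expr2 => h.
apply: le_trans (h isT _); last first.
  rewrite -(pair_bigA _ (fun (l : 'I_1) (k : 'I_m) => ((m - k.+1)%:R / m%:R) ^+ 2)) /=.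
  rewrite big_ord1.
  apply: (@le_trans _ _ (\sum_(k < m) 1)); last by rewrite sumr_const card_ord.
  apply: ler_sum => k _; rewrite expr_le1 // ?divr_ge0 //.
  by rewrite ler_pdivrMr ?ltr0n // mul1r ler_nat leq_subr.
rewrite le_eqVlt; apply/orP; left; apply/eqP/eq_expect => eta; congr (_ * _).
apply: eq_bigr => z _; congr (_ ^+ 2); rewrite /flow /box_sum.
rewrite -(pair_bigA _ (fun (l : 'I_1) (k : 'I_m) => (m - k.+1)%:R / m%:R *
  monomial u q (back j l k z) eta)) /=.
by rewrite big_ord1; apply: eq_bigr => k _; rewrite /back mulr0n add0r.
Qed.

(** The squared weights of an average sum to [1 / (m1 * m2)], which cancels the price of the colour
    classes. *)
Lemma avg_entropy j m1 m2 :
  (0 < m1)%N -> (0 < m2)%N -> (m1 < p)%N -> (m2 <= p)%N -> j != ord0 \/ m2 = 1%N ->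
  expect u (fun eta => f eta * \sum_(z : T)
     avg_back j m2 (avg_back ord0 m1 ((monomial u q)^~ eta)) z ^+ 2) <=
  192 * Q ^+ 2 * (Ent + 5 * #|T|%:R / (m1 * m2)%:R).
Proof.
move=> m10 m20 m1p m2p hj; set m : R := (m1 * m2)%:R.
have m0 : 0 < m by rewrite ltr0n muln_gt0 m10.
have := @box_entropy m1 m2 j (fun=> m^-1) m^-1 m10 m20 m1p m2p hj.
rewrite invr_gt0 m0 -/m -[_ * m * m^-1]mulrA divff ?gt_eqF // mulr1 => h.
apply: le_trans (h isT _); last first.
  by rewrite sumr_const card_prod !card_ord -mulr_natl -/m expr2 mulrA divff ?gt_eqF // mul1r.
rewrite le_eqVlt; apply/orP; left; apply/eqP/eq_expect => eta; congr (_ * _).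
apply: eq_bigr => z _; congr (_ ^+ 2); rewrite /avg_back /box_sum.
rewrite -(pair_bigA _ (fun (k : 'I_m1) (l : 'I_m2) => m^-1 * monomial u q (back j k l z) eta)) /=.
rewrite exchange_big mulr_sumr; apply: eq_bigr => l _ /=.
rewrite -mulr_sumr mulrA /m natrM invfM [_^-1 * _^-1]mulrC; congr (_ * _).
by apply: eq_bigr => k _; rewrite /back opprD addrA addrAC.
Qed.

End BoxEntropy.

Section ForwardAverage.
Variables (R : realType) (d N : nat).
Local Notation T := (torus d N).
Implicit Types (g Y : T -> R) (x y z : T) (i j : 'I_d.-1.+1) (l m : nat).

Lemma avg_fwd_back j m Y x :
  avg_fwd j m Y x = avg_back j m Y (x + basis_vec j *+ m.-1).
Proof.
congr (_ * _); rewrite (reindex_inj rev_ord_inj); apply: eq_bigr => k _ /=.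
congr Y; rewrite -addrA; congr (_ + _); have := ltn_ord k.
case: m k => [|m] k km; first by case: k km.
by rewrite subSS -mulrnBr.
Qed.

Lemma avg_backC i j l m g x :
  avg_back i l (avg_back j m g) x = avg_back j m (avg_back i l g) x.
Proof.
rewrite /avg_back -!mulr_sumr mulrCA exchange_big; congr (_ * (_ * _)).
by apply: eq_bigr => k _; apply: eq_bigr => k' _; rewrite addrAC.
Qed.

Lemma avg_back_translate j m g (v : T) x :
  avg_back j m (fun y => g (y + v)) x = avg_back j m g (x + v).
Proof. by congr (_ * _); apply: eq_bigr => k _; rewrite addrAC. Qed.

(** Forward averages are translates of backward ones, which gives the averages of [omega] access to
    [avg_entropy]. *)
Lemma sum_sqr_avg_fwd i j l m g (v : T) :
  \sum_(x : T) avg_fwd i l (avg_fwd j m (fun y => g (y + v))) x ^+ 2 =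
  \sum_(x : T) avg_back j m (avg_back i l g) x ^+ 2.
Proof.
pose w := basis_vec i *+ l.-1 + (basis_vec j *+ m.-1 + v).
rewrite -[RHS](sum_translate w); apply: eq_bigr => x _; congr (_ ^+ 2).
rewrite avg_fwd_back.
have -> : avg_fwd j m (fun y => g (y + v)) =
    fun y => avg_back j m g (y + (basis_vec j *+ m.-1 + v)).
  by apply: funext => y; rewrite avg_fwd_back avg_back_translate addrA.
by rewrite avg_back_translate avg_backC -addrA.
Qed.

End ForwardAverage.

Lemma scale_bounds m1 m2 n : (2 * (2 * m1).+3 <= n)%N -> (0 < m2)%N -> (m2 <= m1)%N ->
  [/\ (1 < n)%N, (0 < m1)%N, (m1 < n)%N & (m2 <= n)%N].
Proof. by move=> *; split; lia. Qed.

Lemma lag_bounds m : [/\ (1 <= m.+1)%N, (1 + m <= m.+2)%N, (m.+1 <= (2 * m).+1)%N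
  & (m.+1 + m <= (2 * m).+2)%N].
Proof. by split; lia. Qed.

Lemma sum_flow_bounds (R : realFieldType) (K M2 D0 D1 D2 B V W x0 x1 x2 x3 x4 x5 : R) :
  K * x5 <= M2 / 4 * D1 + B -> K * x4 <= M2 / 4 * D0 + B ->
  K * x3 <= M2 / 4 * D1 + B -> K * x2 <= M2 / 4 * D0 + B ->
  x1 <= W -> M2 * (2^-1 * D1 + 2^-1 * D0) <= M2 * D2 -> K * x0 <= V ->
  x1 + K * (x5 + x4 + x3 + x2 + x0) <= M2 * D2 + W + 4 * B + V.
Proof. lra. Qed.

(** * The bound on the expectation of the generator *)

Section Static.
Variables (R : realType) (d N : nat) (u : torus d N -> R).
Local Notation T := (torus d N).
Local Notation conf := (config d N).
Local Notation p := N.-1.+1.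
Local Notation e1 := (basis_vec ord0 : T).
Variable b : R.
Hypotheses (b_gt0 : 0 < b) (u_ge : forall x, b <= u x) (u_le : forall x, b <= 1 - u x).
Implicit Types (x y z : T) (eta : conf) (h : conf -> R).
Variable f : conf -> R.
Hypotheses (f_gt0 : forall eta, 0 < f eta) (f_mass : expect u f = 1).
Local Notation Ent := (entropy (product_measure u) f).
Variables (gamma K s C Q Dr : R) (m1 m2 : nat) (j : 'I_d.-1.+1).
Hypotheses (K_gt0 : 0 < K) (s_gt0 : 0 < s) (N_gt0 : (0 < N)%N) (C_ge0 : 0 <= C).
Hypothesis grad : forall x, `|u (x + e1) - u x| <= C * s / N%:R.
Hypothesis uE : forall x i, i != ord0 -> u (x + basis_vec i) = u x.
Hypotheses (Q_gt0 : 0 < Q) (Q_ge : forall x eta, `|coupling u gamma K x eta| <= Q).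
Hypothesis Q_ge_mobility : forall x, (mobility u x)^-1 <= Q.
Hypothesis drift_le : forall x, `|drift u gamma K x| <= Dr.
Hypotheses (m2_gt0 : (0 < m2)%N) (m21 : (m2 <= m1)%N).
Hypotheses (m1_le : (2 * (2 * m1).+3 <= p)%N) (hj : j != ord0 \/ m2 = 1%N).

Let u_in01 := u01 b_gt0 u_ge u_le.
Let M : R := N%:R.
Let psi := monomial u (coupling u gamma K).
Let q_free : forall x y : T, y != x - e1 -> site_free y (coupling u gamma K x).
Proof. by move=> x y xy bb eta; rewrite /coupling site_free_centered. Qed.

Let sizes : [/\ (1 < p)%N, (0 < m1)%N, (m1 < p)%N & (m2 <= p)%N].
Proof. exact: scale_bounds m1_le m2_gt0 m21. Qed.

Definition flow_cost : R := 192 * Q ^+ 2 * (m1%:R ^+ 2 * Ent + 5 * m1%:R * #|T|%:R).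

Definition bond_cost : R :=
  (K ^+ 2 / (M ^+ 2 * b ^+ 4) + 3 * K * s * C ^+ 2 / (M ^+ 2 * b ^+ 6)) * flow_cost
  + 2 * K * s * Ent.

Let M_gt0 : 0 < M. Proof. by rewrite ltr0n. Qed.
Let Ent_pos : 0 <= Ent. Proof. exact: (entropy_ge0 u_in01). Qed.

(** [F] stands for the averages made before the flow; they only reduce the sum of squares, so all
    four flows have the same cost. *)
Lemma flow_le_cost i m (F : (T -> R) -> T -> R) :
  (i = ord0 /\ m = m1 \/ i = j /\ m = m2) ->
  (forall g, \sum_(z : T) flow i m (F g) z ^+ 2 <= \sum_(z : T) flow i m g z ^+ 2) ->
  lag (2 * m1).+1 (fun z eta => flow i m (F (psi^~ eta)) z) ->
  expect u (fun eta => f eta * (K * \sum_(z : T) flow i m (F (psi^~ eta)) z *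
     (omega u (z + e1) eta - omega u (z + e1 + basis_vec i) eta))) <=
  M ^+ 2 / 4 * (\sum_(z : T) dirichlet_form u f z (z + basis_vec i)) + bond_cost.
Proof.
move=> im hF lagF.
apply: le_trans (flow_bound b_gt0 u_ge u_le f_gt0 f_mass K_gt0 s_gt0 M_gt0 C_ge0
  grad uE lagF m1_le i) _.
rewrite -addrA lerD2l /bond_cost lerD2r.
have b4 k : 0 <= M ^+ 2 * b ^+ k by rewrite mulr_ge0 ?sqr_ge0 // exprn_ge0 // ltW.
apply: ler_wpM2l.
  apply: addr_ge0; apply: divr_ge0 => //; first exact: sqr_ge0.
  by rewrite mulr_ge0 ?sqr_ge0 // mulr_ge0 ?(ltW s_gt0) // mulr_ge0 // ltW.
apply: (@le_trans _ _ (expect u (fun eta => f eta * \sum_(z : T) flow i m (psi^~ eta) z ^+ 2))).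
  by apply: ler_expect => // eta; rewrite ler_pM2l.
have Q2 : 0 < 192 * Q ^+ 2 by rewrite mulr_gt0 // exprn_gt0.
have [p1 m10 m1p m2p] := sizes; case: im => -[-> ->] {hF lagF}.
  apply: le_trans (flow0_entropy u_in01 f_gt0 f_mass Q_gt0 Q_ge q_free m10 m1p) _.
  rewrite /flow_cost -mulrA ler_pM2l // mulrDr lerD2l le_eqVlt; apply/orP; left; apply/eqP.
  by field; rewrite pnatr_eq0 -lt0n.
apply: le_trans (flow_entropy u_in01 f_gt0 f_mass Q_gt0 Q_ge q_free m2_gt0 m2p p1 hj) _.
have m20 : (0 : R) < m2%:R by rewrite ltr0n.
have m21' : (m2%:R : R) <= m1%:R by rewrite ler_nat.
rewrite /flow_cost -mulrA ler_pM2l // mulrDr; apply: lerD.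
  by rewrite ler_wpM2r // lerXn2r ?nnegrE.
have -> : m2%:R ^+ 2 * (5 * #|T|%:R / m2%:R) = 5 * m2%:R * #|T|%:R :> R.
  by field; rewrite gt_eqF.
by rewrite ler_wpM2r // ler_pM2l.
Qed.

(** Two flows in direction [ord0] and two in direction [j], at a quarter each, use at most one
    Dirichlet form, also when [j = ord0]. The averaged product is split by
    [2 a a' <= a^2 + a'^2]. *)
Lemma static_bound :
  expect u (generator gamma K f) <=
  M ^+ 2 * (\sum_(z : T) \sum_i dirichlet_form u f z (z + basis_vec i)) +
  #|T|%:R * (b^-1 * Dr) + 4 * bond_cost +
  192 * K * Q ^+ 2 * (Ent + 5 * #|T|%:R / (m1 * m2)%:R).
Proof.
have [p1 m10 m1p m2p] := sizes.
rewrite expect_generator // ?gt_eqF //.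
have lin : expect u (fun eta => f eta * \sum_(x : T) omega u x eta * drift u gamma K x)
    <= #|T|%:R * (b^-1 * Dr).
  have -> : #|T|%:R * (b^-1 * Dr) = #|T|%:R * (b^-1 * Dr) * expect u f by rewrite f_mass mulr1.
  rewrite -expectZ; apply: ler_expect => // eta.
  rewrite [leRHS]mulrC ler_pM2l //.
  apply: (@le_trans _ _ (\sum_(x : T) b^-1 * Dr)); last by rewrite sumr_const mulr_natl.
  apply: ler_sum => x _; apply: le_trans (ler_norm _) _; rewrite normrM.
  by apply: ler_pM => //; apply: omega_le.
pose A := @avg_back R d N ord0 m1; pose B := @avg_back R d N j m2.
have lag1 : lag 1 psi by apply: lag_monomial; exact: q_free.
(* For [j = ord0] the averages in direction [j] run over a single point and leave the lag
   unchanged. *)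
have jm L (L' : nat) : (L <= L')%N -> (j == ord0 -> L + m2 <= L'.+1)%N.
  by move=> LL j0; move: hj; rewrite j0 => -[//|->]; rewrite addn1 ltnS.
have [l1 l2 l3 l4] := lag_bounds m1.
have lagA : lag m1.+1 (fun z eta => A (psi^~ eta) z) by apply: (lag_avg_back lag1).
have lagBA : lag m1.+1 (fun z eta => B (A (psi^~ eta)) z).
  by apply: (lag_avg_back lagA) => //; apply: jm.
have lagABA : lag (2 * m1).+1 (fun z eta => A (B (A (psi^~ eta))) z).
  by apply: (lag_avg_back lagBA).
have l5 : (1 <= (2 * m1).+1)%N by [].
have l6 : (1 + m1 <= (2 * m1).+2)%N by exact: leq_trans (leq_add l1 (leqnn m1)) l4.
have b1 := @flow_le_cost ord0 m1 id (or_introl (conj erefl erefl)) (fun g => lexx _)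
  (lag_flow lag1 l5 (fun=> l6)).
have b2 := @flow_le_cost j m2 A (or_intror (conj erefl erefl))
  (fun g => sum_sqr_flow_avg_back _ _ _ _ _) (lag_flow lagA l3 (jm _ _ l3)).
have b3 := @flow_le_cost ord0 m1 (fun g => B (A g)) (or_introl (conj erefl erefl))
  (fun g => le_trans (sum_sqr_flow_avg_back _ _ _ _ _) (sum_sqr_flow_avg_back _ _ _ _ _))
  (lag_flow lagBA l3 (fun=> l4)).
have b4 := @flow_le_cost j m2 (fun g => A (B (A g))) (or_intror (conj erefl erefl))
  (fun g => le_trans (sum_sqr_flow_avg_back _ _ _ _ _)
    (le_trans (sum_sqr_flow_avg_back _ _ _ _ _) (sum_sqr_flow_avg_back _ _ _ _ _)))
  (lag_flow lagABA (leqnn _) (jm _ _ (leqnn _))).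
have mob_le : forall x (eta : conf), `|(mobility u x)^-1| <= Q.
  move=> x eta; have m0 := mobility_gt0 u_in01 x; rewrite ger0_norm ?invr_ge0 ?(ltW m0) //.
pose Y (x : T) eta := omega u (x + e1) eta.
have a1 := avg_entropy u_in01 f_gt0 f_mass Q_gt0 Q_ge q_free m10 m2_gt0 m1p m2p hj.
have a2 := @avg_entropy _ _ _ u u_in01 f f_gt0 f_mass Q (fun x _ => (mobility u x)^-1) Q_gt0 _ _ 
  j m1 m2 m10 m2_gt0 m1p m2p hj.
have {}a2 := a2 mob_le (fun x y _ bb eta => erefl).
have {}a2 : expect u (fun eta => f eta * \sum_(x : T)
    avg_fwd ord0 m1 (avg_fwd j m2 (Y^~ eta)) x ^+ 2) <=
    192 * Q ^+ 2 * (Ent + 5 * #|T|%:R / (m1 * m2)%:R).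
  apply: le_trans a2.
    rewrite le_eqVlt; apply/orP; left; apply/eqP/eq_expect => eta.
    congr (_ * _); exact: (@sum_sqr_avg_fwd R d N ord0 j m1 m2 ((omega u)^~ eta) e1).
have quad : expect u (fun eta => f eta * \sum_(x : T) monomial u (coupling u gamma K) x eta * omega u (x + e1) eta) =
  expect u (fun eta => f eta * \sum_(z : T) flow ord0 m1 (psi^~ eta) z *
     (omega u (z + e1) eta - omega u (z + e1 + e1) eta)) +
  expect u (fun eta => f eta * \sum_(z : T) flow j m2 (A (psi^~ eta)) z *
     (omega u (z + e1) eta - omega u (z + e1 + basis_vec j) eta)) +
  expect u (fun eta => f eta * \sum_(z : T) flow ord0 m1 (B (A (psi^~ eta))) z *
     (omega u (z + e1) eta - omega u (z + e1 + e1) eta)) +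
  expect u (fun eta => f eta * \sum_(z : T) flow j m2 (A (B (A (psi^~ eta)))) z *
     (omega u (z + e1) eta - omega u (z + e1 + basis_vec j) eta)) +
  expect u (fun eta => f eta * \sum_(x : T) B (A (psi^~ eta)) x *
     avg_fwd ord0 m1 (avg_fwd j m2 (Y^~ eta)) x).
  rewrite -!expectD; apply: eq_expect => eta; rewrite -!mulrDr; congr (_ * _).
  have := two_scale_average j (psi^~ eta) (Y^~ eta) m10 m2_gt0; rewrite -/A -/B /Y => ->.
  by do 4?[congr (_ + _)]; apply: eq_bigr => z _; rewrite ?[z + _ + e1]addrAC.
have last : expect u (fun eta => f eta * \sum_(x : T) B (A (psi^~ eta)) x *
     avg_fwd ord0 m1 (avg_fwd j m2 (Y^~ eta)) x) <=
    192 * Q ^+ 2 * (Ent + 5 * #|T|%:R / (m1 * m2)%:R).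
  set V := 192 * _ * _ in a1 a2 *.
  have : expect u (fun eta => f eta * \sum_(x : T) B (A (psi^~ eta)) x *
     avg_fwd ord0 m1 (avg_fwd j m2 (Y^~ eta)) x) <=
    2^-1 * (expect u (fun eta => f eta * \sum_(x : T) B (A (psi^~ eta)) x ^+ 2) +
    expect u (fun eta => f eta * \sum_(x : T) avg_fwd ord0 m1 (avg_fwd j m2 (Y^~ eta)) x ^+ 2)).
    rewrite -expectD -expectZ; apply: ler_expect => // eta.
    rewrite -mulrDr mulrCA ler_pM2l // -big_split mulr_sumr; apply: ler_sum => x _ /=.
    set a := B _ _; set a' := avg_fwd _ _ _ _.
    by have := sqr_ge0 (a - a'); rewrite sqrrB; lra.
  move=> /le_trans; apply; move: a1 a2; rewrite -/A -/B -/psi.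
  set a1 := expect u _; set a2 := expect u _; lra.
rewrite quad.
have pull (X : conf -> R) : expect u (fun eta => f eta * (K * X eta)) = K * expect u (fun eta => f eta * X eta).
  by rewrite -expectZ; apply: eq_expect => eta; rewrite mulrCA.
rewrite !pull in b1 b2 b3 b4.
have := ler_wpM2l (ltW K_gt0) last.
have dir : 2^-1 * (\sum_(z : T) dirichlet_form u f z (z + e1)) +
    2^-1 * (\sum_(z : T) dirichlet_form u f z (z + basis_vec j)) <=
    \sum_(z : T) \sum_i dirichlet_form u f z (z + basis_vec i).
  rewrite -mulrDr -big_split mulr_sumr; apply: ler_sum => z _ /=.
  have D0 x y : 0 <= dirichlet_form u f x y.
    rewrite -(expect_cst u 0); apply: ler_expect => // eta; exact: sqr_ge0.
  have Di i : dirichlet_form u f z (z + basis_vec i) <= \sum_i dirichlet_form u f z (z + basis_vec i).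
    by rewrite (bigD1 i) //= lerDl sumr_ge0.
  have := Di ord0; have := Di j; lra.
have := ler_wpM2l (sqr_ge0 M) dir.
move: b1 b2 b3 b4 lin.
move: (expect u _) (expect u _) (expect u _) (expect u _) (expect u _) (expect u _).
move: (\sum_(z : T) _) (\sum_(z : T) _) (\sum_(z : T) _).
move: bond_cost (M ^+ 2) => bc M2 D0 D1 D2 x0 x1 x2 x3 x4 x5.
have -> : 192 * K * Q ^+ 2 * (Ent + 5 * #|T|%:R / (m1 * m2)%:R) =
    K * (192 * Q ^+ 2 * (Ent + 5 * #|T|%:R / (m1 * m2)%:R)).
  by rewrite -!mulrA mulrCA.
exact: sum_flow_bounds.
Qed.

End Static.

(** * Semigroup and entropy production *)

Section Derivatives.
Variable R : realType.
Implicit Types (f : R -> R) (t : R).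

Lemma is_derive_bigsum (I : Type) (s : seq I) (F : I -> R -> R) (dF : I -> R) t :
  (forall i, is_derive t (1 : R) (F i) (dF i)) ->
  is_derive t (1 : R) (fun r => \sum_(i <- s) F i r) (\sum_(i <- s) dF i).
Proof.
move=> hF; elim: s => [|i s IH].
  rewrite big_nil (_ : (fun _ => _) = cst 0); last by apply: funext => r; rewrite big_nil.
  exact: is_derive_cst.
rewrite big_cons (_ : (fun _ => _) = F i + (fun r => \sum_(i <- s) F i r)); last first.
  by apply: funext => r; rewrite big_cons.
exact: is_deriveD.
Qed.

Lemma is_derive_mulr f df t (c : R) : is_derive t (1 : R) f df ->
  is_derive t (1 : R) (fun r => c * f r) (c * df).
Proof. by move=> hf; exact: (is_deriveZ c). Qed.

Lemma is_derive_continuous f (df : R -> R) (a b : R) :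
  (forall t, is_derive t (1 : R) f (df t)) -> {within `[a, b], continuous f}.
Proof.
move=> hf; apply: continuous_subspaceT => t.
by apply: differentiable_continuous; apply/derivable1_diffP; have [] := hf t.
Qed.

Lemma MVT_le f (df : R -> R) (a b M : R) :
  (forall t, is_derive t (1 : R) f (df t)) -> a <= b ->
  (forall t, a <= t <= b -> df t <= M) -> f b - f a <= M * (b - a).
Proof.
move=> hf ab hM.
have [c cab ->] := MVT_segment ab (fun t _ => hf t) (is_derive_continuous hf).
by rewrite ler_wpM2r ?subr_ge0 // hM.
Qed.

End Derivatives.

Section MatrixSeries.
Variables (R : realType) (X : finType).
Implicit Types (A : X -> X -> R) (f : X -> R) (t : R) (x y z : X) (n : nat).

Definition act A f x : R := \sum_y A x y * f y.

Definition mexp A t f x : R :=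
  limn (series (fun n => t ^+ n / n`!%:R * iter n (act A) f x)).

Definition entries A : R := \sum_x \sum_y `|A x y|.

Lemma iter_act_le A n f x : `|iter n (act A) f x| <= entries A ^+ n * \sum_y `|f y|.
Proof.
elim: n x => [|n IH] x /=.
  by rewrite expr0 mul1r (bigD1 x) //= lerDl sumr_ge0.
apply: (@le_trans _ _ (\sum_y `|A x y| * (entries A ^+ n * \sum_z `|f z|))).
  apply: le_trans (ler_norm_sum _ _ _) _; apply: ler_sum => y _.
  by rewrite normrM ler_wpM2l.
rewrite -mulr_suml exprS -mulrA ler_wpM2r //.
  by rewrite mulr_ge0 ?exprn_ge0 ?sumr_ge0 // => ? _; rewrite sumr_ge0.
by rewrite /entries [leRHS](bigD1 x) //= lerDl sumr_ge0 // => ? _; rewrite sumr_ge0.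
Qed.

Definition coef A f x n : R := iter n (act A) f x / n`!%:R.

Lemma mexpE A t f x : mexp A t f x = limn (pseries (coef A f x) t).
Proof.
rewrite /mexp /pseries; congr (limn (series _)); apply: funext => n.
by rewrite /coef mulrC mulrA mulrAC.
Qed.

Lemma coef_diffs A f x : pseries_diffs (coef A f x) = coef A (act A f) x.
Proof.
apply: funext => n; rewrite /pseries_diffs /coef factS natrM invfM.
by rewrite iterSr mulrCA mulVKf ?pnatr_eq0.
Qed.

Lemma cvg_coef A f x t : cvgn (pseries (coef A f x) t).
Proof.
apply: normed_cvg.
pose F : R := \sum_y `|f y|; have F0 : 0 <= F by rewrite sumr_ge0.
have E0 : 0 <= entries A by rewrite sumr_ge0 // => ? _; rewrite sumr_ge0.
apply: (@series_le_cvg _ _ (F *: exp_coeff (entries A * `|t|))).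
- by move=> n; exact: normr_ge0.
- by move=> n; apply: mulr_ge0 => //; apply: divr_ge0; rewrite ?exprn_ge0 ?mulr_ge0.
- move=> n; rewrite /coef /= normrM normrM normrX normfV (ger0_norm (ler0n _ _)).
  have -> : (F *: exp_coeff (entries A * `|t|)) n =
      entries A ^+ n * F / n`!%:R * `|t| ^+ n.
    transitivity (F * ((entries A * `|t|) ^+ n / n`!%:R)) => //.
    by rewrite exprMn; ring.
  by rewrite ler_wpM2r ?exprn_ge0 // ler_wpM2r ?invr_ge0 // iter_act_le.
by apply: is_cvg_seriesZ; exact: is_cvg_series_exp_coeff.
Qed.

(** Termwise differentiation shifts the coefficients, that is, replaces [f] by [act A f]. *)
Lemma is_derive_mexp A f x t :
  is_derive t (1 : R) (fun r => mexp A r f x) (mexp A t (act A f) x).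
Proof.
rewrite mexpE -coef_diffs (_ : (fun _ => _) = fun r => limn (pseries (coef A f x) r)); last first.
  by apply: funext => r; rewrite mexpE.
have tK : `|t| < `| `|t| + 1 |.
  by rewrite [ltRHS]ger0_norm ?ltrDl // addr_ge0.
by apply: (pseries_snd_diffs _ _ _ tK); rewrite ?coef_diffs; apply: cvg_coef.
Qed.

Lemma mexp0 A f x : mexp A 0 f x = f x.
Proof.
rewrite mexpE; apply: cvg_lim => //; apply: cvg_near_cst; near=> n.
rewrite /pseries /series /=.
have n0 : (0 < n)%N by near: n; exists 1%N.
rewrite -(prednK n0) big_nat_recl // /coef /= fact0 divr1 expr0 mulr1 big1 ?addr0 // => i _.
by rewrite exprS mul0r mulr0.
Unshelve. all: by end_near. Qed.

Lemma cvg_bigsum (I : Type) (s : seq I) (F : I -> nat -> R) (l : I -> R) :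
  (forall i, F i n @[n --> \oo] --> l i) ->
  (\sum_(i <- s) F i n) @[n --> \oo] --> \sum_(i <- s) l i.
Proof.
move=> hF; elim: s => [|i s IH].
  rewrite big_nil (_ : (fun _ => _) = cst 0); first exact: cvg_cst.
  by apply: funext => n; rewrite big_nil.
rewrite big_cons (_ : (fun _ => _) = (fun n => F i n + \sum_(i <- s) F i n)).
  exact: cvgD.
by apply: funext => n; rewrite big_cons.
Qed.

Definition delta y x : R := (x == y)%:R.

Lemma sum_delta f x : \sum_y f y * delta y x = f x.
Proof.
rewrite (bigD1 x) //= /delta eqxx mulr1 big1 ?addr0 // => y yx.
by rewrite eq_sym (negbTE yx) mulr0.
Qed.

Lemma iter_act_sum A n f x :
  iter n (act A) f x = \sum_y f y * iter n (act A) (delta y) x.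
Proof.
elim: n x => [|n IH] x /=; first by rewrite sum_delta.
transitivity (\sum_y A x y * iter n (act A) f y) => //.
under [LHS]eq_bigr => z _ do rewrite IH mulr_sumr.
rewrite exchange_big; apply: eq_bigr => y _ /=.
rewrite [act A _ x]/act mulr_sumr.
by apply: eq_bigr => z _; rewrite mulrCA.
Qed.

Lemma mexp_sum A t f x : mexp A t f x = \sum_y f y * mexp A t (delta y) x.
Proof.
rewrite mexpE; apply: cvg_lim => //.
rewrite (_ : pseries _ _ = fun n => \sum_y f y * pseries (coef A (delta y) x) t n).
  apply: cvg_bigsum => y; rewrite mexpE; apply: cvgMl_tmp; exact: cvg_coef.
apply: funext => n; rewrite /pseries /series /=.
under [RHS]eq_bigr do rewrite mulr_sumr.
rewrite exchange_big /=; apply: eq_bigr => k _.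
rewrite /coef iter_act_sum !mulr_suml; apply: eq_bigr => y _; by rewrite !mulrA.
Qed.

Definition evolve A (mu : X -> R) t y : R := \sum_x mu x * mexp A t (delta y) x.

Lemma evolve0 A mu y : evolve A mu 0 y = mu y.
Proof.
rewrite /evolve; under eq_bigr do rewrite mexp0 /delta eq_sym.
exact: (sum_delta mu y).
Qed.

(** Kolmogorov's forward equation, obtained from the backward one by expanding [act A (delta y)] in
    point masses. *)
Lemma is_derive_evolve A mu t y :
  is_derive t (1 : R) (fun r => evolve A mu r y) (\sum_z evolve A mu t z * A z y).
Proof.
have -> : \sum_z evolve A mu t z * A z y = \sum_x mu x * mexp A t (act A (delta y)) x.
  rewrite /evolve; under eq_bigr do rewrite mulr_suml.
  rewrite exchange_big; apply: eq_bigr => x _ /=.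
  rewrite mexp_sum mulr_sumr; apply: eq_bigr => z _.
  have -> : act A (delta y) z = A z y.
    rewrite /act (bigD1 y) //= /delta eqxx mulr1 big1 ?addr0 // => w /negbTE ->.
    by rewrite mulr0.
  by rewrite mulrA mulrAC.
apply: is_derive_bigsum => x; apply: is_derive_mulr; exact: is_derive_mexp.
Qed.

Lemma entries_ge A x y : `|A x y| <= entries A.
Proof.
rewrite /entries (bigD1 x) //= (bigD1 y) //= -addrA lerDl addr_ge0 ?sumr_ge0 //.
by move=> z _; rewrite sumr_ge0.
Qed.

(* Gronwall's lemma for [\sum_y v y ^+ 2]. *)
Lemma linear_ode_unique A (v : R -> X -> R) :
  (forall t y, is_derive t (1 : R) (v ^~ y) (\sum_z v t z * A z y)) ->
  (forall y, v 0 y = 0) -> forall t, 0 <= t -> forall y, v t y = 0.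
Proof.
move=> hv v0 t t0 y.
pose C : R := \sum_(y : X) \sum_(z : X) 2 * entries A.
pose S r := \sum_y v r y ^+ 2.
pose dS r := \sum_y 2 * v r y * \sum_z v r z * A z y.
have sqr_le r z : v r z ^+ 2 <= S r.
  by rewrite /S (bigD1 z) //= lerDl sumr_ge0 // => w _; apply: sqr_ge0.
have derS r : is_derive r (1 : R) S (dS r).
  apply: is_derive_bigsum => z; have h := is_deriveX 2 (hv r z).
  by apply: is_derive_eq h _; rewrite /GRing.scale /= expr1 -mulr_natl.
have dS_le r : dS r <= C * S r.
  rewrite /dS /C mulr_suml; apply: ler_sum => z _; rewrite mulr_suml mulr_sumr.
  apply: ler_sum => w _; have vz := sqr_le r z; have vw := sqr_le r w.
  have h : `|v r z * v r w| <= S r.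
    rewrite ler_norml; have := sqr_ge0 (v r z + v r w); have := sqr_ge0 (v r z - v r w).
    rewrite sqrrB sqrrD; lra.
  have -> : 2 * v r z * (v r w * A w z) = 2 * (v r z * v r w * A w z) by ring.
  rewrite -[leRHS]mulrA ler_pM2l //; apply: le_trans (ler_norm _) _; rewrite normrM mulrC.
  by apply: ler_pM => //; apply: entries_ge.
pose g r := expR (- C * r) * S r.
have derg r : is_derive r (1 : R) g (expR (- C * r) * dS r + S r * (expR (- C * r) * - C)).
  have e1 : is_derive r (1 : R) (fun s => - C * s) (- C).
    have := is_derive_mulr (- C) (is_derive_id r (1 : R)); by rewrite mulr1.
  have e2 := is_derive1_comp (is_derive_expR (- C * r)) e1.
  have := is_deriveM e2 (derS r); exact.
have := MVT_le (M := 0) derg t0 _.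
rewrite mul0r {2}/g /S (eq_bigr (fun=> 0)) ?big1 // ?mulr0 ?subr0; last first.
  by move=> z _; rewrite v0 expr0n.
move=> /(_ _)/wrap[|gt].
  move=> r _.
  have -> : expR (- C * r) * dS r + S r * (expR (- C * r) * - C) =
    expR (- C * r) * (dS r - C * S r) by ring.
  by rewrite pmulr_rle0 ?expR_gt0 // subr_le0.
have St : S t <= 0 by move: gt; rewrite /g pmulr_rle0 ?expR_gt0.
have := le_trans (sqr_le t y) St.
by rewrite real_exprn_even_le0 ?num_real //= => /eqP.
Qed.

End MatrixSeries.

Section Positivity.
Variables (R : realType) (X : finType).
Implicit Types (A : X -> X -> R) (f mu : X -> R) (t : R) (x y z : X) (n : nat).

(** All terms of the series are nonnegative and the zeroth one is [f x]. *)
Lemma mexp_ge A t f x : (forall x y, 0 <= A x y) -> (forall x, 0 <= f x) -> 0 <= t ->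
  f x <= mexp A t f x.
Proof.
move=> A0 f0 t0; rewrite mexpE; apply: limr_ge; first exact: cvg_coef.
have iter0 n y : 0 <= iter n (act A) f y.
  elim: n y => [|n IH] y //=; apply: sumr_ge0 => z _; exact: mulr_ge0.
near=> n; have n0 : (0 < n)%N by near: n; exists 1%N.
rewrite /pseries /series /= -(prednK n0) big_nat_recl //= /coef /= fact0 divr1 expr0 mulr1.
rewrite lerDl sumr_ge0 // => i _; apply: mulr_ge0; last exact: exprn_ge0.
by apply: divr_ge0 => //; exact: (iter0 i.+1).
Unshelve. all: by end_near. Qed.

(* Adding a multiple of the identity makes all entries nonnegative and only
   multiplies the flow by an exponential. *)
Lemma evolve_gt0 A mu t y : (forall x y, x != y -> 0 <= A x y) ->
  (forall x, 0 < mu x) -> 0 <= t -> 0 < evolve A mu t y.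
Proof.
move=> A0 mu0 t0; pose L := entries A; pose B x y := A x y + L * delta R x y.
have B0 x z : 0 <= B x z.
  rewrite /B /delta; have [->|zx] := eqVneq z x; last first.
    by rewrite mulr0 addr0 A0 // eq_sym.
  by rewrite mulr1; have := entries_ge A x x; rewrite ler_norml => /andP[]; rewrite -/L; lra.
pose q r z := expR (- L * r) * evolve B mu r z.
have q_gt0 : 0 < q t y.
  rewrite mulr_gt0 ?expR_gt0 //.
  have d0 z w : 0 <= delta R z w by rewrite /delta ler0n.
  rewrite /evolve (bigD1 y) //= ltr_wpDr //.
    apply: sumr_ge0 => z _; apply: mulr_ge0; first exact: ltW.
    by apply: le_trans (mexp_ge z B0 (d0 y) t0).
  rewrite mulr_gt0 //; apply: lt_le_trans (mexp_ge y B0 (d0 y) t0).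
  by rewrite /delta eqxx.
suff -> : evolve A mu t y = q t y by [].
apply/eqP; rewrite -subr_eq0; apply/eqP.
apply: (@linear_ode_unique _ _ A (fun r z => evolve A mu r z - q r z)) => //; last first.
  by move=> z; rewrite /q mulr0 expR0 mul1r !evolve0 subrr.
move=> r z.
have e1 : is_derive r (1 : R) (fun s => - L * s) (- L).
  have := is_derive_mulr (- L) (is_derive_id r (1 : R)); by rewrite mulr1.
have e2 := is_derive1_comp (is_derive_expR (- L * r)) e1.
have e3 := is_deriveM e2 (is_derive_evolve B mu r z).
have e4 := is_deriveB (is_derive_evolve A mu r z) e3.
apply: is_derive_eq e4 _; rewrite /GRing.scale /=.
under [RHS]eq_bigr do rewrite mulrBl; rewrite sumrB; congr (_ - _).
rewrite /B; under eq_bigr do rewrite mulrDr; rewrite big_split /= mulrDr.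
have -> : \sum_w evolve B mu r w * (L * delta R w z) = L * evolve B mu r z.
  under eq_bigr do rewrite mulrCA; rewrite -mulr_sumr; congr (_ * _).
  rewrite -[RHS](sum_delta (evolve B mu r)); apply: eq_bigr => w _.
  by rewrite /delta.
rewrite mulr_sumr /q -[RHS]addr0 -addrA; congr (_ + _).
  by apply: eq_bigr => w _; rewrite mulrA.
by rewrite /B /=; ring.
Qed.

Lemma evolve_mass A mu t : (forall x, \sum_y A x y = 0) -> 0 <= t ->
  \sum_y evolve A mu t y = \sum_y mu y.
Proof.
move=> A0 t0; pose S r := \sum_y evolve A mu r y.
have dS r : is_derive r (1 : R) S 0.
  have := @is_derive_bigsum R _ (index_enum X) (fun y r => evolve A mu r y) _ r
    (fun y => is_derive_evolve A mu r y).
  rewrite exchange_big big1 // => z _; by rewrite -mulr_sumr A0 mulr0.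
have [c _] := MVT_segment t0 (fun r _ => dS r) (is_derive_continuous dS).
rewrite mul0r => /eqP; rewrite subr_eq0 => /eqP; rewrite {1}/S => ->.
by apply: eq_bigr => y _; rewrite evolve0.
Qed.

(** Positivity is asked at time [t] only and the series makes sense for negative times, so the
    derivative is two-sided even at [t = 0]. *)
Lemma is_derive_entropy A mu (nu : X -> R) t : (forall y, 0 < nu y) ->
  (forall y, 0 < evolve A mu t y) ->
  is_derive t (1 : R)
    (fun r => \sum_y nu y * (evolve A mu r y / nu y * ln (evolve A mu r y / nu y)))
    (\sum_z evolve A mu t z * act A (fun y => ln (evolve A mu t y / nu y) + 1) z).
Proof.
move=> nu0 p0.
have -> : \sum_z evolve A mu t z * act A (fun y => ln (evolve A mu t y / nu y) + 1) z =
  \sum_y (\sum_z evolve A mu t z * A z y) * (ln (evolve A mu t y / nu y) + 1).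
  under eq_bigr do rewrite /act mulr_sumr.
  rewrite exchange_big; apply: eq_bigr => y _; rewrite mulr_suml.
  by apply: eq_bigr => z _; rewrite mulrA.
apply: is_derive_bigsum => y; set dp := \sum_z _.
have h1 : is_derive t (1 : R) (fun r => evolve A mu r y / nu y) (dp / nu y).
  rewrite [dp / _]mulrC (_ : (fun _ => _) = fun r => (nu y)^-1 * evolve A mu r y).
    exact: is_derive_mulr (is_derive_evolve A mu t y).
  by apply: funext => r; rewrite mulrC.
have f0 : 0 < evolve A mu t y / nu y by rewrite divr_gt0.
have h2 := @is_derive1_comp R (@ln R) (fun r => evolve A mu r y / nu y) t _ _ (is_derive1_ln f0) h1.
have h3 := is_derive_mulr (nu y) (is_deriveM h1 h2).
apply: is_derive_eq h3 _; rewrite /GRing.scale /=.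
have nu1 := lt0r_neq0 (nu0 y); have p1 := lt0r_neq0 (p0 y).
by field; rewrite nu1 p1.
Qed.

End Positivity.

(** * Entropy production of the dynamics *)

Section Production.
Variables (R : realType) (d N : nat) (u : torus d N -> R) (gamma K : R).
Local Notation T := (torus d N).
Local Notation conf := (config d N).
Hypothesis u01 : forall x, 0 < u x < 1.
Hypotheses (gamma01 : 0 <= gamma <= 1) (K_ge0 : 0 <= K).
Implicit Types (f g : conf -> R) (eta zeta : conf).

Definition jump (zeta eta : conf) : R := generator gamma K (delta R eta) zeta.

Lemma generator_sum (I : finType) (a : I -> R) (F : I -> conf -> R) zeta :
  generator gamma K (fun eta => \sum_i a i * F i eta) zeta =
  \sum_i a i * generator gamma K (F i) zeta.
Proof.
have B (eta : conf) : \sum_i a i * F i eta - \sum_i a i * F i zeta =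
    \sum_i a i * (F i eta - F i zeta).
  by rewrite -sumrB; apply: eq_bigr => i _; rewrite mulrBr.
rewrite /generator.
have -> : exclusion_gen (fun eta => \sum_i a i * F i eta) zeta =
    \sum_i a i * exclusion_gen (F i) zeta.
  rewrite /exclusion_gen; under [RHS]eq_bigr do rewrite mulr_sumr.
  rewrite [RHS]exchange_big; apply: eq_bigr => x _ /=.
  under [RHS]eq_bigr do rewrite mulr_sumr.
  by rewrite [RHS]exchange_big; apply: eq_bigr => j _ /=; rewrite B.
have -> : glauber_gen gamma (fun eta => \sum_i a i * F i eta) zeta =
    \sum_i a i * glauber_gen gamma (F i) zeta.
  rewrite /glauber_gen; under [RHS]eq_bigr do rewrite mulr_sumr.
  rewrite [RHS]exchange_big; apply: eq_bigr => x _ /=.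
  by rewrite B mulr_sumr; apply: eq_bigr => i _; rewrite mulrCA.
by rewrite !mulr_sumr -big_split; apply: eq_bigr => i _ /=; ring.
Qed.

Lemma act_jump g : act jump g = generator gamma K g.
Proof.
apply: funext => zeta; rewrite /act /jump.
have -> : g = fun eta => \sum_xi g xi * delta R xi eta.
  by apply: funext => eta; rewrite sum_delta.
rewrite generator_sum; apply: eq_bigr => eta _.
by rewrite mulrC; congr (_ * _); rewrite sum_delta.
Qed.

(** The bound [ln x <= x - 1] at [x = sqrt (b / a)]; working with square roots is what leaves the
    square as a gain. *)
Lemma sqrt_log_ineq (a b : R) : 0 < a -> 0 < b ->
  a * (ln b - ln a) <= b - a - (Num.sqrt b - Num.sqrt a) ^+ 2.
Proof.
move=> a0 b0; set r := Num.sqrt a; set s := Num.sqrt b.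
have r0 : 0 < r by rewrite sqrtr_gt0.
have s0 : 0 < s by rewrite sqrtr_gt0.
have -> : a = r ^+ 2 by rewrite sqr_sqrtr // ltW.
have -> : b = s ^+ 2 by rewrite sqr_sqrtr // ltW.
rewrite !lnXn //.
have h : ln s - ln r <= s / r - 1.
  rewrite -ln_div ?posrE // -{1}[s / r](subrK 1) addrC; apply: le_ln1Dx.
  by rewrite ltrBrDr addNr divr_gt0.
have r2 : 0 <= r ^+ 2 by rewrite sqr_ge0.
have := ler_wpM2l r2 h.
have -> : r ^+ 2 * (s / r - 1) = r * s - r ^+ 2 by field; rewrite gt_eqF.
rewrite !mulr2n; lra.
Qed.

Lemma spin_sqr eta (x : T) : spin R eta x ^+ 2 = 1.
Proof. by rewrite /spin; case: (eta x) => /=; ring. Qed.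

Lemma spin_le eta (x : T) : `|spin R eta x| <= 1.
Proof. by rewrite /spin; case: (eta x) => /=; rewrite ler_norml; lra. Qed.

(** As the square of a spin is 1, the rate factorises, which makes its sign visible. *)
Lemma glauber_rateE eta : glauber_rate gamma eta =
  (1 - gamma * spin R eta 0 * spin R eta (- basis_vec ord0)) *
  (1 - gamma * spin R eta 0 * spin R eta (basis_vec ord0)).
Proof.
rewrite /glauber_rate; have := spin_sqr eta 0.
move: (spin R eta 0) (spin R eta (- basis_vec ord0)) (spin R eta (basis_vec ord0)) => a b c a2.
transitivity (1 - gamma * a * (b + c) + gamma ^+ 2 * b * c * a ^+ 2); last by ring.
by rewrite a2 mulr1.
Qed.

Lemma glauber_rate_bounds eta : 0 <= glauber_rate gamma eta <= 4.
Proof.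
have bd x : 0 <= 1 - gamma * spin R eta 0 * spin R eta x <= 2.
  have : `|gamma * spin R eta 0 * spin R eta x| <= 1.
    have /andP[g0 g1] := gamma01; rewrite !normrM (ger0_norm g0).
    apply: mulr_ile1; rewrite ?mulr_ge0 ?spin_le //.
    by apply: mulr_ile1; rewrite ?spin_le.
  by rewrite ler_norml; lra.
rewrite glauber_rateE; have /andP[a0 a1] := bd (- basis_vec ord0).
have /andP[b0 b1] := bd (basis_vec ord0); rewrite mulr_ge0 //=.
by have -> : (4 : R) = 2 * 2 by [lra]; apply: ler_pM.
Qed.

(** [sqrt_log_ineq] for each jump: the square is kept for exchanges and dropped for flips, whose
    rates are nonnegative. *)
Lemma generator_log_le f eta : (forall zeta, 0 < f zeta) ->
  f eta * generator gamma K (fun zeta => ln (f zeta) + 1) eta <=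
  generator gamma K f eta - N%:R ^+ 2 * \sum_(z : T) \sum_i
    (Num.sqrt (f (exchange z (z + basis_vec i) eta)) - Num.sqrt (f eta)) ^+ 2.
Proof.
have e (a c : R) : a + 1 - (c + 1) = a - c by ring.
move=> f0; rewrite /generator mulrDr addrAC; apply: lerD.
  rewrite mulrCA -mulrBr ler_wpM2l ?sqr_ge0 // /exclusion_gen mulr_sumr -sumrB.
  apply: ler_sum => x _; rewrite mulr_sumr -sumrB; apply: ler_sum => j _.
  have := sqrt_log_ineq (f0 eta) (f0 (exchange x (x + basis_vec j) eta)).
  by rewrite e.
rewrite mulrCA ler_wpM2l // /glauber_gen mulr_sumr; apply: ler_sum => x _.
rewrite mulrCA ler_wpM2l //; first by have /andP[] := glauber_rate_bounds (translate x eta).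
rewrite e; apply: le_trans (sqrt_log_ineq (f0 eta) (f0 (flip x eta))) _.
by rewrite gerBl sqr_ge0.
Qed.

Lemma semigroupE t f : semigroup gamma K t f = mexp jump t f.
Proof.
apply: funext => eta; rewrite /semigroup /mexp; congr (limn (series _)).
apply: funext => n; congr (_ * _).
by elim: n eta => [//|n IH] eta /=; rewrite act_jump; congr generator; apply: funext.
Qed.

Lemma law_atE t nu eta : law_at gamma K t nu eta = evolve jump nu t eta.
Proof. by rewrite /law_at /evolve; apply: eq_bigr => xi _; rewrite semigroupE. Qed.

Lemma jump_ge0 zeta eta : zeta != eta -> 0 <= jump zeta eta.
Proof.
move=> ze; have d0 xi : 0 <= delta R eta xi - delta R eta zeta.
  by rewrite {2}/delta (negbTE ze) subr0 /delta ler0n.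
rewrite /jump /generator addr_ge0 // mulr_ge0 ?sqr_ge0 //.
  by rewrite /exclusion_gen sumr_ge0 // => x _; rewrite sumr_ge0.
rewrite /glauber_gen sumr_ge0 // => x _; rewrite mulr_ge0 //.
by have /andP[] := glauber_rate_bounds (translate x zeta).
Qed.

Lemma jump_sum zeta : \sum_eta jump zeta eta = 0.
Proof.
have := congr1 (fun h => h zeta) (act_jump (fun=> 1)).
rewrite /act; under eq_bigr do rewrite mulr1.
move=> ->; rewrite /generator.
have -> : exclusion_gen (fun=> 1 : R) zeta = 0.
  by apply: big1 => x _; apply: big1 => j _; rewrite subrr.
have -> : glauber_gen gamma (fun=> 1 : R) zeta = 0.
  by apply: big1 => x _; rewrite subrr mulr0.
by rewrite !mulr0 addr0.
Qed.

Let nu := product_measure u.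

Lemma density_gt0 t eta : 0 <= t -> 0 < density gamma K t nu eta.
Proof.
move=> t0; have nu0 := product_measure_gt0 u01; rewrite /density law_atE divr_gt0 ?nu0 //.
by apply: evolve_gt0 => //; exact: jump_ge0.
Qed.

Lemma density_mass t : 0 <= t -> expect u (density gamma K t nu) = 1.
Proof.
move=> t0; have nu0 := product_measure_gt0 u01.
transitivity (\sum_eta evolve jump nu t eta).
  apply: eq_bigr => eta _; rewrite /density law_atE mulrC divfK // gt_eqF //.
rewrite evolve_mass //; last exact: jump_sum.
by rewrite -(expect1 u); apply: eq_bigr => eta _; rewrite mulr1.
Qed.

Lemma is_derive_entropy_density (mu : conf -> R) t : 0 <= t -> (forall eta, 0 < mu eta) ->
  let f := density gamma K t mu in
  is_derive t (1 : R) (fun r => entropy mu (density gamma K r mu))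
    (\sum_eta mu eta * (f eta * generator gamma K (fun zeta => ln (f zeta) + 1) eta)).
Proof.
move=> t0 mu0 f.
have mu_neq0 eta : mu eta != 0 by exact: lt0r_neq0.
have fE r : density gamma K r mu = fun eta => evolve jump mu r eta / mu eta.
  by apply: funext => eta; rewrite /density law_atE.
have p0 eta : 0 < evolve jump mu t eta by apply: evolve_gt0 => //; exact: jump_ge0.
have h := is_derive_entropy mu0 p0; rewrite act_jump in h.
rewrite (_ : (fun _ => _) = fun r => \sum_y mu y *
    (evolve jump mu r y / mu y * ln (evolve jump mu r y / mu y))); last first.
  by apply: funext => r; rewrite fE.
apply: is_derive_eq h _; apply: eq_bigr => eta _.
rewrite mulrA /f fE; congr (_ * _).
by rewrite mulrCA mulfV ?mulr1.
Qed.

Lemma entropy_production t : 0 <= t ->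
  let f := density gamma K t nu in
  let H r := entropy nu (density gamma K r nu) in
  derivable H t 1 /\
  derive1 H t <= expect u (generator gamma K f) -
    N%:R ^+ 2 * \sum_(z : T) \sum_i dirichlet_form u f z (z + basis_vec i).
Proof.
move=> t0 f H; have [dH dHE] := is_derive_entropy_density t0 (product_measure_gt0 u01).
have f0 eta : 0 < f eta by exact: density_gt0.
split; first exact: dH.
rewrite derive1E dHE.
apply: le_trans (ler_expect u01 (fun eta => generator_log_le eta f0)) _.
rewrite le_eqVlt; apply/orP; left; apply/eqP.
rewrite -mulNr /dirichlet_form; under [in RHS]eq_bigr do rewrite -expect_sum.
rewrite -expect_sum -expectZ -expectD; apply: eq_expect => eta.
by rewrite mulNr.
Qed.

End Production.

(** * The periodic profile *)

Section Profile.
Variable R : realType.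

Lemma MVT_norm_le (f df : R -> R) (a b M : R) :
  (forall t, is_derive t (1 : R) f (df t)) -> a <= b ->
  (forall t, a <= t <= b -> `|df t| <= M) -> `|f b - f a| <= M * (b - a).
Proof.
move=> hf ab hM.
have [c cab ->] := MVT_segment ab (fun t _ => hf t) (is_derive_continuous hf).
by rewrite normrM [X in _ * X]ger0_norm ?subr_ge0 // ler_wpM2r ?subr_ge0 // hM.
Qed.

Lemma taylor2_le (f f1 f2 : R -> R) (e M : R) :
  (forall t, is_derive t (1 : R) f (f1 t)) -> (forall t, is_derive t (1 : R) f1 (f2 t)) ->
  f 0 = 0 -> f1 0 = 0 -> 0 <= e -> (forall t, 0 <= t <= e -> `|f2 t| <= M) ->
  `|f e| <= M * e ^+ 2.
Proof.
move=> hf hf1 f0 f10 e0 hM.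
have M0 : 0 <= M by apply: le_trans (hM 0 _) => //; rewrite lexx.
have h1 t : 0 <= t <= e -> `|f1 t| <= M * e.
  move=> /andP[t0 te]; have := MVT_norm_le hf1 t0.
  move=> /(_ M); rewrite f10 !subr0 => h; apply: (@le_trans _ _ (M * t)).
    by apply: h => s /andP[s0 st]; rewrite hM // s0 (le_trans st).
  by rewrite ler_wpM2l.
by have := MVT_norm_le hf e0 h1; rewrite f0 !subr0 -mulrA expr2.
Qed.

Variables (gamma : R) (rho rho1 : R -> R).
Hypothesis hgamma : 1 / 2 < gamma < 1.
Local Notation g := (dpotential gamma).
Hypothesis hrho : forall t, is_derive t (1 : R) rho (rho1 t).
Hypothesis hrho1 : forall t, is_derive t (1 : R) rho1 (g (rho t)).
Hypothesis rho01 : forall t, 0 < rho t < 1.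

Lemma dpotential_le r : 0 < r < 1 -> `|g r| <= 2 * `|r - 1 / 2|.
Proof.
move=> /andP[r0 r1]; have /andP[g0 g1] := hgamma.
have -> : g r = (2 * (r - 1 / 2)) * (gamma ^+ 2 * (2 * r - 1) ^+ 2 - (2 * gamma - 1)).
  by rewrite /dpotential; field.
rewrite !normrM (ger0_norm (ler0n _ 2)) -[leRHS]mulr1 ler_wpM2l ?mulr_ge0 //.
have s1 : (2 * r - 1) ^+ 2 <= 1 by rewrite expr2; nra.
have s0 := sqr_ge0 (2 * r - 1).
rewrite ler_norml; apply/andP; split; nra.
Qed.

Lemma dpotential_le2 r : 0 < r < 1 -> `|g r| <= 2.
Proof.
move=> r01; apply: le_trans (dpotential_le r01) _.
rewrite -[leRHS]mulr1 ler_pM2l // ler_norml; move: r01; lra.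
Qed.

(** [rho] varies by less than 1 over a unit interval, so [|rho1| <= 1] somewhere in it, and
    [|rho''| <= 2] adds at most 2. The bound is uniform in the period. *)
Lemma rho1_le t : `|rho1 t| <= 3.
Proof.
have t1 : t <= t + 1 by lra.
have [c cab e] := MVT_segment t1 (fun t _ => hrho t) (is_derive_continuous hrho).
move: cab; rewrite in_itv /= => /andP[c0 c1].
have h := MVT_norm_le hrho1 c0 (fun s _ => dpotential_le2 (rho01 s)).
have := rho01 (t + 1); have := rho01 t => r0 r1.
have rc : `|rho1 c| <= 1.
  have -> : rho1 c = rho (t + 1) - rho t by rewrite e; ring.
  by rewrite ler_norml; lra.
have -> : rho1 t = rho1 c - (rho1 c - rho1 t) by ring.
apply: le_trans (ler_normB _ _) _; lra.
Qed.

Let second t s := rho (t + s) + rho (t - s) - 2 * rho t.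

Let shift_derive (f : R -> R) (df : R -> R) (a t : R) :
  (forall t, is_derive t (1 : R) f (df t)) ->
  is_derive t (1 : R) (fun s => f (a + s)) (df (a + t)) *
  is_derive t (1 : R) (fun s => f (a - s)) (- df (a - t)).
Proof.
move=> hf; split.
  have h : is_derive t (1 : R) (fun s => a + s) 1.
    have := is_deriveD (is_derive_cst a t (1 : R)) (is_derive_id t (1 : R)).
    by rewrite add0r.
  by have := @is_derive1_comp R f (fun s => a + s) t _ _ (hf (a + t)) h; rewrite mulr1.
have h : is_derive t (1 : R) (fun s => a - s) (-1).
  have := is_deriveB (is_derive_cst a t (1 : R)) (is_derive_id t (1 : R)).
  by rewrite sub0r.
by have := @is_derive1_comp R f (fun s => a - s) t _ _ (hf (a - t)) h; rewrite mulrN1.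
Qed.

Lemma second_derive a t : is_derive t (1 : R) (second a) (rho1 (a + t) - rho1 (a - t)).
Proof.
have [h1 h2] := shift_derive a t hrho.
have := is_deriveB (is_deriveD h1 h2) (is_derive_cst (2 * rho a) t (1 : R)).
by rewrite subr0.
Qed.

Lemma second_derive1 a t : is_derive t (1 : R) (fun s => rho1 (a + s) - rho1 (a - s))
  (g (rho (a + t)) + g (rho (a - t))).
Proof.
have [h1 h2] := shift_derive a t hrho1.
by have := is_deriveB h1 h2; rewrite opprK.
Qed.

Lemma second_le a e : 0 <= e -> `|second a e| <= 4 * e ^+ 2.
Proof.
move=> e0; apply: (taylor2_le (second_derive a) (second_derive1 a)) => //.
- by rewrite /second addr0 subr0; ring.
- by rewrite addr0 subr0 subrr.
move=> t _; apply: le_trans (ler_normD _ _) _.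
have := dpotential_le2 (rho01 (a + t)); have := dpotential_le2 (rho01 (a - t)); lra.
Qed.

Lemma increment_le a e : 0 <= e -> `|rho (a + e) - rho a| <= 3 * e.
Proof.
move=> e0; have ae : a <= a + e by lra.
have := MVT_norm_le hrho ae (fun s _ => rho1_le s).
by rewrite (_ : a + e - a = e) //; ring.
Qed.

Lemma decrement_le a e : 0 <= e -> `|rho (a - e) - rho a| <= 3 * e.
Proof.
by move=> e0; have := increment_le (a - e) e0; rewrite subrK distrC.
Qed.

(** An exact expansion of the cubic in the increments [p], [q], whose sum is twice the second
    difference [f]. The constant is [4 * (2 + 6 + 24) + 216]. *)
Lemma dpotential_second a t : 0 <= t ->
  `|g (rho (a + t)) + g (rho (a - t)) - 2 * g (rho a)| <= 344 * t ^+ 2.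
Proof.
move=> t0; have hs := second_le a t0; have hp := increment_le a t0.
have hq := decrement_le a t0.
set p := 2 * (rho (a + t) - rho a); set q := 2 * (rho (a - t) - rho a).
set s := 2 * rho a - 1; set f := second a t in hs *.
have -> : g (rho (a + t)) + g (rho (a - t)) - 2 * g (rho a) =
   - (2 * gamma - 1) * (2 * f) + gamma ^+ 2 * (3 * s ^+ 2 * (2 * f) +
     3 * s * (p ^+ 2 + q ^+ 2) + (2 * f) * (p ^+ 2 - p * q + q ^+ 2)).
  by rewrite /dpotential /f /second /p /q /s; ring.
have /andP[g0 g1] := hgamma.
have p6 : `|p| <= 6 * t by rewrite normrM ger0_norm //; lra.
have q6 : `|q| <= 6 * t by rewrite normrM ger0_norm //; lra.
have := rho01 (a + t); have := rho01 (a - t); have := rho01 a => ra rm rp.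
have p2 : `|p| <= 2 by rewrite ler_norml /p; lra.
have q2 : `|q| <= 2 by rewrite ler_norml /q; lra.
have s1 : `|s| <= 1 by rewrite ler_norml /s; lra.
clearbody p q s f.
have sqb (x c : R) : `|x| <= c -> x ^+ 2 <= c ^+ 2.
  move=> xc; rewrite -(real_normK (num_real x)) lerXn2r ?nnegrE //.
  exact: le_trans xc.
have pp := sqb _ _ p6; have qq := sqb _ _ q6; have ss := sqb _ _ s1.
have pq : `|p ^+ 2 - p * q + q ^+ 2| <= 12.
  have := sqb _ _ p2; have := sqb _ _ q2.
  have : `|p * q| <= 4 by rewrite normrM (_ : 4 = 2 * 2 :> R) ?ler_pM //; lra.
  rewrite !ler_norml; have := sqr_ge0 p; have := sqr_ge0 q; lra.
set F := 4 * t ^+ 2 in hs.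
have F0 : 0 <= F by apply: le_trans hs.
apply: le_trans (ler_normD _ _) _.
have b1 : `|- (2 * gamma - 1) * (2 * f)| <= 2 * F.
  rewrite normrM -[leRHS]mul1r; apply: ler_pM => //; first by rewrite ler_norml; lra.
  by rewrite normrM ger0_norm // ler_pM2l.
have b2 : `|3 * s ^+ 2 * (2 * f)| <= 3 * (2 * F).
  have -> : `|3 * s ^+ 2 * (2 * f)| = 3 * (s ^+ 2 * (2 * `|f|)).
    by rewrite (normrM _ (2 * f)) (normrM 3) (normrM 2) (ger0_norm (sqr_ge0 s)) !(ger0_norm (ler0n _ _)) -mulrA.
  rewrite ler_pM2l // -[leRHS]mul1r; apply: ler_pM; [exact: sqr_ge0 | by rewrite mulr_ge0 | |].
    by move: ss; rewrite expr1n.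
  by rewrite ler_pM2l.
have b3 : `|3 * s * (p ^+ 2 + q ^+ 2)| <= 3 * (72 * t ^+ 2).
  rewrite !normrM !(ger0_norm (ler0n _ _)) -mulrA ler_pM2l // -[leRHS]mul1r.
  apply: ler_pM => //; rewrite ger0_norm ?addr_ge0 ?sqr_ge0 //.
  move: pp qq; rewrite !exprMn; lra.
have b4 : `|2 * f * (p ^+ 2 - p * q + q ^+ 2)| <= 2 * F * 12.
  rewrite normrM; apply: ler_pM => //.
  by rewrite normrM ger0_norm // ler_pM2l.
have b5 : `|3 * s ^+ 2 * (2 * f) + 3 * s * (p ^+ 2 + q ^+ 2) +
    2 * f * (p ^+ 2 - p * q + q ^+ 2)| <= 3 * (2 * F) + 3 * (72 * t ^+ 2) + 2 * F * 12.
  exact: le_trans (ler_normD _ _) (lerD (le_trans (ler_normD _ _) (lerD b2 b3)) b4).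
have b6 : `|gamma ^+ 2 * (3 * s ^+ 2 * (2 * f) + 3 * s * (p ^+ 2 + q ^+ 2) +
    2 * f * (p ^+ 2 - p * q + q ^+ 2))| <= 3 * (2 * F) + 3 * (72 * t ^+ 2) + 2 * F * 12.
  rewrite normrM -[leRHS]mul1r; apply: ler_pM => //.
  rewrite ger0_norm ?sqr_ge0 // expr_le1 ?(ltW g1) //; lra.
rewrite /F in b1 b6; lra.
Qed.

(** The second derivative of the difference in [e] is the quantity of [dpotential_second]: the
    equation yields a fourth order error without any higher derivative of [rho]. *)
Lemma second_taylor a e : 0 <= e ->
  `|second a e - e ^+ 2 * g (rho a)| <= 344 * e ^+ 2 * e ^+ 2.
Proof.
move=> e0; set c := g (rho a).
have d1 t : is_derive t (1 : R) (fun s => second a s - s ^+ 2 * c)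
    (rho1 (a + t) - rho1 (a - t) - 2 * t * c).
  have h := is_deriveB (second_derive a t)
    (is_derive_mulr c (is_deriveX 2 (is_derive_id t (1 : R)))).
  have -> : (fun s => second a s - s ^+ 2 * c) = (second a - (fun r => c * r ^+ 2)).
    by apply: funext => s; rewrite [_ * c]mulrC.
  apply: is_derive_eq h _; rewrite /GRing.scale /= expr1 mulr2n; ring.
have d2 t : is_derive t (1 : R) (fun s => rho1 (a + s) - rho1 (a - s) - 2 * s * c)
    (g (rho (a + t)) + g (rho (a - t)) - 2 * c).
  have h := is_deriveB (second_derive1 a t) (is_derive_mulr (2 * c) (is_derive_id t (1 : R))).
  have -> : (fun s => rho1 (a + s) - rho1 (a - s) - 2 * s * c) =
      ((fun s => rho1 (a + s) - rho1 (a - s)) - (fun r => 2 * c * r)).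
    by apply: funext => s; rewrite [2 * s * c]mulrAC.
  by apply: is_derive_eq h _; rewrite mulr1.
apply: (taylor2_le d1 d2) => //.
- by rewrite /second addr0 subr0 expr0n mul0r; ring.
- by rewrite addr0 subr0 subrr mulr0 mul0r subrr.
move=> t /andP[t0 te]; apply: le_trans (dpotential_second a t0) _.
by rewrite ler_pM2l ?ltr0n // lerXn2r.
Qed.

(** The second derivative test for [rho'' = g (rho)], carried out on second differences. *)
Lemma dpotential_max_le0 c e : 0 < e -> (forall s, 0 <= s <= e -> second c s <= 0) ->
  g (rho c) <= 0.
Proof.
move=> e0 hs; rewrite leNgt; apply/negP => gc.
(* A step with [345 * s <= g (rho c)], whereas [second_taylor] would give
   [g (rho c) <= 344 * s^2 <= 344 * s]. *)
pose s := Num.min e (Num.min 1 (g (rho c) / 345)).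
have s0 : 0 < s by rewrite !lt_min e0 ltr01 divr_gt0 ?ltr0n.
have se : s <= e by rewrite ge_min lexx.
have s1 : s <= 1 by rewrite !ge_min lexx !orbT.
have sg : s * 345 <= g (rho c) by rewrite -ler_pdivlMr ?ltr0n // !ge_min lexx !orbT.
have := second_taylor c (ltW s0); rewrite ler_norml => /andP[h _].
have := hs s; rewrite (ltW s0) se => /(_ isT) h2.
have s2 : 0 < s ^+ 2 by rewrite exprn_gt0.
have h3 : s ^+ 2 * g (rho c) <= s ^+ 2 * (344 * s ^+ 2) by move: h; rewrite mulrAC; lra.
move: h3; rewrite ler_pM2l // => h3.
have : s ^+ 2 <= s by rewrite expr2 ler_piMl // ltW.
lra.
Qed.

(** Maximum principle: a maximum above [1/2] is interior, so [g <= 0] there, which means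
    [rho <= rho_+]; the right side is [2 rho_+ - 1]. *)
Lemma profile_le (L : R) t : 0 < L -> rho 0 = 1 / 2 -> rho L = 1 / 2 -> 0 <= t <= L ->
  2 * rho t - 1 <= Num.sqrt (2 * gamma - 1) / gamma.
Proof.
move=> L0 r0 rL t0L; have /andP[g0 g1] := hgamma.
have [c cL cmax] := EVT_max (ltW L0) (@is_derive_continuous R rho rho1 0 L hrho).
have tc : rho t <= rho c by apply: cmax; rewrite in_itv.
apply: (@le_trans _ _ (2 * rho c - 1)); first lra.
have q0 : 0 <= Num.sqrt (2 * gamma - 1) / gamma by rewrite divr_ge0 ?sqrtr_ge0 //; lra.
have [c2|c2] := leP (2 * rho c - 1) 0; first exact: le_trans c2 q0.
move: cL; rewrite in_itv /= => /andP[c0 cL].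
have c0' : 0 < c by rewrite lt_def c0 andbT; apply/eqP => cc; move: c2; rewrite cc r0; lra.
have cL' : c < L by rewrite lt_def cL andbT; apply/eqP => cc; move: c2; rewrite -cc rL; lra.
have gc : g (rho c) <= 0.
  apply: (@dpotential_max_le0 c (Num.min c (L - c))); first by rewrite lt_min c0' subr_gt0.
  move=> s /andP[s0]; rewrite le_min => /andP[sc sL]; rewrite /second.
  have : rho (c + s) <= rho c by apply: cmax; rewrite in_itv /=; lra.
  have : rho (c - s) <= rho c by apply: cmax; rewrite in_itv /=; lra.
  lra.
have gamma0 : 0 < gamma by lra.
rewrite ler_pdivlMr // -(@ler_sqr _ ((2 * rho c - 1) * gamma)) ?nnegrE ?sqrtr_ge0 //; last first.
  by rewrite mulr_ge0 // ltW.
rewrite sqr_sqrtr; last lra.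
move: gc; have -> : g (rho c) = (2 * rho c - 1) * (((2 * rho c - 1) * gamma) ^+ 2 - (2 * gamma - 1)).
  by rewrite /dpotential; ring.
by rewrite pmulr_rle0 // subr_le0.
Qed.

(** Let [A > 0] be the maximum of [|rho'|]. Then [|rho - 1/2| <= A L], so [|rho''| <= 2 A L]; as
    [rho'] vanishes somewhere by Rolle, [A <= 2 A L^2]. *)
Lemma profile_period_ge (L : R) : 0 < L -> rho 0 = 1 / 2 -> rho L = 1 / 2 -> rho1 0 != 0 ->
  1 / 2 <= L ^+ 2.
Proof.
move=> L0 r0 rL r10.
have [c cL [_ dc]] := Rolle L0 (fun t _ => @ex_derive _ _ _ _ _ _ _ (hrho t))
  (is_derive_continuous hrho) (etrans r0 (esym rL)).
have rc : rho1 c = 0 by have [_ <-] := hrho c.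
(* The maximum is taken of [rho1 ^+ 2], which unlike the absolute value is differentiable. *)
have h2 t := is_deriveX 2 (hrho1 t).
have [m mL mmax] := EVT_max (ltW L0) (is_derive_continuous h2).
set A := `|rho1 m|.
have hA t : 0 <= t <= L -> `|rho1 t| <= A.
  move=> tL; rewrite /A -!sqrtr_sqr; apply: ler_wsqrtr.
  by have := mmax t; rewrite in_itv; apply.
have A0 : 0 < A.
  apply: lt_le_trans (hA 0 _); first by rewrite normr_gt0.
  by rewrite lexx ltW.
have hr t : 0 <= t <= L -> `|rho t - 1 / 2| <= A * L.
  move=> /andP[t0 tL]; rewrite -r0; apply: (@le_trans _ _ (A * (t - 0))).
    by apply: (MVT_norm_le hrho t0) => s /andP[s0 st]; rewrite hA // s0 (le_trans st).
  by rewrite subr0 ler_pM2l.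
have hg t : 0 <= t <= L -> `|g (rho t)| <= 2 * (A * L).
  move=> tL; apply: le_trans (dpotential_le (rho01 t)) _.
  by rewrite ler_pM2l // hr.
move: cL mL; rewrite !in_itv /= => /andP[c0 cL] /andP[m0 mL].
have : A <= 2 * (A * L) * L.
  have AL : 0 <= 2 * (A * L) by rewrite !mulr_ge0 // ltW.
  have {1}-> : A = `|rho1 m - rho1 c| by rewrite rc subr0.
  have [cm|mc] := leP c m.
    apply: (@le_trans _ _ (2 * (A * L) * (m - c))).
      by apply: (MVT_norm_le hrho1 cm) => s /andP[sc sm]; apply: hg; lra.
    by rewrite ler_wpM2l //; lra.
  rewrite distrC; apply: (@le_trans _ _ (2 * (A * L) * (c - m))).
    by apply: (MVT_norm_le hrho1 (ltW mc)) => s /andP[sc sm]; apply: hg; lra.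
  by rewrite ler_wpM2l //; lra.
have -> : 2 * (A * L) * L = A * (2 * L ^+ 2) by ring.
rewrite -{1}[A]mulr1 ler_pM2l //; lra.
Qed.

End Profile.

(** * The profile sampled on the discrete torus *)

Section ProfileOnTorus.
Variables (R : realType) (d N : nat) (gamma K : R) (rho : R -> R).
Local Notation T := (torus d N).
Local Notation p := N.-1.+1.
Local Notation e1 := (basis_vec ord0 : T).
Hypotheses (hgamma : 1 / 2 < gamma < 1) (K_gt0 : 0 < K) (N_gt0 : (0 < N)%N).
Hypothesis hprofile : is_profile gamma K rho.
Local Notation g := (dpotential gamma).
Let u : T -> R := profile_on_torus K rho.
Let L := Num.sqrt K.
Let e := L / N%:R.
Let theta (x : T) : R := (x ord0 : nat)%:R * L / N%:R.

(** This is [rho_-], equal to [1 - rho_+] by symmetry. *)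
Definition gap : R := (1 - Num.sqrt (2 * gamma - 1) / gamma) / 2.

Lemma gap_gt0 : 0 < gap.
Proof.
have /andP[g0 g1] := hgamma; have gamma0 : 0 < gamma by lra.
rewrite /gap divr_gt0 // subr_gt0 ltr_pdivrMr // mul1r.
rewrite -ltr_sqr ?nnegrE ?sqrtr_ge0 ?(ltW gamma0) // sqr_sqrtr; last lra.
have : 0 < (1 - gamma) ^+ 2 by rewrite exprn_gt0 // subr_gt0.
rewrite !expr2; lra.
Qed.

Let N_gt0' : (0 : R) < N%:R. Proof. by rewrite ltr0n. Qed.
Let L_gt0 : 0 < L. Proof. by rewrite sqrtr_gt0. Qed.
Let e_ge0 : 0 <= e. Proof. by rewrite divr_ge0 // ltW. Qed.

Let per t : rho (t + L) = rho t. Proof. by have [h _ _ _ _] := hprofile. Qed.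
Let rho01 t : 0 < rho t < 1. Proof. by have [_ h _ _ _] := hprofile. Qed.

Let hrho t : is_derive t (1 : R) rho (derive1 rho t).
Proof.
by have [_ _ h _ _] := hprofile; have [dr _ _] := h t; rewrite derive1E; exact: derivableP.
Qed.

Let hrho1 t : is_derive t (1 : R) (derive1 rho) (g (rho t)).
Proof.
have [_ _ h _ _] := hprofile; have [_ dr /eqP] := h t.
by rewrite subr_eq0 derive1E => /eqP <-; exact: derivableP.
Qed.

Let rho0 : rho 0 = 1 / 2.
Proof.
have [_ _ _ [t1 /andP[t10 t1L] h] _] := hprofile.
by apply/(h 0); [rewrite lexx L_gt0 | left].
Qed.

Let rhoL : rho L = 1 / 2. Proof. by rewrite -rho0 -(per 0) add0r. Qed.

Lemma profile_mass_ge : 1 / 2 <= K.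
Proof.
have [_ _ _ _ d0] := hprofile.
have -> : K = L ^+ 2 by rewrite sqr_sqrtr // ltW.
by apply: (profile_period_ge hgamma hrho hrho1 rho01 L_gt0 rho0 rhoL); rewrite lt_eqF.
Qed.

Let theta_itv x : 0 <= theta x <= L.
Proof.
rewrite /theta divr_ge0 ?mulr_ge0 ?(ltW L_gt0) //= ler_pdivrMr // mulrC ler_pM2l // ler_nat.
by apply: ltnW; apply: leq_trans (ltn_ord (x ord0)) _; rewrite prednK.
Qed.

(** The potential is symmetric about [1/2], so [1 - rho] solves the same equation and the upper
    bound applies to it. *)
Lemma profile_ge_gap x : gap <= u x.
Proof.
have h1 t : is_derive t (1 : R) (fun s => 1 - rho s) (- derive1 rho t).
  by have := is_deriveB (is_derive_cst (1 : R) t (1 : R)) (hrho t); rewrite sub0r.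
have h2 t : is_derive t (1 : R) (fun s => - derive1 rho s) (g (1 - rho t)).
  have := is_deriveN (hrho1 t); congr is_derive.
  by rewrite /dpotential; ring.
have r01 t : 0 < 1 - rho t < 1 by have := rho01 t; lra.
have r0 : 1 - rho 0 = 1 / 2 by rewrite rho0; lra.
have rL : 1 - rho L = 1 / 2 by rewrite rhoL; lra.
have := profile_le hgamma h1 h2 r01 L_gt0 r0 rL (theta_itv x).
by rewrite /gap /u /profile_on_torus -/(theta x) /=; lra.
Qed.

Lemma profile_le_gap x : gap <= 1 - u x.
Proof.
have := profile_le hgamma hrho hrho1 rho01 L_gt0 rho0 rhoL (theta_itv x).
by rewrite /gap /u /profile_on_torus -/(theta x); lra.
Qed.

Let theta_wrap x : theta (x + e1) = theta x + e \/ theta (x + e1) = theta x + e - L.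
Proof.
have pN : p = N by rewrite prednK.
have xE : (x + e1) ord0 = ((x ord0).+1 %% p)%N :> nat.
  by rewrite !ffunE eqxx /= modnDmr addn1.
have := ltn_ord (x ord0); rewrite leq_eqVlt => /orP[/eqP xp|xp].
  right; rewrite /theta xE xp modnn mul0r mul0r /e.
  have -> : (x ord0 : nat)%:R = N%:R - 1 :> R.
    have -> : (N%:R : R) = (x ord0 : nat)%:R + 1.
      by rewrite natr1; congr (_%:R); exact: esym (etrans xp pN).
    by rewrite addrK.
  by field; rewrite gt_eqF.
left; rewrite /theta xE modn_small // /e -natr1; ring.
Qed.

Lemma profile_succ x : u (x + e1) = rho (theta x + e).
Proof.
rewrite /u /profile_on_torus -/(theta (x + e1)).
by case: (theta_wrap x) => ->; rewrite // -per subrK.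
Qed.

Lemma profile_pred x : u (x - e1) = rho (theta x - e).
Proof.
rewrite /u /profile_on_torus -/(theta (x - e1)).
have := theta_wrap (x - e1); rewrite subrK => -[->|->]; first by rewrite addrK.
by rewrite -(per (_ - e)); congr rho; ring.
Qed.

Lemma profile_grad x : `|u (x + e1) - u x| <= 3 * L / N%:R.
Proof. by rewrite profile_succ -mulrA; apply: (increment_le hgamma hrho hrho1 rho01). Qed.

Lemma profile_flat x i : i != ord0 -> u (x + basis_vec i) = u x.
Proof.
move=> i0; rewrite /u /profile_on_torus; congr (rho (_%:R * _ / _)).
by rewrite !ffunE eq_sym (negbTE i0) addr0.
Qed.

(** With [e^2 = K / N^2] the Laplacian misses [K g] by [344 K e^2]. The reaction misses [- g] by
    [(8 + 8 + 36) e^2], because the first order increments of the two neighbours enter through their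
    sum, a second difference. *)
Lemma profile_drift x : `|drift u gamma K x| <= 400 * K ^+ 2 / N%:R ^+ 2.
Proof.
set t := theta x; set s := 2 * rho t - 1.
pose f := rho (t + e) + rho (t - e) - 2 * rho t.
pose P := 2 * (rho (t + e) - rho t); pose Q := 2 * (rho (t - e) - rho t).
have hf : `|f| <= 4 * e ^+ 2 := second_le hgamma hrho hrho1 rho01 t e_ge0.
have hT : `|f - e ^+ 2 * g (rho t)| <= 344 * e ^+ 2 * e ^+ 2 :=
  second_taylor hgamma hrho hrho1 rho01 t e_ge0.
have hP : `|P| <= 6 * e.
  have := increment_le hgamma hrho hrho1 rho01 t e_ge0.
  by rewrite normrM ger0_norm //; lra.
have hQ : `|Q| <= 6 * e.
  have := decrement_le hgamma hrho hrho1 rho01 t e_ge0.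
  by rewrite normrM ger0_norm //; lra.
have NE : N%:R ^+ 2 * e ^+ 2 = K.
  rewrite /e exprMn mulrCA exprVn divff ?mulr1 ?sqr_sqrtr ?ltW //.
  by rewrite expf_eq0 /= gt_eqF.
have hr : `|reaction u gamma x + g (rho t)| <= 52 * e ^+ 2.
  have -> : reaction u gamma x + g (rho t) =
      2 * (gamma * f) - 2 * (gamma ^+ 2 * s ^+ 2 * f) - gamma ^+ 2 * s * (P * Q).
    rewrite /reaction profile_succ profile_pred /u /profile_on_torus -/(theta x) -/t.
    by rewrite /dpotential /f /s /P /Q; ring.
  have /andP[g0 g1] := hgamma; have := rho01 t => rt.
  have gg : `|gamma| <= 1 by rewrite ler_norml; lra.
  have s1 : `|s| <= 1 by rewrite ler_norml /s; lra.
  have b1 : `|gamma * f| <= 4 * e ^+ 2.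
    by rewrite normrM -[leRHS]mul1r ler_pM.
  have b2 : `|gamma ^+ 2 * s ^+ 2 * f| <= 4 * e ^+ 2.
    rewrite normrM -[leRHS]mul1r ler_pM // normrM !normrX.
    by rewrite mulr_ile1 ?exprn_ge0 // exprn_ile1.
  have b3 : `|gamma ^+ 2 * s * (P * Q)| <= 36 * e ^+ 2.
    rewrite normrM -[leRHS]mul1r ler_pM //.
      by rewrite normrM normrX mulr_ile1 ?exprn_ge0 // exprn_ile1.
    by rewrite normrM (_ : 36 * e ^+ 2 = (6 * e) * (6 * e)) ?ler_pM //; ring.
  move: b1 b2 b3; rewrite !ler_norml; lra.
have -> : drift u gamma K x = N%:R ^+ 2 * (f - e ^+ 2 * g (rho t)) + K * (reaction u gamma x + g (rho t)).
  rewrite /drift profile_succ profile_pred /u /profile_on_torus -/(theta x) -/t -/f.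
  by rewrite -NE; ring.
apply: le_trans (ler_normD _ _) _.
have N2 : 0 < (N%:R : R) ^+ 2 by rewrite exprn_gt0.
rewrite (normrM (N%:R ^+ 2)) (normrM K) (ger0_norm (ltW N2)) (ger0_norm (ltW K_gt0)).
have h1 := ler_wpM2l (ltW N2) hT; have h2 := ler_wpM2l (ltW K_gt0) hr.
have -> : 400 * K ^+ 2 / N%:R ^+ 2 = 400 * (K * e ^+ 2).
  have -> : e ^+ 2 = K / N%:R ^+ 2 by rewrite -NE mulrAC divff ?mul1r // gt_eqF.
  by field; rewrite gt_eqF.
have e1' : N%:R ^+ 2 * (344 * e ^+ 2 * e ^+ 2) = 344 * (K * e ^+ 2) by rewrite -NE; ring.
have e2' : K * (52 * e ^+ 2) = 52 * (K * e ^+ 2) by ring.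
have : 0 <= K * e ^+ 2 by rewrite mulr_ge0 ?sqr_ge0 // ltW.
rewrite e1' in h1; rewrite e2' in h2.
set z := K * e ^+ 2 in h1 h2 *; move: h1 h2; clearbody z.
move: (N%:R ^+ 2 * _) (K * `|_|) => y1 y2; lra.
Qed.

End ProfileOnTorus.

(** * The differential inequality *)

(** Here [L] is [sqrt K]; the assumption [L <= 2 K] turns [K * L] into [2 K^2], whence
    [54 = 2 * 27]. *)
Lemma cost_bound (R : realFieldType) (K L n b Q m t E : R) :
  0 < K -> 0 < L -> L <= 2 * K -> 0 < n -> 0 < b -> 0 <= m -> m <= n -> 0 <= t -> 0 <= E ->
  (K ^+ 2 / (n ^+ 2 * b ^+ 4) + 3 * K * L * 3 ^+ 2 / (n ^+ 2 * b ^+ 6)) *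
    (192 * Q ^+ 2 * (m ^+ 2 * E + 5 * m * t)) + 2 * K * L * E <=
  K ^+ 2 * ((b ^- 4 + 54 * b ^- 6) * (192 * Q ^+ 2) * (E + 5 * (m * t / n ^+ 2)) + 4 * E).
Proof.
move=> K0 L0 LK n0 b0 m0 mn t0 E0.
have n2 : 0 < n ^+ 2 by rewrite exprn_gt0.
have KL : K * L <= 2 * K ^+ 2 by rewrite expr2 mulrCA ler_pM2l.
have b4 : 0 < b ^- 4 by rewrite invr_gt0 exprn_gt0.
have b6 : 0 < b ^- 6 by rewrite invr_gt0 exprn_gt0.
set G := 192 * Q ^+ 2; have G0 : 0 <= G by rewrite mulr_ge0 ?ler0n ?sqr_ge0.
set z := m * t / n ^+ 2; have z0 : 0 <= z by rewrite divr_ge0 ?mulr_ge0 // ltW.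
set y := m ^+ 2 / n ^+ 2 * E.
have yE : y <= E.
  rewrite -[leRHS]mul1r ler_wpM2r // ler_pdivrMr // mul1r lerXn2r ?nnegrE // ltW //.
have y0 : 0 <= y by rewrite mulr_ge0 // divr_ge0 ?sqr_ge0.
have -> : (K ^+ 2 / (n ^+ 2 * b ^+ 4) + 3 * K * L * 3 ^+ 2 / (n ^+ 2 * b ^+ 6)) *
    (G * (m ^+ 2 * E + 5 * m * t)) = (K ^+ 2 * b ^- 4 + 27 * (K * L) * b ^- 6) * (G * (y + 5 * z)).
  by rewrite /y /z; field; rewrite !gt_eqF.
rewrite [leRHS]mulrDr; apply: lerD; last first.
  have := ler_wpM2r E0 KL; lra.
have -> : K ^+ 2 * ((b ^- 4 + 54 * b ^- 6) * G * (E + 5 * z)) =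
   (K ^+ 2 * b ^- 4 + 27 * (2 * K ^+ 2) * b ^- 6) * (G * (E + 5 * z)) by ring.
have K2 := sqr_ge0 K.
apply: ler_pM.
- by rewrite addr_ge0 ?mulr_ge0 ?ler0n ?(ltW b4) ?(ltW b6) ?(ltW K0) ?(ltW L0).
- by rewrite mulr_ge0 // addr_ge0 // mulr_ge0.
- by rewrite lerD2l ler_wpM2r ?(ltW b6) // ler_wpM2l ?ler0n.
- by rewrite ler_wpM2l // lerD2r.
Qed.

(** The constants are [20 = 4 * 5], [16 = 4 * 4] and [1920 = 192 * 2 * 5], the factor 2 coming from
    [K <= 2 K^2]. *)
Lemma rate_combine (R : realFieldType) (K E z w A a Q v B D X : R) :
  1 / 2 <= K -> 0 <= E -> 0 <= z -> 0 <= w -> 0 <= A -> 0 <= a -> 0 <= Q -> v <= z ->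
  B <= K ^+ 2 * (A * (E + 5 * z) + 4 * E) ->
  X <= D + 400 * K ^+ 2 * a * v + 4 * B + 192 * K * Q * (E + 5 * w) ->
  X - D <= (20 * A + 400 * a + 1920 * Q + 16) * K ^+ 2 * (E + z + w).
Proof.
move=> K0 E0 z0 w0 A0 a0 Q0 vz hB hX.
have K2 : 0 <= K ^+ 2 by exact: sqr_ge0.
have KK : K <= 2 * K ^+ 2 by rewrite expr2; nra.
have h1 : K * Q * (E + 5 * w) <= 2 * K ^+ 2 * Q * (E + 5 * w).
  rewrite -mulrA -[leRHS]mulrA ler_wpM2r //.
  by apply: mulr_ge0 => //; apply: addr_ge0 => //; exact: mulr_ge0.
have h2 : K ^+ 2 * a * v <= K ^+ 2 * a * z by rewrite ler_wpM2l // mulr_ge0.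
have pos x y : 0 <= x -> 0 <= y -> 0 <= K ^+ 2 * x * y 
  by move=> x0 y0; apply: mulr_ge0 => //; exact: mulr_ge0.
have := pos _ _ A0 E0; have := pos _ _ A0 z0; have := pos _ _ A0 w0.
have := pos _ _ a0 E0; have := pos _ _ a0 z0; have := pos _ _ a0 w0.
have := pos _ _ Q0 E0; have := pos _ _ Q0 z0; have := pos _ _ Q0 w0.
have := mulr_ge0 K2 E0; have := mulr_ge0 K2 z0; have := mulr_ge0 K2 w0.
lra.
Qed.

Lemma scale_le m n : (2 * (2 * m).+3 <= n)%N -> (m <= n)%N.
Proof. lia. Qed.

Section Rate.
Variables (R : realType) (d N : nat) (gamma K : R) (rho : R -> R).
Local Notation T := (torus d N).
Local Notation p := N.-1.+1.
Local Notation e1 := (basis_vec ord0 : T).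
Hypotheses (hgamma : 1 / 2 < gamma < 1) (K_gt0 : 0 < K) (N_gt0 : (0 < N)%N).
Hypothesis hprofile : is_profile gamma K rho.
Let u : T -> R := profile_on_torus K rho.
Let b := gap gamma.
Let L := Num.sqrt K.

Let b_gt0 : 0 < b. Proof. exact: gap_gt0. Qed.
Let u_ge x : b <= u x. Proof. exact: profile_ge_gap. Qed.
Let u_le x : b <= 1 - u x. Proof. exact: profile_le_gap. Qed.
Let u_in01 := u01 b_gt0 u_ge u_le.

(** [21 = 4 + 4 + 9 + 4]: the two flips, the exchange (through the squared gradient [9 K / N^2]) and
    [coupling1], each at most its share times [b ^- 2 >= 1]. *)
Definition coupling_bound : R := 21 * b ^- 2.

Let b2_ge1 : 1 <= b ^- 2.
Proof.
have b1 : b <= 1 by have := u_ge 0; have := u_le 0; lra.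
by rewrite -[leLHS]invr1 lef_pV2 ?posrE ?exprn_gt0 // expr_le1 // ltW.
Qed.

Let mobilityV_le x : (mobility u x)^-1 <= b ^- 2.
Proof.
by rewrite lef_pV2 ?posrE ?exprn_gt0 ?(mobility_gt0 u_in01) //; exact: mobility_ge.
Qed.

Let mobility_le1 x : mobility u x <= 1.
Proof. by have := u_ge x; have := u_le x; have := b_gt0; rewrite /mobility; nra. Qed.

Let spin_mean_le x : `|2 * u x - 1| <= 1.
Proof. by have /andP[? ?] := u_in01 x; rewrite ler_norml; lra. Qed.

Lemma coupling_le x eta : `|coupling u gamma K x eta| <= coupling_bound.
Proof.
have /andP[g0 g1] := hgamma; pose B := b ^- 2.
have B1 : 1 <= B := b2_ge1.
have mobV z : (mobility u z)^-1 <= B := mobilityV_le z.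
have B0 : 0 <= B by lra.
have gg : `|gamma| <= 1 by rewrite ler_norml; lra.
have pair y z : `|2 * gamma - 2 * gamma ^+ 2 * (2 * u y - 1) * (2 * u z - 1)| <= 4.
  have : `|gamma ^+ 2 * ((2 * u y - 1) * (2 * u z - 1))| <= 1.
    rewrite (normrM (gamma ^+ 2)) normrX (normrM (2 * u y - 1)).
    by rewrite mulr_ile1 ?mulr_ge0 ?exprn_ge0 ?exprn_ile1 // mulr_ile1.
  rewrite !ler_norml => h; have -> : 2 * gamma ^+ 2 * (2 * u y - 1) * (2 * u z - 1) =
    2 * (gamma ^+ 2 * ((2 * u y - 1) * (2 * u z - 1))) by ring.
  move: (gamma ^+ 2 * _) h => a /andP[h1 h2]; apply/andP; split; lra.
have mob y z : `|mobility u y / mobility u z| <= B.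
  have my := mobility_gt0 u_in01 y; have mz := mobility_gt0 u_in01 z.
  rewrite ger0_norm ?divr_ge0 ?(ltW my) ?(ltW mz) // -[leRHS]mul1r.
  by apply: ler_pM; rewrite ?invr_ge0 ?(ltW my) ?(ltW mz).
have c1 : `|coupling1 u gamma x| <= 4 * B.
  rewrite /coupling1 normrM; apply: ler_pM => //.
  rewrite (normrM (- 4 * gamma ^+ 2)) (normrM (- 4)) normrN (ger0_norm (ler0n _ _)) normrX.
  rewrite -mulrA -[leRHS]mulr1 ler_wpM2l // mulr_ile1 ?exprn_ge0 // exprn_ile1 //.
have c0 : `|coupling0 u gamma K x| <= 4 + 4 * B + 9 * B.
  rewrite /coupling0; apply: le_trans (ler_normB _ _) _; apply: lerD.
    apply: le_trans (ler_normD _ _) _; apply: lerD => //.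
    by rewrite normrM; apply: ler_pM.
  have mx := mobility_gt0 u_in01 x.
  have n0 : (0 : R) < N%:R by rewrite ltr0n.
  rewrite ger0_norm; last first.
    apply: divr_ge0; last by apply: ltW; exact: mulr_gt0.
    by apply: mulr_ge0; exact: sqr_ge0.
  have gr : (u (x + e1) - u x) ^+ 2 <= 9 * K / N%:R ^+ 2.
    have h := profile_grad hgamma K_gt0 N_gt0 hprofile x.
    rewrite -(real_normK (num_real (_ - _))).
    have -> : 9 * K / N%:R ^+ 2 = (3 * L / N%:R) ^+ 2.
      by rewrite !exprMn exprVn sqr_sqrtr ?(ltW K_gt0) //; ring.
    by rewrite lerXn2r ?nnegrE // (le_trans _ h).
  have -> : N%:R ^+ 2 * (u (x + e1) - u x) ^+ 2 / (K * mobility u x) =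
      (N%:R ^+ 2 * (u (x + e1) - u x) ^+ 2 / K) * (mobility u x)^-1.
    by rewrite invfM mulrA.
  apply: ler_pM; rewrite ?invr_ge0 ?(ltW mx) //.
    apply: divr_ge0; last exact: ltW.
    by apply: mulr_ge0; exact: sqr_ge0.
  rewrite ler_pdivrMr //.
  have := ler_wpM2l (sqr_ge0 (N%:R : R)) gr.
  by rewrite [X in _ <= X]mulrC divfK // gt_eqF // exprn_gt0.
rewrite /coupling /coupling_bound -/B; apply: le_trans (ler_normD _ _) _.
have : `|coupling1 u gamma x * centered u (x - e1) eta| <= 4 * B.
  rewrite normrM -[leRHS]mulr1; apply: ler_pM => //.
  have /andP[? ?] := u_in01 (x - e1); rewrite /centered.
  by case: (eta _) => /=; rewrite ler_norml; lra.
move: c0; lra.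
Qed.

Variable f : config d N -> R.
Hypotheses (f_gt0 : forall eta, 0 < f eta) (f_mass : expect u f = 1).
Local Notation Ent := (entropy (product_measure u) f).

Definition large_rate : R :=
  20 * ((b ^- 4 + 54 * b ^- 6) * (192 * coupling_bound ^+ 2)) + 400 / b
  + 1920 * coupling_bound ^+ 2 + 16.

Lemma rate_large (m1 m2 : nat) (j : 'I_d.-1.+1) :
  (0 < m2)%N -> (m2 <= m1)%N -> (2 * (2 * m1).+3 <= p)%N -> j != ord0 \/ m2 = 1%N ->
  expect u (generator gamma K f) - N%:R ^+ 2 *
    \sum_(z : T) \sum_i dirichlet_form u f z (z + basis_vec i) <=
  large_rate * K ^+ 2 * (Ent + m1%:R * #|T|%:R / N%:R ^+ 2 + #|T|%:R / (m1 * m2)%:R).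
Proof.
move=> m20 m21 m1p hj; set Q := coupling_bound.
have Q0 : 0 < Q by rewrite mulr_gt0 ?invr_gt0 ?exprn_gt0 ?ltr0n.
have L0 : 0 < L by rewrite sqrtr_gt0.
have Qm x : (mobility u x)^-1 <= Q.
  apply: le_trans (mobilityV_le x) _; rewrite -[leLHS]mul1r ler_wpM2r ?ler1n //.
  by apply: le_trans b2_ge1.
have E0 : 0 <= Ent by exact: (entropy_ge0 u_in01).
have n0 : (0 : R) < N%:R by rewrite ltr0n.
have := static_bound b_gt0 u_ge u_le f_gt0 f_mass K_gt0 L0 N_gt0 (ler0n _ 3)
  (profile_grad hgamma K_gt0 N_gt0 hprofile) (@profile_flat R d N K rho) Q0 coupling_le Qm
  (profile_drift hgamma K_gt0 N_gt0 hprofile) m20 m21 m1p hj.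
have K2 : 1 / 2 <= K := profile_mass_ge hgamma K_gt0 hprofile.
have LK : L <= 2 * K.
  rewrite -ler_sqr ?nnegrE ?(ltW L0) ?mulr_ge0 ?(ltW K_gt0) // sqr_sqrtr ?(ltW K_gt0) //.
  by rewrite exprMn !expr2; nra.
have m1n : (m1%:R : R) <= N%:R by rewrite ler_nat -[leqRHS](prednK N_gt0); exact: scale_le.
have := @cost_bound R K L N%:R b Q m1%:R #|T|%:R Ent K_gt0 L0 LK n0 b_gt0
  (ler0n _ _) m1n (ler0n _ _) E0.
rewrite -/(flow_cost u f Q m1) -/(bond_cost u b f K L 3 Q m1).
set D := \sum_(z : T) _; set t := (#|T|%:R : R); set z := m1%:R * t / N%:R ^+ 2; set w := t / _.
move=> hB hX; have t0 : 0 <= t by exact: ler0n.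
have n2 : 0 < (N%:R : R) ^+ 2 by rewrite exprn_gt0.
have m10 : (1 : R) <= m1%:R by rewrite ler1n (leq_trans m20).
apply: (rate_combine (v := t / N%:R ^+ 2) K2 E0 _ _ _ _ _ _ hB).
- by rewrite divr_ge0 ?mulr_ge0 // ltW.
- by rewrite divr_ge0.
- apply: mulr_ge0; last by apply: mulr_ge0; [exact: ler0n | exact: sqr_ge0].
  apply: addr_ge0; first by rewrite invr_ge0 exprn_ge0 // ltW.
  by apply: mulr_ge0; [exact: ler0n | rewrite invr_ge0 exprn_ge0 // ltW].
- by rewrite invr_ge0 ltW.
- exact: sqr_ge0.
- by rewrite ler_wpM2r ?invr_ge0 ?(ltW n2) // ler_peMl.
apply: le_trans hX _; rewrite le_eqVlt; apply/orP; left; apply/eqP.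
by rewrite /w -[5 * t / _]mulrA -/Q; ring.
Qed.

End Rate.

(** * A crude bound for small tori *)

Section SmallRate.
Variables (R : realType) (d N : nat) (u : torus d N -> R).
Local Notation T := (torus d N).
Local Notation conf := (config d N).
Variable b : R.
Hypotheses (b_gt0 : 0 < b) (u_ge : forall x, b <= u x) (u_le : forall x, b <= 1 - u x).
Variable f : conf -> R.
Hypotheses (f_gt0 : forall eta, 0 < f eta) (f_mass : expect u f = 1).
Let u_in01 := u01 b_gt0 u_ge u_le.

(** The mass [nu eta * f eta] of a single configuration is at most 1, and [nu eta] is at least
    [b ^+ #|T|]. *)
Lemma density_le eta : f eta <= b ^- #|T|.
Proof.
have nu_ge : b ^+ #|T| <= product_measure u eta.
  rewrite -prodr_const; apply: ler_prod => x _; rewrite (ltW b_gt0) /=.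
  by case: (eta x); [exact: u_ge | exact: u_le].
have bT : 0 < b ^+ #|T| by exact: exprn_gt0.
rewrite -[leRHS]mul1r ler_pdivlMr // -f_mass mulrC.
apply: (@le_trans _ _ (product_measure u eta * f eta)).
  by rewrite ler_wpM2r // ltW.
rewrite /expect (bigD1 eta) //= lerDl sumr_ge0 // => xi _.
by rewrite mulr_ge0 // ltW // product_measure_gt0.
Qed.

Lemma generator_le (gamma K : R) : 0 <= gamma <= 1 -> 0 <= K ->
  expect u (generator gamma K f) <=
  b ^- #|T| * #|T|%:R * (N%:R ^+ 2 * d.-1.+1%:R + 4 * K).
Proof.
move=> hg K0; rewrite -[leRHS](expect_cst u); apply: ler_expect => // eta.
set B := b ^- #|T|; have hB xi : f xi - f eta <= B.
  have := density_le xi; have := f_gt0 eta; rewrite -/B; lra.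
have B0 : 0 <= B by rewrite invr_ge0 exprn_ge0 // ltW.
have -> : B * #|T|%:R * (N%:R ^+ 2 * d.-1.+1%:R + 4 * K) =
   N%:R ^+ 2 * (#|T|%:R * (d.-1.+1%:R * B)) + K * (#|T|%:R * (4 * B)) by ring.
rewrite /generator; apply: lerD; apply: ler_wpM2l => //; rewrite ?sqr_ge0 //.
  rewrite /exclusion_gen [leRHS]mulr_natl -sumr_const; apply: ler_sum => x _.
  by rewrite [leRHS]mulr_natl -[X in _ *+ X]card_ord -sumr_const; apply: ler_sum.
rewrite /glauber_gen [leRHS]mulr_natl -sumr_const; apply: ler_sum => x _.
have /andP[r0 r4] := glauber_rate_bounds hg (translate x eta).
apply: (@le_trans _ _ (glauber_rate gamma (translate x eta) * B)).
  by rewrite ler_wpM2l.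
by rewrite ler_wpM2r.
Qed.

End SmallRate.

Lemma card_torus (d N : nat) : (0 < d)%N -> (0 < N)%N -> #|torus d N| = (N ^ d)%N.
Proof. by move=> d0 N0; rewrite card_ffun !card_ord !prednK. Qed.

(** * The scale [ell] and the choice of the boxes *)

Section Scales.
Variable R : realType.

Lemma expR1_le4 : expR 1 <= 4 :> R.
Proof.
have h : expR (1 / 3) <= 13 / 9 :> R.
  apply: le_trans (expR_le_quadratic _) _; first by rewrite ger0_norm //; lra.
  by rewrite expr2; lra.
have -> : (1 : R) = 1 / 3 + (1 / 3 + 1 / 3) by lra.
rewrite !expRD; have e0 := expR_ge0 (1 / 3 : R).
apply: (@le_trans _ _ (13 / 9 * (13 / 9 * (13 / 9)))); last lra.
by apply: ler_pM => //; rewrite ?mulr_ge0 //; apply: ler_pM.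
Qed.

Lemma scale_gt0 d N (l : R) : (0 < d)%N -> (0 < N)%N -> is_scale d N l -> 0 < l.
Proof.
have N0 M : (0 < M)%N -> (0 : R) < M%:R by rewrite ltr0n.
by case: d => [//|[|[|d]]] _ /N0 M0 /= => [->|[]//|->]; apply: powR_gt0.
Qed.

Lemma scale1_le N (l : R) : (0 < N)%N -> is_scale 1 N l -> l <= N%:R.
Proof.
move=> N0 /= ->; rewrite -[leRHS]powRr1 ?ler0n //; apply: ler_powR; rewrite ?ler1n //.
lra.
Qed.

(** In the form [ell^d <= 16 N^(4/3)] the cases [d = 2] and [d >= 3] are treated alike. The
    logarithm is at least 1 for [l > 4], and [16^3 = 4^6] takes care of [l <= 4]. *)
Lemma scale_cube d N (l : R) : (1 < d)%N -> (0 < N)%N -> is_scale d N l ->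
  (l ^+ d) ^+ 3 <= 16 ^+ 3 * N%:R ^+ 4.
Proof.
move=> d1 N0; have n1 : (1 : R) <= N%:R by rewrite ler1n.
have n4 : (1 : R) <= N%:R ^+ 4 by rewrite exprn_ege1.
have c1 : (1 : R) <= 16 ^+ 3 by rewrite exprn_ege1 // ler1n.
case: d d1 => [|[|[|d]]] // _ => [[l0 lN]|].
  rewrite exprAC; have [l4|l4] := leP l 4.
    apply: (@le_trans _ _ (16 ^+ 3)); last by rewrite ler_peMr // (le_trans ler01).
    rewrite (_ : 16 ^+ 3 = (4 ^+ 3) ^+ 2 :> R); last by ring.
    by rewrite lerXn2r ?nnegrE ?exprn_ge0 ?(ltW l0) // lerXn2r ?nnegrE ?(ltW l0).
  have ln1 : 1 <= ln l.
    rewrite -[leLHS](expRK (1 : R)) ler_ln ?posrE ?expR_gt0 //.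
    exact: le_trans expR1_le4 (ltW l4).
  have l3 : l ^+ 3 <= N%:R ^+ 2 by rewrite -lN ler_peMr ?exprn_ge0 // ltW.
  apply: (@le_trans _ _ ((N%:R ^+ 2) ^+ 2)).
    by rewrite lerXn2r ?nnegrE ?exprn_ge0 ?(ltW l0).
  by rewrite -exprM ler_peMl // (le_trans ler01).
move=> ->; rewrite -exprM -powR_mulrn ?powR_ge0 // -powRrM.
have -> : 4 / (3 * d.+3%:R) * (d.+3 * 3)%:R = 4%:R :> R.
  have : (d.+3%:R : R) != 0 by rewrite pnatr_eq0.
  by rewrite natrM; move: (d.+3%:R) => x x0; field.
rewrite powR_mulrn ?ler0n // ler_peMl // (le_trans ler01) //.
Qed.

(** For small [N] this lets [(N / ell)^d] absorb a constant. *)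
Lemma scale_volume_ge d N (l : R) : (0 < d)%N -> (0 < N)%N -> is_scale d N l ->
  1 <= 16 * (N%:R / l) ^+ d.
Proof.
move=> d0 N0 hl; have l0 := scale_gt0 d0 N0 hl.
have n1 : (1 : R) <= N%:R by rewrite ler1n.
have [d1|d1] := leqP d 1.
  have dE : d = 1%N by case: d d0 d1 hl => [|[]].
  subst d; have := scale1_le N0 hl; rewrite expr1 mulrA ler_pdivlMr // mul1r; lra.
have ld : 0 < l ^+ d by rewrite exprn_gt0.
rewrite expr_div_n mulrA ler_pdivlMr // mul1r.
rewrite -(@ler_pXn2r _ 3) ?nnegrE ?mulr_ge0 ?exprn_ge0 ?(ltW l0) //.
apply: le_trans (scale_cube d1 N0 hl) _; rewrite exprMn -exprM ler_wpM2l ?exprn_ge0 //.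
by rewrite ler_weXn2l //; lia.
Qed.

(** The integer part of [N^(2/3)]. If [N < 10 m], then [m^3 <= N^2 < 100 m^2] gives [m < 100] and
    [N < 1000]: this is the origin of the threshold. *)
Lemma two_dim_width N : (1000 <= N)%N ->
  exists m, [/\ (0 < m)%N, (m ^ 3 <= N ^ 2)%N, (N ^ 2 <= 8 * m ^ 3)%N
    & (2 * (2 * m).+3 <= N)%N].
Proof.
move=> N1000.
have exm : exists m, (m ^ 3 <= N ^ 2)%N by exists 0%N.
have bdm m : (m ^ 3 <= N ^ 2)%N -> (m <= N ^ 2)%N.
  by apply: leq_trans; case: m => // m; rewrite expnS leq_pmulr // expn_gt0.
case: (ex_maxnP exm bdm) => m mN mmax.
have m1 : (N ^ 2 < m.+1 ^ 3)%N by rewrite ltnNge; apply/negP => /mmax; rewrite ltnn.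
have m0 : (0 < m)%N.
  by apply: mmax; rewrite exp1n expn_gt0; lia.
exists m; split=> //.
  apply: leq_trans (ltnW m1) _; rewrite (_ : 8 = 2 ^ 3)%N // -expnMn leq_exp2r //; lia.
have : (10 * m <= N)%N; last lia.
rewrite leqNgt; apply/negP => Nm.
have h1 : (N * N < 100 * (m * m))%N.
  have : (N * N < (10 * m) * (10 * m))%N by apply: ltn_mul.
  lia.
have h2 : (m * (m * m) <= N * N)%N by move: mN; rewrite !expnS expn0 !muln1.
have h3 : (m < 100)%N.
  rewrite -(@ltn_pmul2r (m * m)) ?muln_gt0 ?m0 //; lia.
lia.
Qed.

(** For [d >= 2] the errors [m N^d / N^2] and [N^d / m^2] balance at [m^3 = N^2]; the first is at
    most 16 and the second at most [8 * 16] times [(N / ell)^d], in all 144. For [d = 1] both are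
    bounded and [(N / ell) >= 1]. *)
Lemma scale_choice d N (l : R) : (0 < d)%N -> (1000 <= N)%N -> is_scale d N l ->
  exists m1 m2, exists j : 'I_d.-1.+1,
  [/\ (0 < m2)%N, (m2 <= m1)%N, (2 * (2 * m1).+3 <= N.-1.+1)%N, j != ord0 \/ m2 = 1%N &
    m1%:R * (N ^ d)%:R / N%:R ^+ 2 + (N ^ d)%:R / (m1 * m2)%:R
      <= 144 * (N%:R / l) ^+ d :> R].
Proof.
move=> d0 N1000 hl; have N0 : (0 < N)%N by lia.
have l0 := scale_gt0 d0 N0 hl; have n0 : (0 : R) < N%:R by rewrite ltr0n.
have [d1|d1] := leqP d 1.
  have dE : d = 1%N by case: d d0 d1 hl => [|[]].
  subst d; exists (N %/ 10)%N, 1%N, ord0; rewrite prednK //.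
  have mN := leq_trunc_div N 10; have Nm := ltn_ceil N (isT : (0 < 10)%N).
  set m := (N %/ 10)%N in mN Nm *.
  have m0 : (0 < m)%N by lia.
  split=> //; [lia|by right|].
  rewrite expr1 expn1 muln1.
  have nl : 1 <= N%:R / l by rewrite ler_pdivlMr // mul1r (scale1_le N0 hl).
  have a1 : m%:R * N%:R / N%:R ^+ 2 <= 1 :> R.
    rewrite ler_pdivrMr ?exprn_gt0 // mul1r expr2 ler_wpM2r // ler_nat; lia.
  have a2 : N%:R / m%:R <= 20 :> R.
    by rewrite ler_pdivrMr ?ltr0n // -(natrM _ 20) ler_nat; lia.
  lra.
have [m [m0 mN Nm m4]] := two_dim_width N1000.
exists m, m, ord_max; rewrite prednK //; split=> //.
  by left; rewrite -val_eqE /=; lia.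
have m0' : (0 : R) < m%:R by rewrite ltr0n.
have A0 : 0 < l ^+ d by rewrite exprn_gt0.
have mA : m%:R * l ^+ d <= 16 * N%:R ^+ 2.
  rewrite -(@ler_pXn2r _ 3) ?nnegrE ?mulr_ge0 ?exprn_ge0 ?(ltW l0) //.
  have h1 := scale_cube d1 N0 hl.
  have h2 : (m%:R : R) ^+ 3 <= N%:R ^+ 2 by rewrite -!natrX ler_nat.
  have -> : (16 * (N%:R : R) ^+ 2) ^+ 3 = N%:R ^+ 2 * (16 ^+ 3 * N%:R ^+ 4) by ring.
  by rewrite exprMn; apply: ler_pM; rewrite ?exprn_ge0 ?(ltW l0).
have n8 : (N%:R : R) ^+ 2 <= 8 * m%:R ^+ 3 by rewrite -!natrX -(natrM _ 8) ler_nat.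
rewrite expr_div_n natrX natrM; set t := (N%:R : R) ^+ d.
have t0 : 0 < t by rewrite exprn_gt0.
have n2 : 0 < (N%:R : R) ^+ 2 by rewrite exprn_gt0.
have b1 : t / (m%:R * m%:R) <= 8 * (m%:R * t / N%:R ^+ 2).
  rewrite ler_pdivrMr ?mulr_gt0 // -mulrA mulrAC mulrA mulrA ler_pdivlMr //.
  have := ler_wpM2l (ltW t0) n8; rewrite !exprS expr0 !mulr1; lra.
have b2 : m%:R * t / N%:R ^+ 2 <= 16 * (t / l ^+ d).
  rewrite ler_pdivrMr // mulrA mulrAC ler_pdivlMr //.
  have := ler_wpM2l (ltW t0) mA; lra.
lra.
Qed.

End Scales.

Section Constant.
Variables (R : realType) (d : nat) (gamma : R).

(** The 4 and the 8 come from [1 <= 4 K^2] and [4 K <= 8 K^2], valid for [K >= 1/2]. *)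
Definition small_rate (n : nat) : R :=
  gap gamma ^- (n ^ d) * (n ^ d)%:R * (4 * n%:R ^+ 2 * d.-1.+1%:R + 8).

Definition entropy_rate : R := 144 * large_rate gamma + 16 * small_rate 1000.

Hypothesis hgamma : 1 / 2 < gamma < 1.

Lemma gap_le1 : gap gamma <= 1.
Proof.
have /andP[g0 g1] := hgamma.
have : 0 <= Num.sqrt (2 * gamma - 1) / gamma by rewrite divr_ge0 ?sqrtr_ge0 //; lra.
rewrite /gap; lra.
Qed.

Lemma large_rate_ge0 : 0 <= large_rate gamma.
Proof.
have b0 := gap_gt0 hgamma; rewrite /large_rate.
have b4 : 0 <= gap gamma ^- 4 by rewrite invr_ge0 exprn_ge0 // ltW.
have b6 : 0 <= gap gamma ^- 6 by rewrite invr_ge0 exprn_ge0 // ltW.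
have Q0 := sqr_ge0 (coupling_bound gamma).
have h1 : 0 <= (gap gamma ^- 4 + 54 * gap gamma ^- 6) * (192 * coupling_bound gamma ^+ 2).
  by apply: mulr_ge0; [apply: addr_ge0 => // |]; apply: mulr_ge0; rewrite ?ler0n.
have h2 : 0 <= 400 / gap gamma by rewrite divr_ge0 ?ler0n // ltW.
have h3 : 0 <= 1920 * coupling_bound gamma ^+ 2 by rewrite mulr_ge0 ?ler0n.
lra.
Qed.

Lemma small_rate_ge0 n : 0 <= small_rate n.
Proof.
rewrite /small_rate; apply: mulr_ge0; first apply: mulr_ge0; rewrite ?ler0n //.
  by rewrite invr_ge0 exprn_ge0 // ltW // gap_gt0.
Qed.

Lemma small_rate_le (K : R) (N n : nat) : (0 < d)%N -> (0 < N)%N -> (N <= n)%N -> 1 / 2 <= K ->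
  gap gamma ^- #|torus d N| * #|torus d N|%:R * (N%:R ^+ 2 * d.-1.+1%:R + 4 * K)
    <= small_rate n * K ^+ 2.
Proof.
move=> d0 N0 Nn K12; have b0 := gap_gt0 hgamma.
have K0 : 0 < K by lra.
have K2 : 0 <= K ^+ 2 by exact: sqr_ge0.
rewrite card_torus // /small_rate -mulrA -[leRHS]mulrA -[leRHS]mulrA.
have Nd : (N ^ d <= n ^ d)%N by rewrite leq_exp2r.
have bN : gap gamma ^- (N ^ d) <= gap gamma ^- (n ^ d).
  rewrite lef_pV2 ?posrE ?exprn_gt0 //.
  by rewrite ler_wiXn2l ?(ltW b0) // gap_le1.
have N2 : (N%:R : R) ^+ 2 <= n%:R ^+ 2.
  by rewrite lerXn2r ?nnegrE ?ler0n // ler_nat.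
have d' : (0 : R) <= d.-1.+1%:R by exact: ler0n.
have lhs0 : 0 <= N%:R ^+ 2 * d.-1.+1%:R + 4 * K.
  by rewrite addr_ge0 // mulr_ge0 ?sqr_ge0 // ltW.
apply: ler_pM => //.
- by rewrite invr_ge0 exprn_ge0 // ltW.
- by rewrite mulr_ge0 // ler0n.
apply: ler_pM; rewrite ?ler0n ?ler_nat //.
have KK : 1 <= 4 * K ^+ 2 by rewrite expr2; nra.
have KK' : 4 * K <= 8 * K ^+ 2 by rewrite expr2; nra.
have h1 : N%:R ^+ 2 * d.-1.+1%:R <= n%:R ^+ 2 * d.-1.+1%:R * (4 * K ^+ 2).
  apply: (@le_trans _ _ (n%:R ^+ 2 * d.-1.+1%:R)); first by rewrite ler_wpM2r.
  by rewrite ler_peMr // mulr_ge0 // sqr_ge0.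
rewrite [leRHS]mulrDl; apply: lerD => //.
have -> : 4 * n%:R ^+ 2 * d.-1.+1%:R * K ^+ 2 = n%:R ^+ 2 * d.-1.+1%:R * (4 * K ^+ 2) by ring.
exact: h1.
Qed.

End Constant.

(** The constant adds the rates of the two regimes of [N], each being nonnegative; 144 and 16 are
    the constants of [scale_choice] and [scale_volume_ge]. *)
Theorem entropy_rate_bound (R : realType) (d N : nat) (gamma K t l : R) (rho : R -> R) :
  (0 < d)%N -> (0 < N)%N -> 1 / 2 < gamma < 1 -> 0 < K -> is_profile gamma K rho ->
  is_scale d N l -> 0 <= t ->
  let nu : config d N -> R := product_measure (profile_on_torus K rho) in
  let H r := entropy nu (density gamma K r nu) in
  derivable H t 1 /\
  derive1 H t <= entropy_rate d gamma * K ^+ 2 * (H t + (N%:R / l) ^+ d).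
Proof.
move=> d0 N0 hgamma K0 hprof hl t0 nu H.
set u : torus d N -> R := profile_on_torus K rho in nu H *.
have b0 := gap_gt0 hgamma.
have u_ge x : gap gamma <= u x by exact: profile_ge_gap.
have u_le x : gap gamma <= 1 - u x by exact: profile_le_gap.
have u_in01 := u01 b0 u_ge u_le.
have g01 : 0 <= gamma <= 1 by have /andP[? ?] := hgamma; apply/andP; split; lra.
have K12 := profile_mass_ge hgamma K0 hprof.
have [dH prod_le] := entropy_production u_in01 g01 (ltW K0) t0.
split; first exact: dH.
set f := density gamma K t nu in prod_le.
have f0 eta : 0 < f eta by apply: density_gt0 => //; exact: ltW.
have f1 : expect u f = 1 by apply: density_mass => //; exact: ltW.
have H0 : 0 <= H t := entropy_ge0 u_in01 f0 f1.
have K2 : 0 <= K ^+ 2 by exact: sqr_ge0.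
have l0 := scale_gt0 d0 N0 hl.
have L0 := large_rate_ge0 hgamma; have S0 := small_rate_ge0 d hgamma 1000.
set y := (N%:R / l) ^+ d; have y0 : 0 <= y by rewrite exprn_ge0 // divr_ge0 ?ler0n // ltW.
have hsmall := fun N1000 : (N <= 1000)%N => small_rate_le hgamma d0 N0 N1000 K12.
rewrite /entropy_rate; set S := small_rate _ _ _ in S0 hsmall *; clearbody S.
have split_rate : (144 * large_rate gamma + 16 * S) * K ^+ 2 * (H t + y) =
   144 * (large_rate gamma * K ^+ 2 * (H t + y)) + 16 * (S * K ^+ 2 * (H t + y)).
  by ring.
have LH : 0 <= large_rate gamma * K ^+ 2 * (H t + y).
  by apply: mulr_ge0; [exact: mulr_ge0 | exact: addr_ge0].
have SH : 0 <= S * K ^+ 2 * (H t + y).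
  by apply: mulr_ge0; [exact: mulr_ge0 | exact: addr_ge0].
apply: (le_trans prod_le); rewrite split_rate.
have [N1000|N1000] := leqP 1000 N.
  have [m1 [m2 [j [m20 m21 m1p hj hm]]]] := scale_choice d0 N1000 hl.
  have := rate_large hgamma K0 N0 hprof f0 f1 m20 m21 m1p hj.
  rewrite card_torus // -/f => /le_trans; apply.
  have : large_rate gamma * K ^+ 2 * (H t + m1%:R * (N ^ d)%:R / N%:R ^+ 2 +
      (N ^ d)%:R / (m1 * m2)%:R) <= large_rate gamma * K ^+ 2 * (144 * (H t + y)).
    apply: ler_wpM2l; first exact: mulr_ge0.
    by rewrite mulrDr -addrA; apply: lerD => //; rewrite ler_peMl // ler1n.
  rewrite [X in _ <= X -> _]mulrCA => /le_trans; apply.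
  by rewrite lerDl mulr_ge0 // ler0n.
set D := \sum_(z : torus d N) _.
have D0 : 0 <= D.
  apply: sumr_ge0 => z _; apply: sumr_ge0 => i _.
  by rewrite -(expect_cst u 0); apply: ler_expect => // eta; exact: sqr_ge0.
have N2D : 0 <= (N%:R : R) ^+ 2 * D by rewrite mulr_ge0 // sqr_ge0.
have gl := generator_le b0 u_ge u_le f0 f1 g01 (ltW K0).
rewrite -/f in gl.
have {}hsmall := hsmall (ltnW N1000).
have := ler_wpM2l (mulr_ge0 S0 K2) (scale_volume_ge d0 N0 hl); rewrite mulr1 -/y.
have : S * K ^+ 2 * y <= S * K ^+ 2 * (H t + y).
  by apply: ler_wpM2l; [exact: mulr_ge0 | rewrite lerDr].
rewrite [_ * (16 * y)]mulrCA.
move: gl hsmall N2D SH LH.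
move: (expect u _) (_ * _ * (N%:R ^+ 2 * _ + _)) => x1 x2.
move: (N%:R ^+ 2 * D) => x3.
lra.
Qed.
Theorem theorem2p2 (R : realType) (d : nat) (hd : (0 < d)%N)
    (gamma : R) (hgamma : 1 / 2 < gamma < 1)
    (ell : nat -> R)
    (hell : forall N : nat, (0 < N)%N -> is_scale d N (ell N)) :
  exists c : forall N : nat, (torus d N -> R) -> R,
  forall (K : nat -> R) (rho : nat -> R -> R),
    (forall N : nat, (0 < N)%N -> 0 < K N) ->
    (forall M N : nat, (0 < M)%N -> (M <= N)%N -> K M <= K N) ->
    K N @[N --> \oo] --> +oo ->
    K N / N%:R @[N --> \oo] --> (0 : R) ->
    (forall N : nat, (0 < N)%N -> is_profile gamma (K N) (rho N)) ->
    (exists B : R, forall N : nat, (0 < N)%N -> K N ^+ 2 / ell N ^+ d <= B) ->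
    let u (N : nat) : torus d N -> R := profile_on_torus (K N) (rho N) in
    let nu (N : nat) : config d N -> R := product_measure (u N) in
    let H (N : nat) (t : R) : R :=
      entropy (nu N) (density gamma (K N) t (nu N)) in
    (exists B : R, forall N : nat, (0 < N)%N -> `|c N (u N)| <= B) /\
    (forall (N : nat) (t : R), (0 < N)%N -> 0 <= t ->
       derivable (H N) t 1 /\
       derive1 (H N) t <=
         c N (u N) * K N ^+ 2 * (H N t + (N%:R / ell N) ^+ d)).
Proof.
(* The same number serves for every [N] and every profile, so uniform boundedness is immediate. *)
exists (fun _ _ => entropy_rate d gamma) => K rho K0 _ _ _ hprof _ u nu H; split.
  by exists `|entropy_rate d gamma|.
by move=> N t N0 t0; apply: entropy_rate_bound; auto.
Qed.
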